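(* Let $m\ge 1$. There exist a bounded domain $U\subset\mathbb{C}^m$ which is biholomorphic to the unit ball of $\mathbb{C}^m$ and a holomorphic map $F:U\to\mathbb{C}^m$ with a dense orbit; that is, there is a sequence $\{p_n\}_{n=0}^\infty\subset U$, dense in $U$, with $F(p_n)=p_{n+1}$ for all $n\ge 0$.
   Context: A domain is a connected open set. The unit ball of $\mathbb{C}^m$ is $\{z\in\mathbb{C}^m:\|z\|<1\}$ with the Euclidean norm. *)

(* Defs.v *)
From HB Require Import structures.
From mathcomp Require Import all_boot all_order all_algebra.
From mathcomp Require Import all_classical all_reals all_analysis.
From mathcomp Require Import complex.
Set Implicit Arguments.
Unset Strict Implicit.
Unset Printing Implicit Defensive.
Import Order.TTheory GRing.Theory Num.Theory.
Import numFieldNormedType.Exports.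
Local Open Scope classical_set_scope.
Local Open Scope ring_scope.

(* The usual metric structure of C, which real_closed leaves undeclared. *)
HB.instance Definition _ (R : rcfType) :=
  PseudoPointedMetric.copy R[i] R[i]^o.
HB.instance Definition _ (R : rcfType) := Vector.copy R[i] R[i]^o.
HB.instance Definition _ (R : rcfType) := NormedModule.copy R[i] R[i]^o.

(* C^m is the space of row vectors 'rV[R[i]]_m, a normed module over R[i].
   The library norm on it is the sup norm, which induces the usual topology
   and the usual bounded sets; the Euclidean norm is defined here.  Its values
   are nonnegative reals, seen in R[i]. *)
Definition euclidean_norm (R : realType) (m : nat) (z : 'rV[R[i]]_m) : R[i] :=
  sqrtC (\sum_(j < m) `|z 0 j| ^+ 2).

Definition unit_ball (R : realType) (m : nat) : set 'rV[R[i]]_m :=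
  [set z | euclidean_norm z < 1].

Definition domain (T : topologicalType) (U : set T) : Prop :=
  open U /\ connected U.

(* Used for U open only: then it depends only on the restriction of f to U.
   The differential is R[i]-linear, since C^m and C^n are normed modules over
   R[i]. *)
Definition holomorphic_on (R : realType) (m n : nat)
    (U : set 'rV[R[i]]_m) (f : 'rV[R[i]]_m -> 'rV[R[i]]_n) : Prop :=
  forall z, U z -> differentiable f z.

(* A holomorphic bijection f from U onto V whose inverse g is holomorphic. *)
Definition biholomorphic (R : realType) (m n : nat)
    (U : set 'rV[R[i]]_m) (V : set 'rV[R[i]]_n) : Prop :=
  exists (f : 'rV[R[i]]_m -> 'rV[R[i]]_n) (g : 'rV[R[i]]_n -> 'rV[R[i]]_m),
    [/\ holomorphic_on U f, set_bij U V f,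
        holomorphic_on V g & {in U, cancel f g}].

(* Main.v *)
(* Let B_s denote the ball of radius s.  It suffices to find s > 0, holomorphic
   maps Phi, h on B_s with Phi bounded and monotone,
   Re <Phi x - Phi y, x - y> >= |x - y|^2 / 2, and a dense sequence q_n of B_s
   with h(q_n) = Phi(q_(n+1)): then Phi is a biholomorphism onto a bounded domain
   U and F = h o Phi^-1 has the dense orbit Phi(q_n).  Phi and h are limits of
   polynomial maps.  A stage carries a finite chain q_0, ..., q_k with
   h(q_i) = Phi(q_(i+1)) whose end h(q_k) lies outside Phi(B_rho), and such that
   no infinite chain h(x_i) = Phi(x_(i+1)) stays in the closed ball.  To come
   close to a prescribed point a, choose r < rho and zeta of norm r such that
   h(q_k) lies on the ray from Phi(zeta) in the direction zeta, follow the chain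
   from a point b near a until it exits, and then perturb Phi and h by polynomial
   bumps concentrated at zeta, so that the new Phi(zeta) is h(q_k) and the new
   h(zeta) is Phi(b); the radius shrinks slightly below rho.  Stretching Phi in
   the direction zeta at zeta preserves monotonicity; h is moved along two
   segments that avoid the countable set of points with a chain ending at zeta.
   That no infinite chain appears follows by passing to ultralimits. *)
Require Import Defs.
From mathcomp Require Import all_boot all_order all_algebra.
From mathcomp Require Import all_classical all_reals all_analysis.
From mathcomp Require Import complex polyrcf ring lra.
Set Implicit Arguments.
Unset Strict Implicit.
Unset Printing Implicit Defensive.
Import Order.TTheory GRing.Theory Num.Theory.
Import numFieldNormedType.Exports.
Local Open Scope classical_set_scope.
Local Open Scope ring_scope.

(** * The modulus of a complex number as a real number *)

Section Modulus.
Variable R : realType.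
Implicit Types z w : R[i].

(** Every earlier link is frozen, since the bumps vanish at all chain points; the whole freedom of a
    stage lies at the single new point [zeta]. What makes this enough is the shape of the bumps.
    Their values cluster on the interval from 0 to 1, so the perturbed graphs converge to the old
    graph with a segment attached above [zeta]; the absence of infinite chains and the bounds are
    read off from this limit graph. Difference quotients of a bump are, up to a small error,
    [t * dot (x - y) zeta] with [t] in the right half-plane; this protects the monotonicity of [Phi]
    and the local injectivity of [h] however steep the bump is. The slope must be unbounded because
    the second segment for [h] may point in a direction that the differential admits only after a
    steep first bump. The absence of infinite chains acts in three ways: forward chains exit,
    [h zeta] has no chain back to [zeta], and a limit of chains has to meet [zeta]. Each stage
    bounds the change of a map together with its Lipschitz constant, so that the differentials
    converge along with the maps. *)

Definition cm z : R := complex.Re `|z|.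

Lemma cmE z : `|z| = (cm z)%:C%C.
Proof. by rewrite /cm RRe_real // normr_real. Qed.

Lemma cm_ge0 z : 0 <= cm z.
Proof. by have := normr_ge0 z; rewrite cmE ler0c. Qed.

Lemma cm0 : cm 0 = 0. Proof. by rewrite /cm normr0. Qed.
Lemma cm1 : cm 1 = 1. Proof. by rewrite /cm normr1. Qed.
Lemma cmN z : cm (- z) = cm z. Proof. by rewrite /cm normrN. Qed.

Lemma cmM z w : cm (z * w) = cm z * cm w.
Proof. by apply: complexI; rewrite -cmE normrM !cmE rmorphM. Qed.

Lemma cmX z n : cm (z ^+ n) = cm z ^+ n.
Proof. by elim: n => [|n IH]; rewrite ?expr0 ?cm1 // !exprS cmM IH. Qed.

Lemma cmV z : cm z^-1 = (cm z)^-1.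
Proof. by apply: complexI; rewrite -cmE normfV !cmE fmorphV. Qed.

Lemma cmD z w : cm (z + w) <= cm z + cm w.
Proof. by have := ler_normD z w; rewrite !cmE -rmorphD lecR. Qed.

Lemma cmB z w : cm (z - w) = cm (w - z).
Proof. by rewrite -cmN opprB. Qed.

Lemma cm_eq0 z : cm z = 0 -> z = 0.
Proof. by move=> h; apply/eqP; rewrite -normr_eq0 cmE h. Qed.

Lemma cm_gt0 z : z != 0 -> 0 < cm z.
Proof.
move=> z0; rewrite lt0r cm_ge0 andbT; apply: contra z0 => /eqP h.
by rewrite (cm_eq0 h).
Qed.

Lemma cm_real (x : R) : cm x%:C%C = `|x|.
Proof. by rewrite /cm normc_def /= expr0n addr0 sqrtr_sqr. Qed.

Lemma cm_conj z : cm z^*%C = cm z.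
Proof. by case: z => a b; rewrite /cm !normc_def /= sqrrN. Qed.

Lemma cm_sqr z : cm z ^+ 2 = complex.Re z ^+ 2 + complex.Im z ^+ 2.
Proof. by rewrite /cm normc_def /= sqr_sqrtr // addr_ge0 // sqr_ge0. Qed.

Lemma normRe_cm z : `|complex.Re z| <= cm z.
Proof.
rewrite -(@ler_pXn2r _ 2) ?nnegrE ?cm_ge0 // cm_sqr real_normK ?num_real //.
by rewrite lerDl sqr_ge0.
Qed.

Lemma normIm_cm z : `|complex.Im z| <= cm z.
Proof.
rewrite -(@ler_pXn2r _ 2) ?nnegrE ?cm_ge0 // cm_sqr real_normK ?num_real //.
by rewrite lerDr sqr_ge0.
Qed.

Lemma Re_le_cm z : complex.Re z <= cm z.
Proof. exact: le_trans (ler_norm _) (normRe_cm z). Qed.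

Lemma Re_ge_cm z : - cm z <= complex.Re z.
Proof. by have := normRe_cm z; rewrite ler_norml => /andP[]. Qed.

Lemma cm_ReIm z : cm z <= `|complex.Re z| + `|complex.Im z|.
Proof.
rewrite {1}(complexE z) (le_trans (cmD _ _)) // cm_real cmM.
by rewrite cm_real lerD2l {1}/cm normc_def /= expr0n expr1n add0r sqrtr1 mul1r.
Qed.

Lemma cReD z w : complex.Re (z + w) = complex.Re z + complex.Re w.
Proof. by case: z w => [? ?] [? ?]. Qed.
Lemma cImD z w : complex.Im (z + w) = complex.Im z + complex.Im w.
Proof. by case: z w => [? ?] [? ?]. Qed.
Lemma cReN z : complex.Re (- z) = - complex.Re z.
Proof. by case: z. Qed.
Lemma cImN z : complex.Im (- z) = - complex.Im z.
Proof. by case: z. Qed.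
Lemma cReM z w : complex.Re (z * w) =
  complex.Re z * complex.Re w - complex.Im z * complex.Im w.
Proof. by case: z w => [? ?] [? ?]. Qed.
Lemma cImM z w : complex.Im (z * w) =
  complex.Re z * complex.Im w + complex.Im z * complex.Re w.
Proof. by case: z w => [? ?] [? ?]. Qed.
Lemma cReC z : complex.Re z^*%C = complex.Re z. Proof. by case: z. Qed.
Lemma cImC z : complex.Im z^*%C = - complex.Im z. Proof. by case: z. Qed.
Lemma mulcJ z : z * z^*%C = (cm z ^+ 2)%:C%C.
Proof.
by case: z => a b; rewrite cm_sqr /=; simpc; congr (_ +i* _)%C; ring.
Qed.
Lemma cRe_sum (I : Type) (s : seq I) (P : pred I) (F : I -> R[i]) :
  complex.Re (\sum_(i <- s | P i) F i) = \sum_(i <- s | P i) complex.Re (F i).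
Proof. by elim/big_rec2: _ => // i x y _ <-; rewrite cReD. Qed.
Lemma cm_sum (I : Type) (s : seq I) (P : pred I) (F : I -> R[i]) :
  cm (\sum_(i <- s | P i) F i) <= \sum_(i <- s | P i) cm (F i).
Proof.
elim/big_rec2: _ => [|i x y _ h]; first by rewrite cm0.
by rewrite (le_trans (cmD _ _)) // lerD2l.
Qed.

End Modulus.

(** * The hermitian product and the Euclidean norm with real values *)

Section Euclid.
Variables (R : realType) (m : nat).
Local Notation C := R[i].
Local Notation V := 'rV[C]_m.
Implicit Types x y z u v : V.

Definition dot x y : C := \sum_(j < m) x 0 j * (y 0 j)^*%C.
Definition nr x : R := Num.sqrt (\sum_(j < m) cm (x 0 j) ^+ 2).

Lemma dotDl x y z : dot (x + y) z = dot x z + dot y z.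
Proof.
by rewrite /dot -big_split; apply: eq_bigr => j _; rewrite mxE mulrDl.
Qed.
Lemma dotZl (a : C) x y : dot (a *: x) y = a * dot x y.
Proof.
by rewrite /dot mulr_sumr; apply: eq_bigr => j _; rewrite mxE mulrA.
Qed.
Lemma dotC x y : dot y x = (dot x y)^*%C.
Proof.
rewrite /dot rmorph_sum; apply: eq_bigr => j _.
by rewrite rmorphM /= conjcK mulrC.
Qed.
Lemma dotNl x y : dot (- x) y = - dot x y.
Proof. by rewrite -scaleN1r dotZl mulN1r. Qed.
Lemma dotBl x y z : dot (x - y) z = dot x z - dot y z.
Proof. by rewrite dotDl dotNl. Qed.
Lemma dot0l x : dot 0 x = 0.
Proof. by rewrite -(scale0r x) dotZl mul0r. Qed.
Lemma dotDr x y z : dot x (y + z) = dot x y + dot x z.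
Proof. by rewrite dotC dotDl rmorphD /= -!dotC. Qed.
Lemma dotZr (a : C) x y : dot x (a *: y) = a^*%C * dot x y.
Proof. by rewrite dotC dotZl rmorphM /= -dotC. Qed.
Lemma dotNr x y : dot x (- y) = - dot x y.
Proof. by rewrite dotC dotNl rmorphN /= -dotC. Qed.
Lemma dotBr x y z : dot x (y - z) = dot x y - dot x z.
Proof. by rewrite dotDr dotNr. Qed.

Lemma nr_ge0 x : 0 <= nr x. Proof. exact: sqrtr_ge0. Qed.

Lemma nr_sqr x : nr x ^+ 2 = \sum_(j < m) cm (x 0 j) ^+ 2.
Proof. by rewrite /nr sqr_sqrtr // sumr_ge0 // => j _; rewrite sqr_ge0. Qed.

Lemma dotxx x : dot x x = (nr x ^+ 2)%:C%C.
Proof.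
rewrite nr_sqr rmorph_sum; apply: eq_bigr => j _; exact: mulcJ.
Qed.

Lemma Redotxx x : complex.Re (dot x x) = nr x ^+ 2.
Proof. by rewrite dotxx. Qed.

Lemma nr0 : nr 0 = 0.
Proof.
by rewrite /nr big1 ?sqrtr0 // => j _; rewrite mxE cm0 expr0n.
Qed.

Lemma cm_le_nr x j : cm (x 0 j) <= nr x.
Proof.
rewrite -(@ler_pXn2r _ 2) ?nnegrE ?cm_ge0 ?nr_ge0 // nr_sqr (bigD1 j) //=.
by rewrite lerDl sumr_ge0 // => i _; rewrite sqr_ge0.
Qed.

Lemma nr_eq0 x : nr x = 0 -> x = 0.
Proof.
move=> h; apply/rowP => j; rewrite mxE; apply: cm_eq0; apply/eqP.
by rewrite eq_le cm_ge0 andbT -h cm_le_nr.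
Qed.

Lemma nr_gt0 x : x != 0 -> 0 < nr x.
Proof.
move=> x0; rewrite lt0r nr_ge0 andbT; apply: contra x0 => /eqP h.
by rewrite (nr_eq0 h).
Qed.

Lemma nrZ (a : C) x : nr (a *: x) = cm a * nr x.
Proof.
apply/eqP; rewrite -(@eqrXn2 _ 2) ?mulr_ge0 ?cm_ge0 ?nr_ge0 // exprMn !nr_sqr.
by rewrite mulr_sumr; apply/eqP/eq_bigr => j _; rewrite mxE cmM exprMn.
Qed.

Lemma nrN x : nr (- x) = nr x.
Proof. by rewrite -scaleN1r nrZ cmN cm1 mul1r. Qed.

Lemma nrB x y : nr (x - y) = nr (y - x).
Proof. by rewrite -nrN opprB. Qed.

Lemma nrD_sqr x y :
  nr (x + y) ^+ 2 = nr x ^+ 2 + 2 * complex.Re (dot x y) + nr y ^+ 2.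
Proof.
rewrite -!Redotxx !dotDl !dotDr !cReD (dotC x y) cReC; ring.
Qed.

Lemma Redot_le x y : complex.Re (dot x y) <= nr x * nr y.
Proof.
have [->|x0] := eqVneq x 0; first by rewrite dot0l nr0 mul0r.
have [->|y0] := eqVneq y 0; first by rewrite dotC dot0l nr0 mulr0 rmorph0.
have hx := nr_gt0 x0; have hy := nr_gt0 y0.
have : 0 <= nr ((nr y)%:C%C *: x + (- (nr x)%:C%C) *: y) ^+ 2 by rewrite sqr_ge0.
rewrite nrD_sqr !nrZ cmN !cm_real !gtr0_norm // dotZl dotZr.
set d := dot x y; have -> : complex.Re ((nr y)%:C%C * ((- (nr x)%:C%C)^*%C * d)) =
  - (nr x * nr y) * complex.Re d by rewrite !cReM !cImM !cReC !cImC !cReN !cImN /=; ring.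
move=> h; have : 0 <= (nr x * nr y) * (nr x * nr y - complex.Re d) by nra.
by rewrite pmulr_rge0 ?mulr_gt0 // subr_ge0.
Qed.

(** Rotating [x] by the conjugate of [dot x y] makes the product real, which reduces the claim to
    real parts. *)
Lemma cm_dot x y : cm (dot x y) <= nr x * nr y.
Proof.
have [->|d0] := eqVneq (dot x y) 0; first by rewrite cm0 mulr_ge0 ?nr_ge0.
have c0 := cm_gt0 d0.
have := Redot_le ((dot x y)^*%C *: x) y.
rewrite dotZl nrZ cm_conj mulrC mulcJ /= -mulrA expr2 ler_pM2l //.
Qed.

Lemma nrD x y : nr (x + y) <= nr x + nr y.
Proof.
rewrite -(@ler_pXn2r _ 2) ?nnegrE ?addr_ge0 ?nr_ge0 // nrD_sqr.
have := Redot_le x y; nra.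
Qed.

Lemma nr_tri x y z : nr (x - z) <= nr (x - y) + nr (y - z).
Proof. by rewrite -{1}(subrK y x) -addrA; exact: nrD. Qed.

Lemma nr_le_bound x (b : R) : (forall j, cm (x 0 j) <= b) -> nr x <= m%:R * b.
Proof.
move=> h; have [j0 _|h0] := pickP (predT : pred 'I_m); last first.
  have -> : m%:R = 0 :> R by rewrite -[m]card_ord (eq_card0 h0).
  by rewrite mul0r /nr big_pred0 ?sqrtr0.
have b0 : 0 <= b by apply: le_trans (h j0); exact: cm_ge0.
rewrite -(@ler_pXn2r _ 2) ?nnegrE ?nr_ge0 ?mulr_ge0 // nr_sqr.
apply: (@le_trans _ _ (\sum_(j < m) b ^+ 2)).
  by apply: ler_sum => j _; rewrite ler_pXn2r ?nnegrE ?cm_ge0.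
rewrite sumr_const card_ord -[leLHS]mulr_natl exprMn ler_wpM2r ?sqr_ge0 //.
rewrite -natrX ler_nat -[leqLHS]expn1 leq_pexp2l //.
exact: leq_ltn_trans (leq0n j0) (ltn_ord j0).
Qed.

Lemma nr_mulmx (A : 'M[C]_m) : {K : R | 0 < K & forall x, nr (x *m A) <= K * nr x}.
Proof.
pose s := \sum_i \sum_j cm (A i j).
have s0 : 0 <= s by apply: sumr_ge0 => i _; apply: sumr_ge0 => j _; exact: cm_ge0.
(* The summand 1 keeps the constant positive when [A] is zero, so that later proofs can divide by
   it. *)
exists (m%:R * s + 1) => [|x]; first by rewrite ltr_wpDl // mulr_ge0.
apply: (@le_trans _ _ (m%:R * (s * nr x))); last first.
  by rewrite mulrA mulrDl mul1r lerDl nr_ge0.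
apply: nr_le_bound => j; rewrite mxE.
apply: le_trans (cm_sum _ _ _) _; rewrite mulr_suml; apply: ler_sum => i _.
rewrite cmM mulrC ler_pM ?cm_ge0 ?cm_le_nr //.
rewrite (bigD1 j) //= lerDl sumr_ge0 // => k _; exact: cm_ge0.
Qed.

End Euclid.

(** * Strict differentiability and polynomial maps *)

Section StrictDerivative.
Variables (R : realType) (m : nat).
Local Notation C := R[i].
Local Notation V := 'rV[C]_m.
Implicit Types (x y z u v : V) (f g : V -> V) (l k : V -> C).

(** Strict differentiability, with two moving points: local injectivity compares the values at two
    points near [zeta], which a derivative based at [z] alone does not control. As [dot] is
    conjugate linear in its second argument, [a] is the conjugate of the complex gradient. *)
Definition sgrad l z (a : V) := forall w : R, 0 < w -> exists2 d : R, 0 < d &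
  forall x y, nr (x - z) < d -> nr (y - z) < d ->
    cm (l x - l y - dot (x - y) a) <= w * nr (x - y).

Definition sder f z (A : 'M[C]_m) := forall w : R, 0 < w -> exists2 d : R, 0 < d &
  forall x y, nr (x - z) < d -> nr (y - z) < d ->
    nr (f x - f y - (x - y) *m A) <= w * nr (x - y).

Definition econt f := forall z (e : R), 0 < e -> exists2 d : R, 0 < d &
  forall y, nr (y - z) < d -> nr (f y - f z) < e.

Lemma sgrad_cont l z a : sgrad l z a -> forall e : R, 0 < e ->
  exists2 d : R, 0 < d & forall y, nr (y - z) < d -> cm (l y - l z) < e.
Proof.
move=> /(_ 1 ltr01) [d d0 hd] e e0.
have a0 := nr_ge0 a; have K0 : 0 < 1 + nr a by lra.
exists (Num.min d (e / (1 + nr a))) => [|y]; first by rewrite lt_min d0 divr_gt0.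
rewrite lt_min => /andP[yd]; rewrite ltr_pdivlMr // => ye.
have := hd y z yd; rewrite subrr nr0 mul1r => /(_ d0) h.
rewrite -(subrK (dot (y - z) a) (l y - l z)).
apply: le_lt_trans (cmD _ _) _; have := cm_dot (y - z) a; lra.
Qed.

Lemma sgrad_const (c : C) z : sgrad (fun=> c) z 0.
Proof.
move=> w w0; exists 1 => // x y _ _.
by rewrite subrr sub0r cmN dotC dot0l rmorph0 cm0 mulr_ge0 ?nr_ge0 // ltW.
Qed.

Lemma sgrad_coord j z : sgrad (fun x => x 0 j) z (delta_mx 0 j).
Proof.
move=> w w0; exists 1 => // x y _ _.
rewrite /dot (bigD1 j) //= big1 => [|i /negPf ij].
  by rewrite !mxE !eqxx conjc1 mulr1 addr0 subrr cm0 mulr_ge0 ?nr_ge0 // ltW.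
by rewrite !mxE eqxx ij conjc_nat mulr0.
Qed.

Lemma sgradD l k z a b : sgrad l z a -> sgrad k z b ->
  sgrad (fun x => l x + k x) z (a + b).
Proof.
move=> hl hk w w0; have w2 : 0 < w / 2 by rewrite divr_gt0.
have [d d0 hd] := hl _ w2; have [d' d0' hd'] := hk _ w2.
exists (Num.min d d') => [|x y]; first by rewrite lt_min d0.
rewrite !lt_min => /andP[xd xd'] /andP[yd yd'].
rewrite dotDr (_ : _ - _ - _ = (l x - l y - dot (x - y) a) +
   (k x - k y - dot (x - y) b)); last by ring.
have := hd x y xd yd; have := hd' x y xd' yd'.
have := cmD (l x - l y - dot (x - y) a) (k x - k y - dot (x - y) b); lra.
Qed.

Lemma sgradM l k z a b : sgrad l z a -> sgrad k z b ->
  sgrad (fun x => l x * k x) z ((k z)^*%C *: a + (l z)^*%C *: b).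
Proof.
move=> hl hk w w0.
have a0 := nr_ge0 a; have b0 := nr_ge0 b.
have lz0 := cm_ge0 (l z); have kz0 := cm_ge0 (k z).
pose K := 2 + cm (l z) + cm (k z) + nr a + nr b.
have K0 : 0 < K by rewrite /K; lra.
pose e := Num.min 1 (w / K).
have e0 : 0 < e by rewrite lt_min ltr01 divr_gt0.
have e1 : e <= 1 by rewrite ge_min lexx.
have eK : e * K <= w by rewrite -ler_pdivlMr // ge_min lexx orbT.
have [d1 d10 h1] := hl _ e0; have [d2 d20 h2] := hk _ e0.
have [d3 d30 h3] := sgrad_cont hl e0; have [d4 d40 h4] := sgrad_cont hk e0.
exists (Num.min (Num.min d1 d2) (Num.min d3 d4)) => [|x y].
  by rewrite !lt_min d10 d20 d30 d40.
rewrite !lt_min => /andP[/andP[x1 x2] /andP[x3 x4]] /andP[/andP[y1 y2] /andP[y3 y4]].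
set u := x - y; rewrite dotDr !dotZr !conjcK.
rewrite (_ : _ - _ - _ = (l x - l y - dot u a) * k x + dot u a * (k x - k z)
  + (l y * (k x - k y - dot u b) + (l y - l z) * dot u b)); last by ring.
have := h1 x y x1 y1; have := h2 x y x2 y2; rewrite -/u => H2 H1.
have H3 := h3 y y3; have H4 := h4 x x4.
have kx : cm (k x) <= cm (k z) + 1.
  by rewrite -[k x](subrK (k z)); apply: le_trans (cmD _ _) _; lra.
have ly : cm (l y) <= cm (l z) + 1.
  by rewrite -[l y](subrK (l z)); apply: le_trans (cmD _ _) _; lra.
have u0 := nr_ge0 u.
apply: le_trans (cmD _ _) _.
have T1 : cm ((l x - l y - dot u a) * k x) <= e * nr u * (cm (k z) + 1).
  by rewrite cmM ler_pM ?cm_ge0.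
have T2 : cm (dot u a * (k x - k z)) <= nr u * nr a * e.
  by rewrite cmM ler_pM ?cm_ge0 ?cm_dot // ltW.
have T3 : cm (l y * (k x - k y - dot u b)) <= (cm (l z) + 1) * (e * nr u).
  by rewrite cmM ler_pM ?cm_ge0.
have T4 : cm ((l y - l z) * dot u b) <= e * (nr u * nr b).
  by rewrite cmM ler_pM ?cm_ge0 ?cm_dot // ltW.
apply: (@le_trans _ _ (e * K * nr u)); last by rewrite ler_wpM2r.
have := cmD ((l x - l y - dot u a) * k x) (dot u a * (k x - k z)).
have := cmD (l y * (k x - k y - dot u b)) ((l y - l z) * dot u b).
rewrite /K; lra.
Qed.

Lemma sder_cont f z A : sder f z A -> forall e : R, 0 < e ->
  exists2 d : R, 0 < d & forall y, nr (y - z) < d -> nr (f y - f z) < e.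
Proof.
move=> /(_ 1 ltr01) [d d0 hd] e e0.
have [K K0 hK] := nr_mulmx A.
have K1 : 0 < 1 + K by lra.
exists (Num.min d (e / (1 + K))) => [|y]; first by rewrite lt_min d0 divr_gt0.
rewrite lt_min => /andP[yd]; rewrite ltr_pdivlMr // => ye.
have := hd y z yd; rewrite subrr nr0 mul1r => /(_ d0) h.
rewrite -(subrK ((y - z) *m A) (f y - f z)).
apply: le_lt_trans (nrD _ _) _; have := hK (y - z); lra.
Qed.

Lemma sder_tr (c : V) z : sder (fun x => x + c) z 1%:M.
Proof.
move=> w w0; exists 1 => // x y _ _.
by rewrite mulmx1 opprD addrACA subrr addr0 subrr nr0 mulr_ge0 ?nr_ge0 // ltW.
Qed.

(** A bump with gradient [a] added in the direction [v] changes the differential by the rank one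
    matrix [adj a *m v]. *)
Definition adj (a : V) : 'cV[C]_m := \col_j (a 0 j)^*%C.

Lemma mulmx_adj u a v : u *m (adj a *m v) = dot u a *: v.
Proof.
rewrite mulmxA; suff -> : u *m adj a = (dot u a)%:M by rewrite mul_scalar_mx.
by apply/matrixP => i j; rewrite !ord1 !mxE mulr1n; apply: eq_bigr => k _; rewrite mxE.
Qed.

Lemma sderD f l z A a v : sder f z A -> sgrad l z a ->
  sder (fun x => f x + l x *: v) z (A + adj a *m v).
Proof.
move=> hf hl w w0.
have v0 := nr_ge0 v; have K0 : 0 < 2 * (nr v + 1) by lra.
have w1 : 0 < w / 2 by rewrite divr_gt0.
have w2 : 0 < w / (2 * (nr v + 1)) by rewrite divr_gt0.
have [d d0 hd] := hf _ w1; have [d' d0' hd'] := hl _ w2.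
exists (Num.min d d') => [|x y]; first by rewrite lt_min d0.
rewrite !lt_min => /andP[xd xd'] /andP[yd yd'].
rewrite mulmxDr mulmx_adj; set u := x - y.
rewrite (_ : _ - _ - _ = (f x - f y - u *m A) + (l x - l y - dot u a) *: v); last first.
  by rewrite !scalerBl !opprD [X in X + _ = _]addrACA [LHS]addrACA.
have H1 := hd x y xd yd; have H2 := hd' x y xd' yd'.
apply: le_trans (nrD _ _) _; rewrite nrZ.
have u0 := nr_ge0 u.
have : cm (l x - l y - dot u a) * nr v <= w / 2 * nr u.
  apply: (@le_trans _ _ (w / (2 * (nr v + 1)) * nr u * (nr v + 1))).
    by rewrite ler_pM ?cm_ge0 //; lra.
  by rewrite le_eqVlt; apply/orP; left; apply/eqP; field; lra.
rewrite -/u in H1; lra.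
Qed.

Inductive polyfun : (V -> C) -> Prop :=
| pf_const c : polyfun (fun=> c)
| pf_coord j : polyfun (fun x => x 0 j)
| pf_add l k : polyfun l -> polyfun k -> polyfun (fun x => l x + k x)
| pf_mul l k : polyfun l -> polyfun k -> polyfun (fun x => l x * k x).

(** A translation plus scalar polynomials times fixed vectors: the class is closed by construction
    under the perturbations [f x + lam k x *: v]. *)
Inductive polymap : (V -> V) -> Prop :=
| pm_tr c : polymap (fun x => x + c)
| pm_add f l v : polymap f -> polyfun l -> polymap (fun x => f x + l x *: v).

Lemma polyfun_sgrad l : polyfun l -> forall z, exists a, sgrad l z a.
Proof.
elim=> [c|j|l1 k1 _ IHl _ IHk|l1 k1 _ IHl _ IHk] z.
- by exists 0; exact: sgrad_const.
- by eexists; exact: sgrad_coord.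
- by have [a ha] := IHl z; have [b hb] := IHk z; eexists; exact: sgradD ha hb.
- by have [a ha] := IHl z; have [b hb] := IHk z; eexists; exact: sgradM ha hb.
Qed.

Lemma polymap_sder f : polymap f -> forall z, exists A, sder f z A.
Proof.
elim=> [c|f1 l v _ IHf /polyfun_sgrad hl] z.
- by eexists; exact: sder_tr.
- by have [a ha] := hl z; have [A hA] := IHf z; eexists; exact: sderD hA ha.
Qed.

Lemma polymap_cont f : polymap f -> econt f.
Proof. by move=> /polymap_sder h z; have [A hA] := h z; exact: sder_cont hA. Qed.

(** Bound and Lipschitz constant are carried together because the Lipschitz constant of a product
    involves the bounds of both factors. *)
Lemma polyfun_lip l (r : R) : polyfun l -> exists2 K : R, 0 <= K &
  (forall x, nr x <= r -> cm (l x) <= K) /\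
  (forall x y, nr x <= r -> nr y <= r -> cm (l x - l y) <= K * nr (x - y)).
Proof.
elim=> [c|j|l1 k1 _ [K K0 [b h]] _ [K' K0' [b' h']]|l1 k1 _ [K K0 [b h]] _ [K' K0' [b' h']]].
- exists (cm c); first exact: cm_ge0.
  split=> // x y _ _; by rewrite subrr cm0 mulr_ge0 ?cm_ge0 ?nr_ge0.
- exists (`|r| + 1); first by rewrite addr_ge0.
  split=> [x hx|x y _ _].
    apply: le_trans (cm_le_nr _ _) _; apply: le_trans hx _.
    by have := ler_norm r; lra.
  have := cm_le_nr (x - y) j; rewrite !mxE => /le_trans; apply.
  by rewrite ler_peMl ?nr_ge0 // lerDr.
- exists (K + K'); first exact: addr_ge0.
  split=> [x hx|x y hx hy].
    apply: le_trans (cmD _ _) _; exact: lerD (b _ hx) (b' _ hx).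
  rewrite opprD addrACA; apply: le_trans (cmD _ _) _; rewrite mulrDl.
  exact: lerD (h _ _ hx hy) (h' _ _ hx hy).
- have u0 := @nr_ge0 R m.
  have KK : 0 <= K * K' by apply: mulr_ge0.
  exists (K * K' + K * K'); first exact: addr_ge0.
  split=> [x hx|x y hx hy].
    apply: (@le_trans _ _ (K * K')); last by lra.
    by rewrite cmM ler_pM ?cm_ge0 ?b ?b'.
  rewrite (_ : _ - _ = (l1 x - l1 y) * k1 x + l1 y * (k1 x - k1 y)); last by ring.
  apply: le_trans (cmD _ _) _; rewrite !cmM mulrDl; apply: lerD.
    rewrite mulrAC; apply: ler_pM; rewrite ?cm_ge0 ?h ?b' //.
  rewrite -mulrA; apply: ler_pM; rewrite ?cm_ge0 ?h' ?b //.
Qed.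

Lemma polymap_lip f (r : R) : polymap f -> exists2 K : R, 0 <= K &
  forall x y, nr x <= r -> nr y <= r -> nr (f x - f y) <= K * nr (x - y).
Proof.
elim=> [c|f1 l v _ [K K0 h] /(polyfun_lip r) [K' K0' [_ h']]].
  by exists 1 => // x y _ _; rewrite opprD addrACA subrr addr0 mul1r.
exists (K + K' * nr v); first by rewrite addr_ge0 ?mulr_ge0 ?nr_ge0.
move=> x y hx hy; rewrite opprD addrACA -scalerBl.
apply: le_trans (nrD _ _) _; rewrite mulrDl nrZ; apply: lerD; first exact: h.
by rewrite mulrAC ler_wpM2r ?nr_ge0 ?h'.
Qed.

Lemma polyfun_dot a (c : C) : polyfun (fun x => c * dot x a).
Proof.
rewrite /dot; apply: pf_mul; first exact: pf_const.
elim: (index_enum _) => [|j s IH].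
  by under eq_fun do rewrite big_nil; exact: pf_const.
under eq_fun do rewrite big_cons.
apply: pf_add => //; apply: pf_mul; [exact: pf_coord|exact: pf_const].
Qed.

Lemma polyfun_poly (p : {poly C}) l : polyfun l -> polyfun (fun x => p.[l x]).
Proof.
move=> hl; elim/poly_ind: p => [|p c IH].
  by under eq_fun do rewrite horner0; exact: pf_const.
under eq_fun do rewrite hornerMXaddC.
by apply: pf_add; [exact: pf_mul|exact: pf_const].
Qed.

End StrictDerivative.

(** * Compactness through limits along a free ultrafilter *)

Section UltraLimit.

Lemma free_ultrafilter : exists G : set_system nat,
  UltraFilter G /\ forall N, G [set k | (N <= k)%N].
Proof.
have [G [GU sG]] := ultraFilterLemma (@eventually_filter).
by exists G; split=> // N; apply: sG; exists N.
Qed.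

(** One fixed ultrafilter stands for all extractions of subsequences: every bounded sequence
    converges along it, so a sequence of infinite chains has a limit at all indices at once. *)
Definition fu : set_system nat := projT1 (cid free_ultrafilter).
#[global] Instance fu_ultra : UltraFilter fu := (projT2 (cid free_ultrafilter)).1.
#[global] Instance fu_proper : ProperFilter fu := ultra_proper.

#[global] Instance fu_filter : Filter fu. Proof. exact: filter_filter. Qed.

Lemma fu_all (P : nat -> Prop) : (forall k, P k) -> fu [set k | P k].
Proof. by move=> h; apply: filterS filterT => k _; exact: h. Qed.

Lemma fu_ge N : fu [set k | (N <= k)%N].
Proof. exact: (projT2 (cid free_ultrafilter)).2. Qed.

Lemma fuN (P : nat -> Prop) : ~ fu [set k | P k] -> fu [set k | ~ P k].
Proof. by move=> h; have [//|] := in_ultra_setVsetC [set k | P k] fu_ultra. Qed.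

Lemma near_fu (phi : nat -> nat) (P : nat -> Prop) : (forall K, (K <= phi K)%N) ->
  (\forall k \near \oo, P k) -> fu [set K | P (phi K)].
Proof.
move=> hphi [N _ hN]; apply: filterS (fu_ge N) => K NK.
by apply: hN; exact: leq_trans NK (hphi K).
Qed.

(** A property that is not eventually true fails along some [phi] with [K <= phi K]. The
    counterexamples, indexed by [K], then have limits along [fu], and [near_fu] transports eventual
    facts to the indices [phi K]. *)
Lemma near_by_contradiction (P : nat -> Prop) :
  (forall phi : nat -> nat, (forall K, (K <= phi K)%N) ->
     (forall K, ~ P (phi K)) -> False) -> \forall k \near \oo, P k.
Proof.
move=> h; apply: contrapT => nP.
have /choice[phi hphi] : forall K, exists k, (K <= k)%N /\ ~ P k.
  move=> K; apply: contrapT => nK; apply: nP; exists K => // k Kk.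
  by apply: contrapT => nPk; apply: nK; exists k.
by apply: (h phi) => K; have [] := hphi K.
Qed.

Variables (R : realType) (m : nat).
Local Notation C := R[i].
Local Notation V := 'rV[C]_m.

Definition ulimR (a : nat -> R) (l : R) :=
  forall e : R, 0 < e -> fu [set k | `|a k - l| < e].
Definition ulimC (a : nat -> C) (l : C) :=
  forall e : R, 0 < e -> fu [set k | cm (a k - l) < e].
Definition ulim (x : nat -> V) (l : V) :=
  forall e : R, 0 < e -> fu [set k | nr (x k - l) < e].

(** The limit is the supremum of the [t] that lie below the sequence on a set of the ultrafilter. *)
Lemma ulimR_ex (a : nat -> R) (b : R) : fu [set k | `|a k| <= b] -> exists l, ulimR a l.
Proof.
move=> ab; pose S := [set t : R | fu [set k | t <= a k]].
have S0 : S (- b).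
  by apply: filterS ab => k /=; rewrite ler_norml => /andP[].
have Sub : ubound S b.
  move=> t St; have [k [/= tk ak]] := filter_ex (filterI St ab).
  by apply: le_trans tk (le_trans (ler_norm _) ak).
have hS : has_sup S by split; [exists (- b)|exists b].
exists (sup S) => e e0.
have [t St ht] := sup_adherent e0 hS.
have nS : ~ S (sup S + e / 2).
  move=> /(sup_upper_bound hS); lra.
move/fuN : nS => nS; apply: filterS2 St nS => k /= tk /negP; rewrite -ltNge => ks.
rewrite ltr_norml; apply/andP; split; lra.
Qed.

Lemma ulimC_ex (a : nat -> C) (b : R) : fu [set k | cm (a k) <= b] -> exists l, ulimC a l.
Proof.
move=> ab.
have [p hp] := @ulimR_ex (fun k => complex.Re (a k)) b
  (filterS (fun k => le_trans (normRe_cm _)) ab).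
have [q hq] := @ulimR_ex (fun k => complex.Im (a k)) b
  (filterS (fun k => le_trans (normIm_cm _)) ab).
exists (p +i* q)%C => e e0; have e2 : 0 < e / 2 by rewrite divr_gt0.
apply: filterS2 (hp _ e2) (hq _ e2) => k /= h1 h2.
apply: le_lt_trans (cm_ReIm _) _; rewrite cReD cReN cImD cImN /=; lra.
Qed.

Lemma ulim_ex (x : nat -> V) (b : R) : fu [set k | nr (x k) <= b] -> exists l, ulim x l.
Proof.
move=> xb.
have h j : exists l, ulimC (fun k => x k 0 j) l.
  by apply: (@ulimC_ex _ b); apply: filterS xb => k; apply: le_trans; exact: cm_le_nr.
have [l hl] := choice h; exists (\row_j l j) => e e0.
have m1 : 0 < m%:R + 1 :> R by rewrite ltr_wpDl.
have e1 : 0 < e / (m%:R + 1) by rewrite divr_gt0.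
have : fu [set k | forall j, cm (x k 0 j - l j) < e / (m%:R + 1)].
  by apply: filter_forall => j; exact: hl.
apply: filterS => k /= hk.
have /le_lt_trans : nr (x k - \row_j l j) <= m%:R * (e / (m%:R + 1)).
  by apply: nr_le_bound => j; rewrite !mxE; apply/ltW/hk.
apply; rewrite mulrA ltr_pdivrMr // mulrC ltr_pM2l //; lra.
Qed.

Lemma ulim_unique (x : nat -> V) l l' : ulim x l -> ulim x l' -> l = l'.
Proof.
move=> h h'; apply/eqP; rewrite -subr_eq0; apply/negP => /negP /nr_gt0 n0.
have n2 : 0 < nr (l - l') / 2 by rewrite divr_gt0.
have [k [/= h1 h2]] := filter_ex (filterI (h _ n2) (h' _ n2)).
have := nr_tri l (x k) l'; rewrite (nrB l (x k)); lra.
Qed.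

Lemma ulim_le (x : nat -> V) l (r : R) : ulim x l ->
  (forall e, 0 < e -> fu [set k | nr (x k) <= r + e]) -> nr l <= r.
Proof.
move=> h hx; rewrite leNgt; apply/negP => rl.
have e0 : 0 < (nr l - r) / 2 by rewrite divr_gt0 // subr_gt0.
have [k [/= h1 h2]] := filter_ex (filterI (h _ e0) (hx _ e0)).
have := nrD (l - x k) (x k); rewrite subrK (nrB l); lra.
Qed.

Lemma ulim_cst (l : V) : ulim (fun=> l) l.
Proof.
by move=> e e0; apply: filterS filterT => k _ /=; rewrite subrr nr0.
Qed.

Lemma ulim_cont (f : V -> V) (x : nat -> V) l :
  (forall e : R, 0 < e -> exists2 d : R, 0 < d &
    forall y, nr (y - l) < d -> nr (f y - f l) < e) ->
  ulim x l -> ulim (f \o x) (f l).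
Proof.
move=> hf hx e /hf[d d0 hd]; apply: filterS (hx _ d0) => k /=; exact: hd.
Qed.

Lemma ulimD (x y : nat -> V) l l' : ulim x l -> ulim y l' ->
  ulim (fun k => x k + y k) (l + l').
Proof.
move=> hx hy e e0; have e2 : 0 < e / 2 by rewrite divr_gt0.
apply: filterS2 (hx _ e2) (hy _ e2) => k /= h1 h2.
rewrite opprD addrACA; apply: le_lt_trans (nrD _ _) _; lra.
Qed.

Lemma ulimZ (a : nat -> C) (c : C) v : ulimC a c -> ulim (fun k => a k *: v) (c *: v).
Proof.
move=> h e e0; have v0 := nr_ge0 v; have v1 : 0 < nr v + 1 by lra.
have e1 : 0 < e / (nr v + 1) by rewrite divr_gt0.
apply: filterS (h _ e1) => k /= hk; rewrite -scalerBl nrZ.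
rewrite ltr_pdivlMr // in hk; have := cm_ge0 (a k - c); nra.
Qed.

Lemma ulimR_C (a : nat -> R) (c : R) : ulimR a c -> ulimC (fun k => (a k)%:C%C) c%:C%C.
Proof.
by move=> h e e0; apply: filterS (h _ e0) => k /=; rewrite -rmorphB cm_real.
Qed.

Lemma ulim_eq (x y : nat -> V) l : fu [set k | x k = y k] -> ulim x l -> ulim y l.
Proof. by move=> h hx e e0; apply: filterS2 h (hx _ e0) => k /= ->. Qed.

Lemma ulimR_01 (a : nat -> R) l : (forall k, 0 <= a k <= 1) -> ulimR a l -> 0 <= l <= 1.
Proof.
move=> ha hl; apply/andP; split; rewrite leNgt; apply/negP => h.
  have e0 : 0 < - l by lra.
  have [k /=] := filter_ex (hl _ e0); rewrite ltr_norml => /andP[_].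
  by have /andP[] := ha k; lra.
have e0 : 0 < l - 1 by lra.
have [k /=] := filter_ex (hl _ e0); rewrite ltr_norml => /andP[+ _].
by have /andP[] := ha k; lra.
Qed.

End UltraLimit.

(** * The truncated logarithm near its singularity *)

Section TruncatedLog.
Variable R : realType.
Local Notation C := R[i].
Implicit Types (a c s t : C) (r x : R).

(** The real mean value theorem is applied to the real polynomial giving the real part of [c * p]
    along the segment. The factor [c] is free; later it is the conjugate of [s - t] or of [p.[s] -
    p.[t]], which turns the real part into a statement on the whole difference. *)
Lemma complex_mvt (p : {poly C}) c s t : exists2 x : R, 0 <= x <= 1 &
  complex.Re (c * (p.[s] - p.[t])) =
  complex.Re (c * (s - t) * (p^`()).[t + x%:C%C * (s - t)]).
Proof.
pose q := c *: (p \Po (t%:P + (s - t) *: 'X)).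
pose Q : {poly R} := map_poly (@complex.Re R) q.
have QE (w : {poly C}) x : (map_poly (@complex.Re R) w).[x] = complex.Re w.[x%:C%C].
  rewrite (@horner_coef_wide _ (size w)) ?size_poly // horner_coef cRe_sum.
  apply: eq_bigr => i _; rewrite coef_map_id0 ?raddf0 //.
  by rewrite -rmorphXn cReM /= mulr0 subr0.
have ReMn (w : C) k : complex.Re (w *+ k) = complex.Re w *+ k.
  by elim: k => [|k IH]; rewrite ?mulr0n // !mulrSr cReD IH.
have Qd : Q^`() = map_poly (@complex.Re R) q^`().
  apply/polyP => i; by rewrite coef_deriv !coef_map_id0 // coef_deriv ReMn.
have qE x : q.[x%:C%C] = c * p.[t + x%:C%C * (s - t)].
  by rewrite /q hornerZ horner_comp !hornerE [_ * x%:C%C]mulrC.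
have [x x01] := poly_mvt Q (@ltr01 R).
rewrite Qd !QE !qE subr0 mulr1 /= mul1r subrKC.
have -> : ((0 : R)%:C)%C = 0 :> C by [].
rewrite mul0r addr0 -raddfB -mulrBr => ->.
exists x; first by move: x01; rewrite in_itv /= => /andP[/ltW -> /ltW ->].
rewrite /q derivZ hornerZ deriv_comp hornerM horner_comp !hornerE.
rewrite derivD derivC derivZ derivX !hornerE; congr complex.Re.
by rewrite /= [_ * x%:C%C]mulrC mulr1 mulrAC.
Qed.

(** The Taylor polynomial of degree [n] of - ln (1 - a) at 0. *)
Definition tlog n : {poly C} := \sum_(j < n) (j.+1%:R)^-1 *: 'X^(j.+1).

Lemma tlogE n a : (tlog n).[a] = \sum_(j < n) a ^+ j.+1 / j.+1%:R.
Proof.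
rewrite /tlog horner_sum; apply: eq_bigr => j _.
by rewrite hornerZ hornerXn mulrC.
Qed.

Lemma tlog_derivE n a : (1 - a) * ((tlog n)^`()).[a] = 1 - a ^+ n.
Proof.
rewrite -{2}(expr1n _ n) subrXX /tlog raddf_sum /= horner_sum; congr (_ * _).
apply: eq_bigr => j _.
rewrite derivZ derivXn hornerZ hornerMn hornerXn expr1n mul1r /=.
by rewrite -[X in _ * X = _]mulr_natl mulrA mulVf ?mul1r // pnatr_eq0.
Qed.

Lemma cm_nat n : cm (n%:R : C) = n%:R.
Proof. by rewrite (_ : n%:R = (n%:R)%:C%C) ?cm_real ?normr_nat // rmorph_nat. Qed.

Lemma cm_X_le1 a n : cm a <= 1 -> cm (a ^+ n) <= 1.
Proof. by move=> a1; rewrite cmX exprn_ile1 ?cm_ge0. Qed.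

(** Summation by parts: multiplying by [1 - a] leaves the differences of consecutive reciprocals,
    which telescope. The induction carries the boundary term [a ^+ n.+1 / n.+1%:R] on the left and
    pays for it with [- (n.+1%:R)^-1] on the right. *)
Lemma tlog_tail a K n : cm a <= 1 -> (K <= n)%N ->
  cm (1 - a) * cm (\sum_(K <= j < n) a ^+ j.+1 / j.+1%:R) <= 2 / K.+1%:R.
Proof.
move=> a1 Kn; rewrite -cmM; set T := (1 - a) * _.
suff h : cm (T + a ^+ n.+1 / n.+1%:R) <= 2 / K.+1%:R - (n.+1%:R)^-1.
  rewrite -(addrK (a ^+ n.+1 / n.+1%:R) T); apply: le_trans (cmD _ _) _.
  rewrite cmN [cm (_ / _)]cmM cmV cm_nat.
  have q : cm (a ^+ n.+1) / n.+1%:R <= (n.+1%:R)^-1 by rewrite ler_piMl ?cm_X_le1.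
  by apply: le_trans (lerD h q) _; rewrite subrK.
rewrite {}/T; elim: n Kn => [|n IH].
  rewrite leqn0 => /eqP->; rewrite big_geq // mulr0 add0r ?divr1 ?invr1 ?divr1.
  by apply: le_trans (cm_X_le1 _ a1) _; lra.
rewrite leq_eqVlt => /predU1P[->|].
  rewrite big_geq // mulr0 add0r cmM cmV cm_nat.
  have q : cm (a ^+ n.+2) / n.+2%:R <= (n.+2%:R)^-1 by rewrite ler_piMl ?cm_X_le1.
  by apply: le_trans q _; rewrite mulrDl mul1r addrK.
rewrite ltnS => Kn; rewrite big_nat_recr //= mulrDr.
set S := (1 - a) * _ in IH *.
have -> : S + (1 - a) * (a ^+ n.+1 / n.+1%:R) + a ^+ n.+2 / n.+2%:R =
   (S + a ^+ n.+1 / n.+1%:R) - a ^+ n.+2 * ((n.+1%:R)^-1 - (n.+2%:R)^-1).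
  rewrite (exprS a n.+1); move: (a ^+ n.+1) (n.+1%:R^-1) (n.+2%:R^-1) => A p q.
  by ring.
apply: le_trans (cmD _ _) _; rewrite cmN cmM.
have := IH Kn.
have d0 : 0 <= (n.+1%:R)^-1 - (n.+2%:R)^-1 :> R.
  by rewrite subr_ge0 lef_pV2 ?posrE ?ltr0n // ler_nat.
have -> : cm ((n.+1%:R)^-1 - (n.+2%:R)^-1 : C) = (n.+1%:R)^-1 - (n.+2%:R)^-1.
  rewrite -(ger0_norm d0) -cm_real; congr cm.
  by rewrite rmorphB !fmorphV !rmorph_nat.
have q : cm (a ^+ n.+2) * ((n.+1%:R)^-1 - (n.+2%:R)^-1) <= (n.+1%:R)^-1 - (n.+2%:R)^-1.
  by rewrite ler_piMl ?cm_X_le1.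
by move=> IHn; apply: le_trans (lerD IHn q) _; rewrite addrA subrK.
Qed.

Lemma cm_Xsub1 a n : cm a <= 1 -> cm (a ^+ n - 1) <= n%:R * cm (1 - a).
Proof.
move=> a1; elim: n => [|n IH]; first by rewrite subrr cm0 mul0r.
rewrite exprS (_ : _ - 1 = a * (a ^+ n - 1) - (1 - a)); last by ring.
apply: le_trans (cmD _ _) _; rewrite cmN cmM -natr1 mulrDl mul1r lerD2r.
by apply: le_trans IH; rewrite ler_piMl ?cm_ge0.
Qed.

Definition harm K : R := \sum_(0 <= j < K) (j.+1%:R)^-1.

Lemma harm_ge0 K : 0 <= harm K.
Proof. by apply: sumr_ge0 => j _; rewrite invr_ge0. Qed.

Lemma tlog_head a K : cm a <= 1 ->
  cm (\sum_(0 <= j < K) a ^+ j.+1 / j.+1%:R - (harm K)%:C%C) <= K%:R * cm (1 - a).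
Proof.
move=> a1; rewrite /harm rmorph_sum -sumrB.
apply: le_trans (cm_sum _ _ _) _.
apply: (@le_trans _ _ (\sum_(0 <= j < K) cm (1 - a))); last first.
  by rewrite sumr_const_nat subn0 mulr_natl.
apply: ler_sum => j _.
rewrite (_ : _ - _ = (a ^+ j.+1 - 1) / j.+1%:R); last first.
  by rewrite fmorphV rmorph_nat mulrBl mul1r.
rewrite cmM cmV cm_nat ler_pdivrMr ?ltr0n // mulrC; exact: cm_Xsub1.
Qed.

(* The parameter P fixes the evaluation point 1 - 1/P; the degree 16 P^2 makes
   the tail of the geometric series harmless on the disc of radius 1 - 1/(2P). *)
Section EvaluationPoint.
Variable P : nat.
Hypothesis P1 : (1 <= P)%N.
Let n := (16 * P ^ 2)%N.
Let r : R := 1 - P%:R^-1.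
Let r2 : R := 1 - (2 * P%:R)^-1.
Let N : R := complex.Re (tlog n).[r%:C%C].

Let P0 : 0 < P%:R :> R. Proof. by rewrite ltr0n. Qed.
Let P1R : 1 <= P%:R :> R. Proof. by rewrite ler1n. Qed.
Let rP : r * P%:R = P%:R - 1. Proof. by rewrite /r; field; rewrite gt_eqF. Qed.
Let r2P : r2 * (2 * P%:R) = 2 * P%:R - 1. Proof. by rewrite /r2; field; rewrite gt_eqF. Qed.
Let r_ge0 : 0 <= r. Proof. by rewrite -(pmulr_lge0 _ P0) rP; have := P1R; lra. Qed.
Let r_lt1 : r < 1. Proof. by rewrite -(ltr_pM2r P0) rP; have := P1R; lra. Qed.
Let r2_lt1 : r2 < 1. Proof. by rewrite -(@ltr_pM2r _ (2 * P%:R)) ?r2P; have := P0; lra. Qed.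
Let r_lt_r2 : r < r2. Proof. by rewrite -(@ltr_pM2r _ (2 * P%:R)) ?r2P; have := P1R; have := rP; lra. Qed.

Let r2_n : r2 ^+ n <= (8 * P%:R)^-1.
Proof.
have p0 := P0; have p1 := P1R; have r1 := r_lt1; have r21 := r2_lt1; have rr2 := r_lt_r2.
have r20 : 0 <= r2 by apply: le_trans r_ge0 (ltW r_lt_r2).
have d0 : 0 < 2 * P%:R :> R by lra.
(* A form of Bernoulli's inequality; at [k = n] the quotient is 16 P^2 / (2 P) = 8 P. *)
have bern k : r2 ^+ k * (1 + k%:R / (2 * P%:R)) <= 1.
  elim: k => [|k IH]; first by rewrite expr0 mul0r; lra.
  rewrite exprSr -natr1; apply: le_trans IH; rewrite -mulrA ler_wpM2l ?exprn_ge0 //.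
  have k0 : 0 <= k%:R / (2 * P%:R) :> R by rewrite divr_ge0 // ltW.
  have -> : r2 = 1 - (2 * P%:R)^-1 by [].
  have : 0 < (2 * P%:R)^-1 :> R by rewrite invr_gt0.
  set b := (2 * P%:R)^-1 => b0; rewrite -/b in k0; nra.
rewrite -[leRHS]mul1r ler_pdivlMr ?mulr_gt0 //.
apply: le_trans (bern n); rewrite ler_wpM2l ?exprn_ge0 //.
have -> : n%:R / (2 * P%:R) = 8 * P%:R :> R; last by lra.
by rewrite /n natrM natrX; field; rewrite gt_eqF.
Qed.

(** The full geometric series 1 / (1 - a) has real part at least 1/2 in the unit disc, and on the
    disc of radius [r2] the missing tail a^n / (1 - a) is at most (1 / (8 P)) / (1 / (2 P)) =
    1/4. *)
Lemma tlog_deriv_Re a : cm a <= r2 -> 0 <= complex.Re ((tlog n)^`()).[a].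
Proof.
have p0 := P0; have p1 := P1R; have r1 := r_lt1; have r21 := r2_lt1; have rr2 := r_lt_r2.
move=> ar2; have := tlog_derivE n a; set D := _.[a] => HD.
have a1 : cm (1 - a) >= 1 - r2.
  by have := cmD (1 - a) a; rewrite subrK cm1; lra.
have a0 : 1 - a != 0.
  by apply/eqP => h; move: a1; rewrite h cm0; lra.
have -> : D = (1 - a)^-1 - a ^+ n / (1 - a).
  by apply: (mulfI a0); rewrite HD mulrBr mulrCA divff // mulr1.
have g0 : 0 < cm (1 - a) := cm_gt0 a0.
have h1 : 1 / 2 <= complex.Re (1 - a)^-1.
  have -> : (1 - a)^-1 = (cm (1 - a) ^+ 2)^-1%:C%C * (1 - a)^*%C.
    by apply: (mulfI a0); rewrite divff // mulrCA mulcJ -rmorphM mulVf // gt_eqF ?exprn_gt0.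
  have c2 : 0 < cm (1 - a) ^+ 2 by rewrite exprn_gt0.
  rewrite cReM /= mul0r subr0 cReC [leRHS]mulrC ler_pdivlMr // cm_sqr cReD cReN cImD cImN /=.
  have := cm_sqr a; have : cm a ^+ 2 <= 1.
    by rewrite expr_le1 ?cm_ge0 //; lra.
  nra.
have h2 : cm (a ^+ n / (1 - a)) <= 1 / 4.
  rewrite cmM cmV ler_pdivrMr // cmX.
  have e1 : cm a ^+ n <= (8 * P%:R)^-1.
    by apply: le_trans r2_n; rewrite lerXn2r ?nnegrE ?cm_ge0 // (le_trans _ ar2) ?cm_ge0.
  have q : (8 * P%:R)^-1 = (1 - r2) / 4 by rewrite /r2; field; rewrite gt_eqF.
  by rewrite q in e1; lra.
have := Re_le_cm (a ^+ n / (1 - a)); rewrite cReD cReN; lra.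
Qed.

Lemma tlog_deriv_cm a : cm a <= 1 -> cm (1 - a) * cm ((tlog n)^`()).[a] <= 2.
Proof.
have p0 := P0; have p1 := P1R; have r1 := r_lt1; have r21 := r2_lt1; have rr2 := r_lt_r2.
move=> a1; rewrite -cmM tlog_derivE; apply: le_trans (cmD _ _) _.
by rewrite cmN cm1; have := cm_X_le1 n a1; lra.
Qed.

Lemma tlog_cm a : cm a <= 1 -> cm (1 - a) * cm (tlog n).[a] <= 2.
Proof.
have p0 := P0; have p1 := P1R; have r1 := r_lt1; have r21 := r2_lt1; have rr2 := r_lt_r2.
move=> a1; have := tlog_tail a1 (leq0n n).
by rewrite divr1 tlogE big_mkord.
Qed.

Lemma tlog_real (x : R) : (tlog n).[x%:C%C] = (complex.Re (tlog n).[x%:C%C])%:C%C.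
Proof.
have p0 := P0; have p1 := P1R; have r1 := r_lt1; have r21 := r2_lt1; have rr2 := r_lt_r2.
rewrite tlogE cRe_sum rmorph_sum; apply: eq_bigr => j _.
by rewrite -(rmorph_nat (real_complex R)) -fmorphV -rmorphXn -rmorphM.
Qed.

Lemma tlog_ReE (x : R) :
  complex.Re (tlog n).[x%:C%C] = \sum_(0 <= j < n) x ^+ j.+1 / j.+1%:R.
Proof.
have p0 := P0; have p1 := P1R; have r1 := r_lt1; have r21 := r2_lt1; have rr2 := r_lt_r2.
rewrite tlogE cRe_sum big_mkord; apply: eq_bigr => j _.
by rewrite -(rmorph_nat (real_complex R)) -fmorphV -rmorphXn -rmorphM.
Qed.

(** By Bernoulli, r^j >= 1 - j / P, so each of the first [K] terms of [N] loses at most 1 / P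
    against the harmonic sum. *)
Lemma harm_le_norm K : (K <= n)%N -> harm K - K%:R / P%:R <= N.
Proof.
have p0 := P0; have p1 := P1R; have r1 := r_lt1; have r21 := r2_lt1; have rr2 := r_lt_r2.
move=> Kn; rewrite /N tlog_ReE (big_cat_nat (leq0n K) Kn) /=.
apply: (@le_trans _ _ (\sum_(0 <= j < K) r ^+ j.+1 / j.+1%:R)); last first.
  rewrite lerDl sumr_ge0 // => j _; rewrite divr_ge0 // exprn_ge0 //.
have -> : K%:R / P%:R = \sum_(0 <= j < K) P%:R^-1 :> R.
  by rewrite sumr_const_nat subn0 mulr_natl.
rewrite /harm -sumrB; apply: ler_sum => j _.
rewrite -(@ler_pM2r _ j.+1%:R) ?ltr0n // mulrBl mulVf ?pnatr_eq0 //.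
rewrite mulrAC -mulrA divff ?mulr1 ?pnatr_eq0 //.
elim: (j.+1) => [|k IH]; first by rewrite mulr0 expr0; lra.
rewrite exprS -natr1.
have b0 : 0 < P%:R^-1 :> R by rewrite invr_gt0.
have -> : r = 1 - P%:R^-1 by [].
have : 0 <= k%:R :> R by [].
have := exprn_ge0 k r_ge0; have := exprn_ile1 k r_ge0 (ltW r_lt1).
rewrite /r in IH *; set b := P%:R^-1 in b0 IH *; set q := (1 - b) ^+ k in IH *; nra.
Qed.

(** Cut the sum at [K], the integer part of 1 / |1 - a|. The first [K] terms differ from the
    harmonic sum by at most K |1 - a| <= 1, and summation by parts bounds the others by 2. After
    division by the large number [N] the values therefore cluster on the interval from 0 to 1. *)
Lemma tlog_near_segment a : cm a <= r2 -> exists2 h : R, 0 <= h <= N + 2 &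
  cm ((tlog n).[a] - h%:C%C) <= 3.
Proof.
have p0 := P0; have p1 := P1R; have r1 := r_lt1; have r21 := r2_lt1; have rr2 := r_lt_r2.
move=> ar2.
have a1 : cm a <= 1 by apply: le_trans ar2 (ltW r2_lt1).
have a2 : cm (1 - a) >= 1 - r2.
  by have := cmD (1 - a) a; rewrite subrK cm1; lra.
have g0 : 0 < cm (1 - a) by apply: lt_le_trans a2; rewrite subr_gt0.
pose K := Num.truncn (cm (1 - a))^-1.
have /andP[K1 K2] : K%:R <= (cm (1 - a))^-1 < K.+1%:R.
  by apply: truncn_itv; rewrite invr_ge0 ltW.
have K1' : K%:R * cm (1 - a) <= 1 by rewrite -ler_pdivlMr // mul1r.
have K2' : 1 <= K.+1%:R * cm (1 - a) by rewrite -ler_pdivrMr // mul1r ltW.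
have K2P : K%:R <= 2 * P%:R :> R.
  apply: le_trans K1 _; rewrite -(@ler_pM2r _ (cm (1 - a))) // mulVf ?gt_eqF //.
  have := ler_wpM2l (ltW (mulr_gt0 (ltr0n R 2) P0)) a2.
  by rewrite mulrBr [2 * P%:R * r2]mulrC r2P; lra.
have Kn : (K <= n)%N.
  rewrite -(ler_nat R); apply: le_trans K2P _; rewrite /n natrM natrX; nra.
exists (harm K).
  rewrite harm_ge0 /=; have := harm_le_norm Kn.
  have : K%:R / P%:R <= 2 :> R by rewrite ler_pdivrMr.
  lra.
rewrite tlogE -[X in X - _](big_mkord xpredT (fun j => a ^+ j.+1 / j.+1%:R)).
rewrite (big_cat_nat (leq0n K) Kn) /= addrAC; apply: le_trans (cmD _ _) _.
have := tlog_head K a1; have := tlog_tail a1 Kn.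
set T := cm (\sum_(K <= _ < _) _) => h1 h2.
have : T <= 2.
  have := ler_wpM2r (cm_ge0 (\sum_(K <= i < n) a ^+ i.+1 / i.+1%:R)) K2'.
  rewrite mul1r -/T; move: h1; rewrite ler_pdivlMr ?ltr0n // => h1; nra.
lra.
Qed.

(** The first [J] terms are at most 1; the others are at most r^j / J and their geometric sum is at
    most P / J. With P = J^2 this gives N <= 2 J, crude for a logarithm but small against a
    derivative of order [P]. *)
Lemma tlog_norm_le (J : nat) : (1 <= J)%N -> (J <= n)%N -> N <= J%:R + P%:R / J%:R.
Proof.
have p0 := P0; have p1 := P1R; have r1 := r_lt1; have r21 := r2_lt1; have rr2 := r_lt_r2.
move=> J1 Jn; rewrite /N tlog_ReE (big_cat_nat (leq0n J) Jn) /=.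
have J0 : 0 < J%:R :> R by rewrite ltr0n.
apply: lerD.
  have -> : J%:R = \sum_(0 <= j < J) 1 :> R by rewrite sumr_const_nat subn0.
  apply: ler_sum => j _; rewrite ler_pdivrMr ?ltr0n // mul1r.
  by apply: (@le_trans _ _ 1); [rewrite exprn_ile1 // ltW|rewrite ler1n].
apply: (@le_trans _ _ (\sum_(J <= j < n) r ^+ j.+1 / J%:R)).
  rewrite [leLHS]big_nat [leRHS]big_nat; apply: ler_sum => j /andP[Jj _].
  rewrite ler_wpM2l ?exprn_ge0 // lef_pV2 ?posrE ?ltr0n // ler_nat.
  exact: leq_trans Jj (leqnSn j).
rewrite -mulr_suml ler_wpM2r ?invr_ge0 ?(ltW J0) //.
have geo k : \sum_(J <= j < k) r ^+ j.+1 <= P%:R * (1 - r ^+ k).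
  elim: k => [|k IH]; first by rewrite big_geq // expr0; lra.
  have [kJ|Jk] := ltnP k J.
    rewrite big_geq // mulr_ge0 ?subr_ge0 ?exprn_ile1 // ltW //.
  rewrite big_nat_recr //= exprS; have := rP; have := exprn_ge0 k r_ge0; nra.
apply: le_trans (geo n) _.
have := exprn_ge0 n r_ge0; nra.
Qed.

Lemma tlog_deriv_real :
  ((tlog n)^`()).[r%:C%C] = (P%:R * (1 - r ^+ n))%:C%C.
Proof.
have p0 := P0; have p1 := P1R; have r1 := r_lt1; have r21 := r2_lt1; have rr2 := r_lt_r2.
have h := tlog_derivE n r%:C%C.
have r0 : 1 - r%:C%C != 0 :> C.
  by rewrite -(rmorph1 (real_complex R)) -rmorphB fmorph_eq0 subr_eq0 gt_eqF.
apply: (mulfI r0); rewrite h -(rmorph1 (real_complex R)) -rmorphXn -!rmorphB -rmorphM.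
congr (_ %:C)%C; rewrite /r; field; by rewrite gt_eqF.
Qed.

Lemma tlog_deriv_ge : 3 / 4 * P%:R <= P%:R * (1 - r ^+ n).
Proof.
have p0 := P0; have p1 := P1R; have r1 := r_lt1; have r21 := r2_lt1; have rr2 := r_lt_r2.
rewrite mulrC ler_wpM2l ?(ltW p0) //.
have : r ^+ n <= r2 ^+ n by rewrite lerXn2r ?nnegrE // ltW // (le_lt_trans r_ge0).
have := r2_n; have : (8 * P%:R)^-1 <= 1 / 4 :> R.
  by rewrite -[leLHS]mul1r ler_pdivrMr ?mulr_gt0 //; lra.
lra.
Qed.

End EvaluationPoint.

Lemma harm_pow2 k : k%:R / 2 <= harm (2 ^ k).
Proof.
elim: k => [|k IH]; first by rewrite mul0r harm_ge0.
have le2 : (2 ^ k <= 2 ^ k.+1)%N by rewrite leq_exp2l.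
rewrite /harm (big_cat_nat (leq0n _) le2) /= -natr1 mulrDl lerD //.
apply: (@le_trans _ _ (\sum_(2 ^ k <= j < 2 ^ k.+1) (2 ^ k.+1)%:R^-1)).
  rewrite sumr_const_nat expnS mul2n -addnn addnK -mulr_natr natrD.
  have : 0 < (2 ^ k)%:R :> R by rewrite ltr0n expn_gt0.
  by set q := (2 ^ k)%:R => q0; rewrite le_eqVlt; apply/orP; left; apply/eqP; field; lra.
rewrite [leLHS]big_nat [leRHS]big_nat; apply: ler_sum => j /andP[_ jk].
by rewrite lef_pV2 ?posrE ?ltr0n ?expn_gt0 // ler_nat.
Qed.

End TruncatedLog.

(** * Polynomial bumps concentrated at a point of a sphere *)

Section Bump.
Variables (R : realType) (m : nat).
Local Notation C := R[i].
Local Notation V := 'rV[C]_m.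
Implicit Types (r : R) (x y z u v : V) (l : V -> C).

(* Realised by the truncation of [- ln (1 - t)], [t = dot x zeta / r ^+ 2],
   evaluated slightly inside its disc of convergence, normalised at [zeta] and
   corrected at the nodes by interpolation; the slope at [zeta] tends to infinity
   because the logarithm blows up at [t = 1] while its derivative blows up faster. *)
Record bump_seq (r : R) (zeta : V) (Q : seq V) (lam : nat -> V -> C)
    (rho tau : nat -> R) : Prop := Bump {
  bump_poly : forall k, polyfun (lam k);
  bump_tip : forall k, lam k zeta = 1;
  bump_node : forall k q, q \in Q -> lam k q = 0;
  bump_radius : forall k, r < rho k <= 2 * r;
  bump_radius_cvg : forall e : R, 0 < e -> \forall k \near \oo, rho k <= r + e;
  bump_grad : forall k, sgrad (lam k) zeta ((tau k)%:C%C *: zeta);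
  bump_slope : forall X : R, \forall k \near \oo, X <= tau k;
  bump_off : forall d : R, 0 < d -> \forall k \near \oo, forall x,
    nr x <= rho k -> d <= nr (x - zeta) -> cm (lam k x) <= d;
  bump_off_lip : forall d : R, 0 < d -> \forall k \near \oo, forall x y,
    nr x <= rho k -> nr y <= rho k -> d <= nr (x - zeta) -> d <= nr (y - zeta) ->
    cm (lam k x - lam k y) <= d * nr (x - y);
  bump_segment : forall d : R, 0 < d -> \forall k \near \oo, forall x,
    nr x <= rho k -> exists2 th : R, 0 <= th <= 1 & cm (lam k x - th%:C%C) <= d;
  bump_monotone : forall d : R, 0 < d -> \forall k \near \oo, forall x y,
    nr x <= rho k -> nr y <= rho k -> exists2 t : C, 0 <= complex.Re t &
    cm (lam k x - lam k y - t * dot (x - y) zeta) <= d * nr (x - y) }.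

Lemma sgrad_poly (p : {poly C}) l z a : sgrad l z a ->
  sgrad (fun x => p.[l x]) z ((p^`().[l z])^*%C *: a).
Proof.
move=> hl; elim/poly_ind: p => [|p c IH].
  have -> : (fun x => (0 : {poly C}).[l x]) = fun=> 0.
    by apply/funext => x; rewrite horner0.
  rewrite deriv0 horner0 conjc0 scale0r; exact: sgrad_const.
have -> : (fun x => (p * 'X + c%:P).[l x]) = fun x => p.[l x] * l x + c.
  by apply/funext => x; rewrite hornerMXaddC.
have := sgradD (sgradM IH hl) (@sgrad_const R m c z).
rewrite addr0 scalerA -scalerDl -!rmorphM -rmorphD /=.
by rewrite derivD derivC addr0 derivM derivX mulr1 hornerD hornerMX mulrC.
Qed.

Lemma sgrad_dot a (c : C) z : sgrad (fun x => c * dot x a) z (c^*%C *: a).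
Proof.
move=> w w0; exists 1 => // x y _ _.
rewrite dotZr conjcK dotBl mulrBr subrr cm0 mulr_ge0 ?nr_ge0 //; exact: ltW.
Qed.

(** A product of squares of the affine functions <x - p, q - p> / |q - p|^2; the squares make the
    differential vanish on [S]. With [zeta] in [S], adding a multiple of [g] to a bump keeps its
    value and its gradient at [zeta]. *)
Lemma interpolation (S : seq V) q : q \notin S -> exists2 g : V -> C,
  polyfun g & g q = 1 /\ forall p, p \in S -> g p = 0 /\ sgrad g p 0.
Proof.
elim: S => [_|p S IH].
  by exists (fun=> 1); [exact: pf_const|split].
rewrite inE negb_or => /andP[qp /IH[g pg [gq hg]]].
pose c := (dot (q - p) (q - p))^-1.
have n0 : dot (q - p) (q - p) != 0.
  rewrite dotxx -(rmorph0 (real_complex R)) (inj_eq (@complexI _)).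
  by rewrite sqrf_eq0 gt_eqF // nr_gt0 // subr_eq0.
pose l x := c * dot x (q - p) - c * dot p (q - p).
have pl : polyfun l by apply: pf_add; [exact: polyfun_dot|exact: pf_const].
have lp : l p = 0 by rewrite /l subrr.
have lq : l q = 1 by rewrite /l -mulrBr -dotBl mulVf.
exists (fun x => g x * (l x * l x)); first by do 2?apply: pf_mul.
split=> [|p']; first by rewrite gq lq !mulr1.
have [a ha] := polyfun_sgrad pg p'; have [b hb] := polyfun_sgrad pl p'.
rewrite inE => /predU1P[p'p|/hg[gp' sg]].
  rewrite p'p lp !mulr0; split=> //; rewrite p'p in ha hb.
  have := sgradM ha (sgradM hb hb); rewrite lp !mulr0 conjc0 !scale0r addr0.
  by rewrite scaler0 addr0.
rewrite gp' mul0r; split=> //.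
have := sgradM sg (sgradM hb hb); rewrite gp' conjc0 scale0r addr0.
by rewrite scaler0.
Qed.

(** The correction is [- lam k q] times an interpolating polynomial. As [q] is not [zeta], the
    coefficient tends to 0, so the correction is small together with its Lipschitz constant on the
    ball of radius [2 * r], and all asymptotic properties survive. *)
Lemma bump_add_node r zeta Q lam rho tau q : nr zeta = r -> nr q <= r ->
  q != zeta -> bump_seq r zeta Q lam rho tau ->
  exists lam', bump_seq r zeta (q :: Q) lam' rho tau.
Proof.
move=> zr qr qz [pl tip node rad radc grad slope off offl seg mono].
have [qQ|qQ] := boolP (q \in Q).
  exists lam; split=> // k x; rewrite inE => /predU1P[->|]; exact: node.
have [g pg [gq hg]] : exists2 g : V -> C,
    polyfun g & g q = 1 /\ forall p, p \in zeta :: Q -> g p = 0 /\ sgrad g p 0.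
  by apply: interpolation; rewrite inE negb_or qz.
have [gz sgz] := hg zeta (mem_head _ _).
have [K K0 [gb gl]] := polyfun_lip (2 * r) pg.
pose c k := - lam k q.
have cK (d : R) : 0 < d -> \forall k \near \oo, cm (c k) * K <= d.
  move=> d0; have K1 : 0 < K + 1 by lra.
  have qz0 : 0 < nr (q - zeta) by rewrite nr_gt0 // subr_eq0.
  have e0 : 0 < Num.min (nr (q - zeta)) (d / (K + 1)).
    by rewrite lt_min qz0 divr_gt0.
  apply: filterS (off _ e0) => k hk; rewrite /c cmN.
  have := hk q (le_trans qr (ltW (andP (rad k)).1)).
  rewrite ge_min lexx /= => /(_ isT); rewrite le_min => /andP[_].
  rewrite ler_pdivlMr //; have := cm_ge0 (lam k q); lra.
have small k x : nr x <= rho k -> cm (c k * g x) <= cm (c k) * K.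
  move=> xr; rewrite cmM ler_wpM2l ?cm_ge0 // gb //.
  by apply: le_trans xr (andP (rad k)).2.
have smalll k x y : nr x <= rho k -> nr y <= rho k ->
    cm (c k * g x - c k * g y) <= cm (c k) * K * nr (x - y).
  move=> xr yr; rewrite -mulrBr cmM -mulrA ler_wpM2l ?cm_ge0 // gl //.
    by apply: le_trans xr (andP (rad k)).2.
  by apply: le_trans yr (andP (rad k)).2.
exists (fun k x => lam k x + c k * g x); split => //.
- by move=> k; apply: pf_add => //; apply: pf_mul => //; exact: pf_const.
- by move=> k; rewrite gz mulr0 addr0.
- move=> k p; rewrite inE => /predU1P[->|pQ]; first by rewrite gq mulr1 subrr.
  by rewrite node // add0r (hg p _).1 ?mulr0 // inE pQ orbT.
- move=> k; have := sgradD (grad k) (sgradM (sgrad_const (c k) zeta) sgz).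
  by rewrite !scaler0 addr0 addr0.
- move=> d d0; have d2 : 0 < d / 2 by rewrite divr_gt0.
  apply: filterS2 (off _ d2) (cK _ d2) => k h1 h2 x xr xd.
  apply: le_trans (cmD _ _) _; have := h1 x xr; have := small k x xr; lra.
- move=> d d0; have d2 : 0 < d / 2 by rewrite divr_gt0.
  apply: filterS2 (offl _ d2) (cK _ d2) => k h1 h2 x y xr yr xd yd.
  rewrite opprD addrACA; apply: le_trans (cmD _ _) _.
  have := smalll k x y xr yr; have := nr_ge0 (x - y).
  have := h1 x y xr yr; nra.
- move=> d d0; have d2 : 0 < d / 2 by rewrite divr_gt0.
  apply: filterS2 (seg _ d2) (cK _ d2) => k h1 h2 x xr.
  have [th th01 hth] := h1 x xr; exists th => //.
  rewrite addrAC; apply: le_trans (cmD _ _) _; have := small k x xr; lra.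
- move=> d d0; have d2 : 0 < d / 2 by rewrite divr_gt0.
  apply: filterS2 (mono _ d2) (cK _ d2) => k h1 h2 x y xr yr.
  have [t t0 ht] := h1 x y xr yr; exists t => //.
  rewrite (_ : _ - _ - _ = (lam k x - lam k y - t * dot (x - y) zeta) +
    (c k * g x - c k * g y)); last by ring.
  apply: le_trans (cmD _ _) _.
  have := smalll k x y xr yr; have := nr_ge0 (x - y); nra.
Qed.

Lemma bump_exists0 r zeta : 0 < r -> nr zeta = r ->
  exists lam rho tau, bump_seq r zeta [::] lam rho tau.
Proof.
move=> r0 zr.
(* The square of [J = 2 ^ k.+1], the value of [J] that balances the two terms of [tlog_norm_le]. *)
pose P k := (2 ^ (2 * k.+1))%N.
have P1 k : (1 <= P k)%N by rewrite expn_gt0.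
pose n k := (16 * P k ^ 2)%N.
pose r1 k : R := 1 - (P k)%:R^-1.
pose r2 k : R := 1 - (2 * (P k)%:R)^-1.
pose N k : R := complex.Re (tlog R (n k)).[(r1 k)%:C%C].
pose p k : {poly C} := (N k)^-1%:C%C *: tlog R (n k).
(* This form sends [zeta] to [r1 k] and the ball of radius [rho k] into the disc of radius [r2 k],
   where the derivative has nonnegative real part; [rho k] exceeds [r] because [r1 k < r2 k]. *)
pose l k x : C := (r1 k / r ^+ 2)%:C%C * dot x zeta.
have P4 k : 4 <= (P k)%:R :> R.
  by rewrite (ler_nat R 4) /P -[4%N]/(2 ^ 2)%N leq_exp2l // mulnS leq_addr.
have P0 k : 0 < (P k)%:R :> R by apply: lt_le_trans (P4 k).
have iP k : 0 < ((P k)%:R^-1 : R) <= 1 / 4.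
  by rewrite invr_gt0 P0 /= -[leLHS]mul1r ler_pdivrMr //; have := P4 k; lra.
have r2E k : r2 k = 1 - (P k)%:R^-1 / 2.
  by rewrite /r2; field; rewrite gt_eqF.
have r1_ge k : 3 / 4 <= r1 k by have /andP[_] := iP k; rewrite /r1; lra.
have r1_le k : r1 k < 1 by have /andP[+ _] := iP k; rewrite /r1; lra.
have r12 k : r1 k < r2 k by have /andP[+ _] := iP k; rewrite r2E /r1; lra.
have r2_le k : r2 k < 1 by have /andP[+ _] := iP k; rewrite r2E; lra.
have kN k : k%:R <= N k.
  have Pn : (P k <= n k)%N by rewrite /n expnS expn1 mulnA leq_pmull // muln_gt0 /= P1.
  have := @harm_le_norm R (P k) (P1 k) (P k) Pn.
  rewrite divff ?gt_eqF // -/(r1 k) -/(N k); have := harm_pow2 R (2 * k.+1).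
  rewrite -/(P k) natrM -(natr1 k); lra.
(* At [k = 0] the bound [kN] is not strict; four terms of the harmonic sum exceed 4 / P <= 1. *)
have N0 k : 0 < N k.
  have Pn : (4 <= n k)%N by rewrite -(ler_nat R) /n natrM natrX; have := P4 k; nra.
  have := @harm_le_norm R (P k) (P1 k) 4 Pn.
  rewrite -/(r1 k) -/(N k) /harm !big_nat_recr //= big_geq // add0r.
  have /andP[_] := iP k; have : 0 < 2^-1 :> R by rewrite invr_gt0.
  have : 0 < 3^-1 :> R by rewrite invr_gt0.
  have : 0 < 4^-1 :> R by rewrite invr_gt0.
  lra.
pose rho k := r * (r2 k / r1 k).
have r1_0 k : 0 < r1 k by have := r1_ge k; lra.
have lc k x : nr x <= rho k -> cm (l k x) <= r2 k.
  move=> xr; rewrite /l cmM cm_real ger0_norm ?divr_ge0 ?exprn_ge0 ?(ltW (r1_0 k)) ?(ltW r0) //.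
  have h := cm_dot x zeta; rewrite zr in h.
  have h' : nr x * r <= rho k * r by rewrite ler_pM2r.
  rewrite mulrAC ler_pdivrMr ?exprn_gt0 //.
  have -> : r2 k * r ^+ 2 = r1 k * (rho k * r).
    by rewrite /rho; field; rewrite gt_eqF.
  by rewrite ler_pM2l //; apply: le_trans h h'.
have rhoE k : rho k <= r * (1 + (P k)%:R^-1).
  rewrite /rho ler_pM2l // ler_pdivrMr // r2E /r1; have /andP[] := iP k.
  set b := (P k)%:R^-1; nra.
have iPk (e : R) : 0 < e -> \forall k \near \oo, (P k)%:R^-1 <= e.
  move=> e0; have : \forall k \near \oo, e^-1 <= k%:R by exact: nbhs_infty_ger.
  apply: filterS => k hk; rewrite -(invrK e) lef_pV2 ?posrE ?invr_gt0 //.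
  apply: le_trans hk _; rewrite ler_nat /P; apply: (@leq_trans (2 ^ k)%N); first exact/ltnW/ltn_expl.
  by rewrite leq_exp2l // (leq_trans (leqnSn k)) // leq_pmull.
have Nk (e : R) : 0 < e -> \forall k \near \oo, (N k)^-1 <= e.
  move=> e0; have : \forall k \near \oo, e^-1 <= k%:R by exact: nbhs_infty_ger.
  apply: filterS => k hk; rewrite -(invrK e) lef_pV2 ?posrE ?invr_gt0 //.
  exact: le_trans hk (kN k).
have lE k x y : l k x - l k y = (r1 k / r ^+ 2)%:C%C * dot (x - y) zeta.
  by rewrite /l dotBl mulrBr.
have pE k (z : C) : (p k).[z] = (N k)^-1%:C%C * (tlog R (n k)).[z] by rewrite hornerZ.
have pdE k (z : C) : ((p k)^`()).[z] = (N k)^-1%:C%C * ((tlog R (n k))^`()).[z].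
  by rewrite /p derivZ hornerZ.
have lz k : l k zeta = (r1 k)%:C%C.
  by rewrite /l dotxx zr -rmorphM divfK // gt_eqF ?exprn_gt0.
have convex_disc k (s t : C) (x : R) : 0 <= x <= 1 -> cm s <= r2 k -> cm t <= r2 k ->
    cm (t + x%:C%C * (s - t)) <= r2 k.
  move=> /andP[x0 x1] hs ht.
  have -> : t + x%:C%C * (s - t) = (1 - x)%:C%C * t + x%:C%C * s.
    by rewrite rmorphB rmorph1; ring.
  apply: le_trans (cmD _ _) _; rewrite !cmM !cm_real !ger0_norm ?subr_ge0 //.
  nra.
(* Roundness of the sphere: |x - zeta| >= d gives 2 Re <x, zeta> <= |x|^2 + r^2 - d^2, so [l k x]
   keeps away from the singularity 1 once [rho k] is close to [r]. *)
have rho_off (d : R) : 0 < d -> exists2 d' : R, 0 < d' <= 1 &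
    \forall k \near \oo, forall x, nr x <= rho k -> d <= nr (x - zeta) ->
    complex.Re (l k x) <= 1 - d'.
  move=> d0; pose d' := Num.min 1 (d ^+ 2 / (4 * r ^+ 2)).
  have r20 : 0 < r ^+ 2 by rewrite exprn_gt0.
  have d2 : 0 < d ^+ 2 by rewrite exprn_gt0.
  have d'1 : d' <= 1 by rewrite ge_min lexx.
  have d'2 : d' * (4 * r ^+ 2) <= d ^+ 2.
    by rewrite -ler_pdivlMr ?mulr_gt0 // ge_min lexx orbT.
  have d'0 : 0 < d' by rewrite lt_min ltr01 divr_gt0 // mulr_gt0.
  exists d'; first by rewrite d'0.
  have e0 : 0 < d' / 2 by rewrite divr_gt0.
  apply: filterS (iPk _ e0) => k hk x xr xd.
  rewrite /l cReM /= mul0r subr0.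
  set D := complex.Re (dot x zeta).
  have hD : 2 * D <= nr x ^+ 2 + r ^+ 2 - d ^+ 2.
    have : d ^+ 2 <= nr (x - zeta) ^+ 2.
      by rewrite ler_pXn2r ?nnegrE ?nr_ge0 // ltW.
    rewrite nrD_sqr nrN zr dotNr cReN -/D; lra.
  have hx : nr x ^+ 2 <= r ^+ 2 * (1 + 2 * d').
    have h1 : nr x <= r * (1 + d' / 2).
      apply: le_trans xr (le_trans (rhoE k) _); rewrite ler_pM2l //; lra.
    apply: (@le_trans _ _ ((r * (1 + d' / 2)) ^+ 2)).
      by rewrite ler_pXn2r ?nnegrE ?nr_ge0 // mulr_ge0 ?ltW //; lra.
    by rewrite exprMn ler_pM2l //; nra.
  have hD' : D <= r ^+ 2 * (1 - d') by nra.
  rewrite mulrAC ler_pdivrMr //.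
  have h0 : 0 <= r ^+ 2 * (1 - d') by rewrite mulr_ge0 ?subr_ge0 ?(ltW r20).
  have := r1_le k; have := r1_0 k; nra.
(* In the mean value theorem take for [c] the conjugate of [s]: then [c * s] is |s|^2 and the
   difference quotient inherits the sign of the real part of the derivative. *)
have quot k x y : nr x <= rho k -> nr y <= rho k -> exists2 t : C,
    0 <= complex.Re t & (p k).[l k x] - (p k).[l k y] = t * dot (x - y) zeta.
  move=> xr yr; set D := _ - _; set s := l k x - l k y.
  have [s0|s0] := eqVneq s 0.
    exists 0 => //; rewrite mul0r /D; apply/eqP; rewrite subr_eq0; apply/eqP.
    by move/eqP: s0; rewrite subr_eq0 => /eqP ->.
  exists (D / s * (r1 k / r ^+ 2)%:C%C); last by rewrite -[RHS]mulrA -lE -/s divfK.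
  have [x0 x01 hx] := complex_mvt (p k) s^*%C (l k x) (l k y).
  rewrite cReM /= mulr0 subr0 mulr_ge0 ?divr_ge0 ?exprn_ge0 ?(ltW r0) ?(ltW (r1_0 k)) //.
  have -> : D / s = (cm s ^+ 2)^-1%:C%C * (s^*%C * D).
    apply: (mulfI s0); rewrite [LHS]mulrCA divff // mulr1 [RHS]mulrCA (mulrA s) mulcJ mulrA -rmorphM.
    by rewrite mulVf ?mul1r // gt_eqF // exprn_gt0 // cm_gt0.
  rewrite cReM /= mul0r subr0 mulr_ge0 ?invr_ge0 ?exprn_ge0 ?cm_ge0 //.
  rewrite /D hx -/s [s^*%C * s]mulrC mulcJ cReM /= mul0r subr0.
  rewrite mulr_ge0 ?exprn_ge0 ?cm_ge0 // pdE cReM /= mul0r subr0.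
  rewrite mulr_ge0 ?invr_ge0 ?(ltW (N0 k)) //.
  by apply: (tlog_deriv_Re (P1 k)); apply: convex_disc => //; apply: lc.
pose tau k := (N k)^-1 * ((P k)%:R * (1 - r1 k ^+ n k)) * (r1 k / r ^+ 2).
exists (fun k x => (p k).[l k x]), rho, tau; split=> //.
- by move=> k; apply: polyfun_poly; exact: polyfun_dot.
- move=> k; rewrite pE lz (tlog_real (P1 k)) -/(N k) -rmorphM mulVf ?gt_eqF //.
- move=> k; apply/andP; split.
    by rewrite /rho -{1}(mulr1 r) ltr_pM2l // ltr_pdivlMr // mul1r.
  apply: le_trans (rhoE k) _; rewrite mulrC ler_pM2r //.
  by have /andP[_] := iP k; lra.
- move=> e e0; have e1 : 0 < e / r by rewrite divr_gt0.
  apply: filterS (iPk _ e1) => k; rewrite ler_pdivlMr // => hk.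
  by apply: le_trans (rhoE k) _; rewrite mulrDr mulr1 lerD2l mulrC.
- move=> k; have := sgrad_poly (p k) (sgrad_dot zeta (r1 k / r ^+ 2)%:C%C zeta).
  rewrite -/(l k zeta) lz pdE (tlog_deriv_real _ (P1 k)) -rmorphM !conjc_real scalerA.
  by rewrite -rmorphM.
- move=> X; have X0 : 0 < Num.max X 1 by rewrite lt_max ltr01 orbT.
  have e0 : 0 < (Num.max X 1 * r ^+ 2 * 8)^-1 by rewrite invr_gt0 !mulr_gt0 ?exprn_gt0.
  have : \forall k \near \oo, Num.max X 1 * r ^+ 2 * 8 <= k%:R by exact: nbhs_infty_ger.
  apply: filterS => k hk; apply: (@le_trans _ _ (Num.max X 1)); first by rewrite le_max lexx.
  pose J := (2 ^ k.+1)%N.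
  have J0 : 0 < J%:R :> R by rewrite ltr0n expn_gt0.
  have PJ : P k = (J ^ 2)%N by rewrite /J /P -expnM mulnC.
  have Jn : (J <= n k)%N.
    rewrite /n PJ -expnM; apply: (@leq_trans (J ^ 4)%N); last by rewrite leq_pmull.
    by rewrite -[leqLHS]expn1 leq_pexp2l // /J expn_gt0.
  have J0n : (0 < J)%N by rewrite expn_gt0.
  have := @tlog_norm_le R _ (P1 k) J J0n Jn.
  rewrite -/(r1 k) -/(N k) PJ natrX expr2 mulfK ?gt_eqF // => hN.
  have := tlog_deriv_ge R (P1 k); rewrite -/(r1 k) -/(n k) => hD.
  have kJ : k%:R <= J%:R :> R by rewrite ler_nat; apply: (@leq_trans (2 ^ k)%N); [exact/ltnW/ltn_expl|rewrite leq_exp2l].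
  rewrite /tau; set A := (P k)%:R * _ in hD *.
  have PJ' : (P k)%:R = J%:R ^+ 2 :> R by rewrite PJ natrX.
  have -> : (N k)^-1 * A * (r1 k / r ^+ 2) = A * r1 k / (r ^+ 2 * N k).
    have E (a b c d : R) : a * c * (d * b) = c * d * (b * a) by ring.
    by rewrite [in RHS]invfM E.
  rewrite ler_pdivlMr ?mulr_gt0 ?exprn_gt0 // mulrA.
  have := r1_ge k; have := N0 k.
  set M := Num.max X 1 * r ^+ 2 in hk *.
  have M0 : 0 < M by rewrite mulr_gt0 ?exprn_gt0.
  rewrite PJ' in hD.
  move=> Nk0 r1k.
  apply: (@le_trans _ _ (J%:R / 8 * (2 * J%:R))).
    by apply: ler_pM; rewrite ?(ltW M0) ?(ltW Nk0) //; lra.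
  apply: (@le_trans _ _ (3 / 4 * (3 / 4 * J%:R ^+ 2))).
    rewrite expr2; nra.
  by rewrite [leRHS]mulrC; apply: ler_pM; rewrite ?mulr_ge0 ?exprn_ge0 ?(ltW J0).
- move=> d d0; have [d' /andP[d'0 d'1] hoff] := rho_off _ d0.
  have e0 : 0 < d * d' / 2 by rewrite divr_gt0 // mulr_gt0.
  apply: filterS2 hoff (Nk _ e0) => k h1 h2 x xr xd.
  have h3 := h1 x xr xd; have xr' := lc k x xr.
  have a1 : cm (l k x) <= 1 by have := r2_le k; lra.
  have h4 : d' <= cm (1 - l k x).
    by apply: le_trans (Re_le_cm _); rewrite cReD cReN /=; lra.
  have := tlog_cm (P1 k) a1; rewrite pE cmM cm_real gtr0_norm ?invr_gt0 //.
  have := cm_ge0 (tlog R (n k)).[l k x]; have : 0 < (N k)^-1 by rewrite invr_gt0.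
  set T := cm _.[_]; set I := (N k)^-1; set c := cm _ => I0 T0 hT.
  have hT' : d' * T <= 2 by nra.
  apply: (@le_trans _ _ (d * d' / 2 * T)); first by rewrite ler_wpM2r.
  nra.
- move=> d d0; have [d' /andP[d'0 d'1] hoff] := rho_off _ d0.
  have e0 : 0 < d * d' * r / 2 by rewrite divr_gt0 // !mulr_gt0.
  apply: filterS2 hoff (Nk _ e0) => k h1 h2 x y xr yr xd yd.
  set D := _ - _; set s := l k x - l k y.
  have [x0 /andP[x00 x01] hx] := complex_mvt (p k) D^*%C (l k x) (l k y).
  set xi := l k y + x0%:C%C * _ in hx.
  have xi2 : cm xi <= r2 k by apply: convex_disc; rewrite ?x00 ?lc.
  have xi1 : cm xi <= 1 by have := r2_le k; lra.
  have h4 : d' <= cm (1 - xi).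
    have hxi : complex.Re xi <= 1 - d'.
      have e1 := h1 x xr xd; have e2 := h1 y yr yd.
      have -> : complex.Re xi = complex.Re (l k y) + x0 * (complex.Re (l k x) - complex.Re (l k y)).
        have E (a b : C) (q : R) : complex.Re (a + q%:C%C * (b - a)) =
            complex.Re a + q * (complex.Re b - complex.Re a).
          by rewrite cReD cReM cReD cReN mul0r subr0.
        exact: E.
      nra.
    by apply: le_trans (Re_le_cm _); rewrite cReD cReN /=; lra.
  have h5 := tlog_deriv_cm (P1 k) xi1.
  have h6 : cm D ^+ 2 <= cm D * (cm s * cm ((p k)^`()).[xi]).
    have -> : cm D ^+ 2 = complex.Re (D^*%C * D) by rewrite mulrC mulcJ.
    by rewrite hx; apply: le_trans (Re_le_cm _) _; rewrite !cmM cm_conj mulrA.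
  have [D0|D0] := eqVneq D 0; first by rewrite D0 cm0 mulr_ge0 ?nr_ge0 // ltW.
  move: h6; rewrite expr2 ler_pM2l ?cm_gt0 // => h6; apply: le_trans h6 _.
  rewrite pdE cmM cm_real gtr0_norm ?invr_gt0 //.
  have := cm_ge0 ((tlog R (n k))^`()).[xi]; have : 0 < (N k)^-1 by rewrite invr_gt0.
  move: h5; set T := cm ((tlog R (n k))^`()).[xi]; set I := (N k)^-1 => hT I0 T0.
  have hT' : d' * T <= 2 by nra.
  have hs : cm s <= nr (x - y) / r.
    rewrite /s lE cmM cm_real ger0_norm ?divr_ge0 ?exprn_ge0 ?(ltW r0) ?(ltW (r1_0 k)) //.
    have := cm_dot (x - y) zeta; rewrite zr => h.
    apply: (@le_trans _ _ ((r ^+ 2)^-1 * (nr (x - y) * r))).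
      apply: ler_pM => //; rewrite ?cm_ge0 // ?divr_ge0 ?exprn_ge0 ?(ltW r0) ?(ltW (r1_0 k)) //.
      by rewrite -[leRHS]mul1r ler_pM2r ?invr_gt0 ?exprn_gt0 // ltW.
    by rewrite le_eqVlt; apply/orP; left; apply/eqP; field; rewrite gt_eqF.
  have hIT : I * T <= d * r.
    apply: (@le_trans _ _ (d * d' * r / 2 * T)); first by rewrite ler_wpM2r.
    have : 0 < d * r by rewrite mulr_gt0.
    nra.
  apply: (@le_trans _ _ (nr (x - y) / r * (d * r))).
    by apply: ler_pM => //; rewrite ?cm_ge0 // mulr_ge0 // ltW.
  by rewrite le_eqVlt; apply/orP; left; apply/eqP; field; rewrite gt_eqF.
(* The real point [h] may exceed [N k] by 2; cutting it off adds this to the error 3, hence 5. *)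
- move=> d d0; have e0 : 0 < d / 5 by rewrite divr_gt0.
  apply: filterS (Nk _ e0) => k hk x xr.
  have [h /andP[h0 hN] hh] := tlog_near_segment (P1 k) (lc k x xr).
  rewrite -/(r1 k) -/(N k) -/(n k) in hN hh.
  exists (Num.min 1 (h / N k)).
    by rewrite le_min ler01 divr_ge0 ?(ltW (N0 k)) //= ge_min lexx.
  rewrite pE.
  have hmin : `|h - N k * Num.min 1 (h / N k)| <= 2.
    rewrite /Num.min; case: ifP => [|_].
      by rewrite ltr_pdivlMr // mul1r => hk'; rewrite mulr1 ger0_norm; lra.
    by rewrite mulrC divfK ?gt_eqF // subrr normr0.
  set th := Num.min _ _ in hmin *.
  have -> : (N k)^-1%:C%C * (tlog R (n k)).[l k x] - th%:C%C =
    (N k)^-1%:C%C * (((tlog R (n k)).[l k x] - h%:C%C) + (h - N k * th)%:C%C).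
    have q : th%:C%C = (N k)^-1%:C%C * (N k * th)%:C%C by rewrite -rmorphM mulKf ?gt_eqF.
    rewrite rmorphB [X in _ - X = _]q -mulrBr; congr (_ * _).
    by rewrite addrA subrK.
  rewrite cmM cm_real gtr0_norm ?invr_gt0 //.
  apply: (@le_trans _ _ ((N k)^-1 * 5)); last by lra.
  rewrite ler_pM2l ?invr_gt0 //; apply: le_trans (cmD _ _) _; rewrite cm_real.
  lra.
- move=> d d0; near=> k => x y xr yr.
  have [t t0 ->] := quot k x y xr yr; exists t => //.
  by rewrite subrr cm0 mulr_ge0 ?nr_ge0 // ltW.
Unshelve. all: by end_near. Qed.

Lemma bump_exists r zeta (Q : seq V) : 0 < r -> nr zeta = r ->
  (forall q, q \in Q -> nr q <= r /\ q != zeta) ->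
  exists lam rho tau, bump_seq r zeta Q lam rho tau.
Proof.
move=> r0 zr; elim: Q => [_|q Q IH h]; first exact: bump_exists0.
have [q' hq|lam [rho [tau b]]] := IH; first by apply: h; rewrite inE hq orbT.
have [qr qz] := h q (mem_head _ _).
by have [lam' b'] := bump_add_node zr qr qz b; exists lam', rho, tau.
Qed.

End Bump.

Arguments bump_seq {R m} r zeta Q lam rho tau.

(** * Chains and their limits under a perturbation *)

Section Chains.
Variables (R : realType) (m : nat).
Local Notation C := R[i].
Local Notation V := 'rV[C]_m.
Implicit Types (r : R) (x y z u v : V) (Phi h f : V -> V).

Definition nochain Phi h r := ~ exists x : nat -> V,
  (forall i, nr (x i) <= r) /\ forall i, h (x i) = Phi (x i.+1).

(** The values to keep away from: if [h zeta] were such a [p], the chain would close up at [zeta]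
    and could be repeated for ever. *)
Definition reach Phi h r (zeta p : V) := exists (n : nat) (x : nat -> V),
  [/\ forall i, nr (x i) <= r, x n = zeta, Phi (x 0%N) = p &
      forall i, (i < n)%N -> h (x i) = Phi (x i.+1)].

Lemma ulim_radius (x : nat -> V) l (rho : nat -> R) r : ulim x l ->
  (forall K, nr (x K) <= rho K) ->
  (forall e : R, 0 < e -> fu [set K | rho K <= r + e]) -> nr l <= r.
Proof.
move=> xl xr hr; apply: (ulim_le xl) => e /hr; apply: filterS => K /=.
exact: le_trans.
Qed.

Section Limit.
Variables (r : R) (zeta : V) (Q : seq V) (lam : nat -> V -> C) (rho tau : nat -> R).
Hypothesis hb : bump_seq r zeta Q lam rho tau.
Variable phi : nat -> nat.
Hypothesis hphi : forall K, (K <= phi K)%N.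

Lemma bump_rho_fu e : 0 < e -> fu [set K | rho (phi K) <= r + e].
Proof. by move=> /(bump_radius_cvg hb)/(near_fu hphi). Qed.

Lemma bump_ulim_ex (x : nat -> V) : (forall K, nr (x K) <= rho (phi K)) ->
  exists2 l, ulim x l & nr l <= r.
Proof.
move=> xr; have [l xl] : exists l, ulim x l.
  apply: (@ulim_ex _ _ _ (2 * r)); apply: filterS filterT => K _ /=.
  by apply: le_trans (xr K) _; have /andP[] := bump_radius hb (phi K).
by exists l => //; apply: (ulim_radius xl xr); exact: bump_rho_fu.
Qed.

(** The graphs converge to the graph of [f] with the segment from [f zeta] to [f zeta + v] attached
    above [zeta]. The bump values have a limit along the ultrafilter; [bump_segment] puts it in the
    real unit interval and [bump_off] makes it 0 unless [l] is [zeta]. *)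
Lemma bump_ulim (f : V -> V) v (x : nat -> V) l : econt f ->
  (forall K, nr (x K) <= rho (phi K)) -> ulim x l ->
  exists th : R, [/\ 0 <= th <= 1, l <> zeta -> th = 0 &
    ulim (fun K => f (x K) + lam (phi K) (x K) *: v) (f l + th%:C%C *: v)].
Proof.
move=> fc xr xl; pose a K := lam (phi K) (x K).
have seg (d : R) : 0 < d -> fu [set K | exists2 th : R, 0 <= th <= 1 & cm (a K - th%:C%C) <= d].
  move=> /(bump_segment hb)/(near_fu hphi); apply: filterS => K /= hK; exact: hK (xr K).
have [c hc] : exists c, ulimC a c.
  apply: (@ulimC_ex _ _ 2); apply: filterS (seg _ ltr01) => K [th /andP[h0 h1] /= hth].
  have := cmD (a K - th%:C%C) th%:C%C; rewrite subrK cm_real ger0_norm //; lra.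
have cseg (d : R) : 0 < d -> exists2 th : R, 0 <= th <= 1 & cm (c - th%:C%C) <= d.
  move=> d0; have d2 : 0 < d / 2 by rewrite divr_gt0.
  have [K [/= h1 [th th01 h2]]] := filter_ex (filterI (hc _ d2) (seg _ d2)).
  exists th => //; rewrite -(subrK (a K) c) -addrA; apply: le_trans (cmD _ _) _.
  rewrite cmB; lra.
have cRe : c = (complex.Re c)%:C%C.
  apply/eqP; rewrite eq_complex /= eqxx -normr_le0; apply/ler_addgt0Pr => d d0.
  have [th _ hth] := cseg _ d0; rewrite add0r; apply: le_trans hth.
  by have := normIm_cm (c - th%:C%C); rewrite cImD cImN /= subr0.
have c01 : 0 <= complex.Re c <= 1.
  apply/andP; split; apply/ler_addgt0Pr => d d0;
    have [th /andP[t0 t1] hth] := cseg _ d0;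
    have := normRe_cm (c - th%:C%C); rewrite cReD cReN /= ler_norml => /andP[]; lra.
exists (complex.Re c); split=> //; last first.
  rewrite -cRe; apply: ulimD (ulim_cont _ xl) (ulimZ v hc); exact: fc.
move=> lz; have d0 : 0 < nr (l - zeta) by rewrite nr_gt0 // subr_eq0; apply/eqP.
have c0 : c = 0.
  apply: cm_eq0; apply/eqP; rewrite eq_le cm_ge0 andbT; apply/ler_addgt0Pr => d dp.
  have e0 : 0 < Num.min (d / 2) (nr (l - zeta) / 2) by rewrite lt_min !divr_gt0.
  have d2 : 0 < d / 2 by rewrite divr_gt0.
  have [K [[/= h1 h2] h3]] := filter_ex (filterI (filterI (hc _ d2)
    (near_fu hphi (bump_off hb e0))) (xl _ (divr_gt0 d0 (ltr0n R 2)))).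
  have : cm (a K) <= d / 2.
    apply: le_trans (_ : Num.min (d / 2) (nr (l - zeta) / 2) <= _); last first.
      by rewrite ge_min lexx.
    apply: h2 => //; rewrite ge_min; apply/orP; right.
    have T := nr_tri l (x K) zeta; rewrite (nrB l (x K)) in T; move: h3 => /= h3; lra.
  move: h1 => /= h1; have := cmD (c - a K) (a K); rewrite subrK (cmB c) add0r; lra.
by rewrite c0.
Qed.

End Limit.

Section Perturbation.
Variables (r : R) (zeta : V) (Q : seq V) (lam : nat -> V -> C) (rho tau : nat -> R).
Hypothesis hb : bump_seq r zeta Q lam rho tau.
Variables (Phi h : V -> V).
Hypotheses (Phic : econt Phi) (hc : econt h) (hN : nochain Phi h r).

Section Jump.
Variable v : V.
Hypothesis avoid : forall th : R, 0 <= th <= 1 -> ~ reach Phi h r zeta (h zeta + th%:C%C *: v).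

Let hk k x := h x + lam k x *: v.

Lemma jump_limit (phi : nat -> nat) (X : nat -> nat -> V) :
  (forall K, (K <= phi K)%N) -> (forall K i, nr (X K i) <= rho (phi K)) ->
  exists x : nat -> V, [/\ forall i, nr (x i) <= r, forall i, ulim (X^~ i) (x i) &
    forall i, fu [set K | hk (phi K) (X K i) = Phi (X K i.+1)] ->
      exists th : R, [/\ 0 <= th <= 1, x i <> zeta -> th = 0 &
        h (x i) + th%:C%C *: v = Phi (x i.+1)]].
Proof.
move=> hphi Xr.
have /choice[x hx] : forall i, exists l, ulim (X^~ i) l /\ nr l <= r.
  by move=> i; have [l l1 l2] := bump_ulim_ex hb hphi (Xr^~ i); exists l.
exists x; split=> [i|i|i hi]; [exact: (hx i).2|exact: (hx i).1|].
have [th [th01 thz hth]] := bump_ulim hb hphi v hc (Xr^~ i) (hx i).1.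
exists th; split=> //.
have := ulim_eq hi hth; move/ulim_unique; apply.
apply: ulim_cont (hx i.+1).1; exact: Phic.
Qed.

Lemma exact_chain_contra (x : nat -> V) : (forall i, nr (x i) <= r) ->
  (forall i, x i <> zeta) ->
  (forall i, exists th : R, [/\ 0 <= th <= 1, x i <> zeta -> th = 0 &
        h (x i) + th%:C%C *: v = Phi (x i.+1)]) -> False.
Proof.
move=> xr xz hx; apply: hN; exists x; split=> // i.
by have [th [_ /(_ (xz i)) -> <-]] := hx i; rewrite scale0r addr0.
Qed.

(** Links of a limit chain before its first visit to [zeta] are exact, so cutting there gives a
    chain of the unperturbed pair. *)
Lemma first_visit (x : nat -> V) j : (forall i, nr (x i) <= r) -> x j = zeta ->
  (forall i, (forall k, (k <= i)%N -> x k <> zeta) ->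
     exists th : R, [/\ 0 <= th <= 1, x i <> zeta -> th = 0 &
        h (x i) + th%:C%C *: v = Phi (x i.+1)]) ->
  reach Phi h r zeta (Phi (x 0%N)).
Proof.
move=> xr xj hx.
have ex : exists i, x i == zeta by exists j; rewrite xj.
case: (ex_minnP ex) => n /eqP xn nmin; exists n, x; split=> // i ilt.
have nz k : (k <= i)%N -> x k <> zeta.
  by move=> ki /eqP /nmin; rewrite leqNgt (leq_ltn_trans ki ilt).
by have [th [_ /(_ (nz i (leqnn i))) -> <-]] := hx i nz; rewrite scale0r addr0.
Qed.

(** A limit of infinite chains meets [zeta], as otherwise it is an infinite chain of the unperturbed
    pair. After the visit it continues from a point of the segment: a return to [zeta] contradicts
    [avoid], and no return contradicts [hN]. *)
Lemma jump_nochain : \forall k \near \oo, nochain Phi (hk k) (rho k).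
Proof.
apply: near_by_contradiction => phi hphi /(_ _)/contrapT hX.
have /choice[X hX'] := hX.
have [x [xr _ hx]] := jump_limit hphi (fun K => (hX' K).1).
have {}hx i := hx i (fu_all (fun K => (hX' K).2 i)).
have [[i xi]|nz] := pselect (exists i, x i = zeta); last first.
  by refine (exact_chain_contra xr _ hx) => i xi; apply: nz; exists i.
have [th [th01 _ hth]] := hx i; rewrite xi in hth; apply: (avoid th01).
rewrite hth; have [[j xj]|nz] := pselect (exists j, x (i.+1 + j)%N = zeta); last first.
  exfalso; refine (@exact_chain_contra (fun j => x (i.+1 + j)%N) _ _ _) => // j.
  - by move=> xj; apply: nz; exists j.
  - by rewrite addnS; exact: hx.
rewrite -[i.+1]addn0; apply: (@first_visit (fun j => x (i.+1 + j)%N) j) => // k _.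
by rewrite addnS; exact: hx.
Qed.

(** Keeps the second segment admissible while [h] moves along the first. The lengths [n K] may be
    unbounded; freezing each chain at its end [zeta] by [minn] gives a limit at every index, and
    where the limit is not [zeta] most chains have not ended yet. *)
Lemma jump_noreach p w : (forall th : R, 0 <= th <= 1 -> ~ reach Phi h r zeta (p + th%:C%C *: w)) ->
  \forall k \near \oo, forall th : R, 0 <= th <= 1 ->
    ~ reach Phi (hk k) (rho k) zeta (p + th%:C%C *: w).
Proof.
move=> av; apply: near_by_contradiction => phi hphi hX.
have /choice[th /all_and2[th01 /choice[n /choice[X hX']]]] : forall K, exists th : R,
    0 <= th <= 1 /\ reach Phi (hk (phi K)) (rho (phi K)) zeta (p + th%:C%C *: w).
  move=> K; apply: contrapT => nK; apply: (hX K) => th th01 hr.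
  by apply: nK; exists th.
have Xr K i : nr (X K (minn i (n K))) <= rho (phi K) by have [] := hX' K.
have [x [xr xl hx]] := jump_limit hphi Xr.
have [t tl] : exists t, ulimR th t.
  apply: (@ulimR_ex _ _ 1); apply: filterS filterT => K _ /=.
  by have /andP[t0 t1] := th01 K; rewrite ger0_norm.
have t01 := ulimR_01 th01 tl.
apply: (av t t01); have -> : p + t%:C%C *: w = Phi (x 0%N).
  apply: (@ulim_unique _ _ (fun K => p + (th K)%:C%C *: w)).
    by apply: ulimD (ulim_cst p) _; apply: ulimZ; exact: ulimR_C.
  apply: ulim_eq (ulim_cont (Phic _) (xl 0%N)).
  by apply: filterS filterT => K _ /=; rewrite min0n; have [] := hX' K.
have late i : x i <> zeta -> fu [set K | (i < n K)%N].
  move=> xi; apply: contrapT => /fuN nK; apply: xi.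
  apply: (ulim_unique (xl i)); apply: ulim_eq (ulim_cst zeta).
  apply: filterS nK => K /= /negP; rewrite -leqNgt => /minn_idPr ->.
  by have [_ ->] := hX' K.
have step i : x i <> zeta -> exists th : R, [/\ 0 <= th <= 1, x i <> zeta -> th = 0 &
        h (x i) + th%:C%C *: v = Phi (x i.+1)].
  move=> /late hi; apply: hx; apply: filterS hi => K /= iK.
  rewrite (minn_idPl (ltnW iK)) (minn_idPl iK); have [_ _ _] := hX' K; exact.
have [[j xj]|nz] := pselect (exists j, x j = zeta).
  by apply: (first_visit xr xj) => i hi; apply: step; exact: hi.
have xz i : x i <> zeta by move=> xi; apply: nz; exists i.
by exfalso; refine (exact_chain_contra xr xz _) => i; exact: step.
Qed.

Lemma jump_bound M : (forall x, nr x <= r -> nr (h x) <= M) ->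
  (forall th : R, 0 <= th <= 1 -> nr (h zeta + th%:C%C *: v) <= M) ->
  forall e : R, 0 < e -> \forall k \near \oo, forall x, nr x <= rho k -> nr (hk k x) <= M + e.
Proof.
move=> hM hS e e0; apply: near_by_contradiction => phi hphi hX.
have /choice[X /all_and2[Xr hX']] : forall K, exists x, nr x <= rho (phi K) /\ M + e < nr (hk (phi K) x).
  move=> K; apply: contrapT => nK; apply: (hX K) => x xr; rewrite leNgt; apply/negP => hx.
  by apply: nK; exists x.
have [l Xl lr] := bump_ulim_ex hb hphi Xr.
have [th [th01 thz hth]] := bump_ulim hb hphi v hc Xr Xl.
have lM : nr (h l + th%:C%C *: v) <= M.
  have [->|lz] := eqVneq l zeta; first exact: hS.
  by rewrite thz ?scale0r ?addr0 ?hM //; apply/eqP.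
have [K /= hK] := filter_ex (hth _ e0).
have := nrD (hk (phi K) (X K) - (h l + th%:C%C *: v)) (h l + th%:C%C *: v).
rewrite subrK; have := hX' K; rewrite /hk in hK *; lra.
Qed.

End Jump.
End Perturbation.
End Chains.

(** * Monotone and locally expanding maps, local surjectivity *)

Section Geometry.
Variables (R : realType) (m : nat).
Local Notation C := R[i].
Local Notation V := 'rV[C]_m.
Implicit Types (r : R) (x y z u v : V) (Phi h f : V -> V).

Definition monot Phi r (mu : R) := forall x y, nr x <= r -> nr y <= r ->
  mu * nr (x - y) ^+ 2 <= complex.Re (dot (Phi x - Phi y) (x - y)).

(** Expansion at small scale, uniform on the ball: it makes the fibres of [h] countable and its
    differentials invertible, and it survives bumps in suitable directions. *)
Definition locinj h r := exists be d : R, [/\ 0 < be, 0 < d &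
  forall x y, nr x <= r -> nr y <= r -> nr (x - y) <= d ->
    be * nr (x - y) <= nr (h x - h y)].

(** The derivative at one base point, which is the form obtained for limits of the stages, inverses
    and composites. *)
Definition fder f z (A : 'M[C]_m) := forall w : R, 0 < w -> exists2 d : R, 0 < d &
  forall y, nr (y - z) < d -> nr (f y - f z - (y - z) *m A) <= w * nr (y - z).

Lemma sder_fder f z A : sder f z A -> fder f z A.
Proof.
move=> h w /h[d d0 hd]; exists d => // y yd; apply: hd => //.
by rewrite subrr nr0.
Qed.

Lemma monot_expand Phi r mu x y : monot Phi r mu -> nr x <= r -> nr y <= r ->
  mu * nr (x - y) <= nr (Phi x - Phi y).
Proof.
move=> hP xr yr; have [->|xy] := eqVneq x y; first by rewrite !subrr nr0 mulr0.
have n0 : 0 < nr (x - y) by rewrite nr_gt0 // subr_eq0.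
rewrite -(ler_pM2r n0) -mulrA -expr2.
exact: le_trans (hP x y xr yr) (Redot_le _ _).
Qed.

Lemma monot_inj Phi r mu x y : 0 < mu -> monot Phi r mu -> nr x <= r -> nr y <= r ->
  Phi x = Phi y -> x = y.
Proof.
move=> mu0 hP xr yr xy; have := monot_expand hP xr yr.
rewrite xy subrr nr0 pmulr_rle0 // => h; apply/eqP; rewrite -subr_eq0; apply/eqP.
by apply: nr_eq0; apply/eqP; rewrite eq_le h nr_ge0.
Qed.

Lemma unitmx_expand (A : 'M[C]_m) (be : R) : 0 < be ->
  (forall u, be * nr u <= nr (u *m A)) -> A \in unitmx.
Proof.
move=> be0 hA; rewrite -row_free_unit -kermx_eq0; apply/rowV0P => u /sub_kermxP uA.
apply: nr_eq0; apply/eqP; rewrite eq_le nr_ge0 andbT.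
by have := hA u; rewrite uA nr0 pmulr_rle0.
Qed.

(** Testing at [z + t u] for one small [t] passes the lower bound to the differential; by
    [unitmx_expand] it is then invertible. *)
Lemma fder_expand f z A (be d : R) : 0 < d -> fder f z A ->
  (forall y, nr (y - z) <= d -> be * nr (y - z) <= nr (f y - f z)) ->
  forall u, be * nr u <= nr (u *m A).
Proof.
move=> d0 hf hbe u; have [->|u0] := eqVneq u 0; first by rewrite mul0mx nr0 mulr0.
have nu := nr_gt0 u0; apply/ler_addgt0Pr => e e0.
have [d' d'0 hd] := hf (e / nr u) (divr_gt0 e0 nu).
pose t := Num.min d (d' / 2) / nr u.
have t0 : 0 < t by rewrite divr_gt0 // lt_min d0 divr_gt0.
have nt : nr (t%:C%C *: u) = Num.min d (d' / 2).
  by rewrite nrZ cm_real gtr0_norm // /t divfK // gt_eqF.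
have yz : z + t%:C%C *: u - z = t%:C%C *: u by rewrite addrC addKr.
have := hbe (z + t%:C%C *: u); have := hd (z + t%:C%C *: u).
rewrite yz nt -scalemxAl => h1 h2.
have {}h1 : nr (f (z + t%:C%C *: u) - f z - t%:C%C *: (u *m A)) <= e / nr u * (t * nr u).
  rewrite /t divfK ?gt_eqF //; apply: h1; rewrite gt_min; apply/orP; right; lra.
have {}h2 : be * (t * nr u) <= nr (f (z + t%:C%C *: u) - f z).
  by rewrite /t divfK ?gt_eqF //; apply: h2; rewrite ge_min lexx.
have h3 := nrD (f (z + t%:C%C *: u) - f z - t%:C%C *: (u *m A)) (t%:C%C *: (u *m A)).
rewrite subrK nrZ cm_real gtr0_norm // in h3.
rewrite (_ : e / nr u * (t * nr u) = t * e) in h1; last by field; rewrite gt_eqF.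
rewrite -(ler_pM2l t0); lra.
Qed.

Lemma locinj_unitmx h rho z A : locinj h rho -> nr z < rho -> sder h z A -> A \in unitmx.
Proof.
move=> [be [d [be0 d0 hbe]]] zr /sder_fder hA; apply: (unitmx_expand be0).
have e0 : 0 < Num.min d (rho - nr z) by rewrite lt_min d0 subr_gt0.
apply: (fder_expand e0 hA) => y; rewrite le_min => /andP[yd yr].
apply: hbe => //; last exact: ltW.
have := nrD (y - z) z; rewrite subrK; lra.
Qed.

Lemma ball_min (g : V -> R) c r : 0 <= r ->
  (forall z, nr (z - c) <= r -> forall e : R, 0 < e -> exists2 d : R, 0 < d &
     forall y, nr (y - c) <= r -> nr (y - z) < d -> `|g y - g z| < e) ->
  (forall z, nr (z - c) <= r -> 0 <= g z) ->
  exists2 z, nr (z - c) <= r & forall y, nr (y - c) <= r -> g z <= g y.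
Proof.
move=> r0 gc g0; pose S := [set g z | z in [set z | nr (z - c) <= r]].
have hS : has_inf S.
  split; first by exists (g c); exists c => //=; rewrite subrr nr0.
  by exists 0 => _ [z zr <-]; exact: g0.
have /choice[X /all_and2[Xr Xg]] : forall K : nat, exists z, nr (z - c) <= r /\
    g z < inf S + K.+1%:R^-1.
  move=> K; have K0 : 0 < K.+1%:R^-1 :> R by rewrite invr_gt0.
  by have [_ [z zr <-] hz] := inf_adherent K0 hS; exists z.
have [l Xl] : exists l, ulim X l.
  apply: (@ulim_ex _ _ _ (r + nr c)); apply: fu_all => K.
  by have := nrD (X K - c) c; rewrite subrK; have := Xr K; lra.
have lr : nr (l - c) <= r.
  apply: (@ulim_le _ _ (fun K => X K - c)).
    by apply: ulimD Xl (ulim_cst _).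
  by move=> e e0; apply: fu_all => K; have := Xr K; lra.
exists l => // y yr; apply: (@le_trans _ _ (inf S)); last first.
  by apply: ge_inf; [case: hS|exists y].
apply/ler_addgt0Pr => e e0; have e2 : 0 < e / 2 by rewrite divr_gt0.
have [d d0 hd] := gc l lr _ e2.
have ev : \forall K \near \oo, K.+1%:R^-1 < e / 2.
  have : \forall k \near \oo, (e / 2)^-1 < k%:R :> R by exact: nbhs_infty_gtr.
  apply: filterS => K hK; rewrite -[ltRHS]invrK ltf_pV2 ?posrE ?invr_gt0 //.
  by apply: lt_le_trans hK _; rewrite ler_nat.
have [K [/= h1 h2]] := filter_ex (filterI (Xl _ d0) (near_fu (fun K => leqnn K) ev)).
have := hd (X K) (Xr K) h1; rewrite ltr_norml => /andP[+ _].
by move: h2 (Xg K); move: (K.+1%:R^-1) => b; lra.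
Qed.

(* At a minimum of [|f x - y|] over the ball, moving along [(y - f x) A^-1]
   decreases the distance to [y] to first order, so [f x = y]. *)
Lemma local_surjection f c (r be : R) : 0 < r -> 0 < be ->
  (forall x, nr (x - c) <= r -> be * nr (x - c) <= nr (f x - f c)) ->
  (forall x, nr (x - c) <= r -> exists2 A, A \in unitmx & fder f x A) ->
  forall y, nr (y - f c) < be * r / 2 -> exists2 x, nr (x - c) < r & f x = y.
Proof.
move=> r0 be0 hbe hder y hy.
have fcont z : nr (z - c) <= r -> forall e : R, 0 < e -> exists2 d : R, 0 < d &
     forall q, nr (q - c) <= r -> nr (q - z) < d -> `|nr (f q - y) - nr (f z - y)| < e.
  move=> zr e e0; have [A _ /(_ 1 ltr01)[d d0 hd]] := hder z zr.
  have [K K0 hK] := nr_mulmx A; have K1 : 0 < 1 + K by lra.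
  exists (Num.min d (e / (1 + K))); first by rewrite lt_min d0 divr_gt0.
  move=> q _; rewrite lt_min => /andP[/hd h1]; rewrite ltr_pdivlMr // => h2.
  have h3 : nr (f q - f z) < e.
    rewrite -(subrK ((q - z) *m A) (f q - f z)).
    by apply: le_lt_trans (nrD _ _) _; have := hK (q - z); lra.
  have := nr_tri (f q) (f z) y; have := nr_tri (f z) (f q) y; rewrite (nrB (f z) (f q)).
  by rewrite ltr_norml => ? ?; apply/andP; split; lra.
have [x xr xmin] := ball_min (ltW r0) fcont (fun z _ => nr_ge0 (f z - y)).
have xc := xmin c; rewrite subrr nr0 in xc; have {}xc := xc (ltW r0).
rewrite (nrB (f c)) in xc.
(* The minimum is interior: comparing with [c], the value [f x] lies within
   [2 * nr (y - f c) < be * r] of [f c]. *)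
have xr' : nr (x - c) < r.
  have H1 := hbe x xr; have H2 := nr_tri (f x) y (f c).
  by rewrite -(ltr_pM2l be0); apply: le_lt_trans H1 _; lra.
exists x => //; apply/eqP; rewrite -subr_eq0; apply/negP => /negP w0.
set w := f x - y in w0 *; have nw := nr_gt0 w0.
have [A Au hA] := hder x xr; pose u := - (w *m invmx A).
have uA : u *m A = - w by rewrite mulNmx mulmxKV.
have u0 : 0 < nr u + 1 by have := nr_ge0 u; lra.
have [d d0 hd] := hA (nr w / (2 * (nr u + 1))) (divr_gt0 nw (mulr_gt0 (ltr0n R 2) u0)).
pose t := Num.min 1 (Num.min d (r - nr (x - c)) / (2 * (nr u + 1))).
have m0 : 0 < Num.min d (r - nr (x - c)) by rewrite lt_min d0 subr_gt0.
have t0 : 0 < t by rewrite lt_min ltr01 divr_gt0 // mulr_gt0.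
have t1 : t <= 1 by rewrite ge_min lexx.
have tm : t * (2 * (nr u + 1)) <= Num.min d (r - nr (x - c)).
  by rewrite -ler_pdivlMr ?mulr_gt0 // ge_min lexx orbT.
move: tm; rewrite le_min => /andP[td tr].
have nu := nr_ge0 u.
pose q := x + t%:C%C *: u.
have qx : q - x = t%:C%C *: u by rewrite /q addrC addKr.
have nqx : nr (q - x) = t * nr u by rewrite qx nrZ cm_real gtr0_norm.
have qr : nr (q - c) <= r by have := nr_tri q x c; rewrite nqx; nra.
have := hd q; rewrite nqx => /(_ ltac:(nra)) h1.
have := xmin q qr; rewrite -/w.
have -> : f q - y = (f q - f x - (q - x) *m A) + (1 - t)%:C%C *: w.
  rewrite qx -scalemxAl uA scalerN opprK rmorphB rmorph1 scalerBl scale1r.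
  by rewrite addrACA subrr addr0 /w addrA subrK.
have := nrD (f q - f x - (q - x) *m A) ((1 - t)%:C%C *: w).
rewrite nrZ cm_real ger0_norm ?subr_ge0 // => h2 h3.
have h4 : nr w / (2 * (nr u + 1)) * (t * nr u) <= nr w * t / 2.
  rewrite -!mulrA ler_wpM2l ?(ltW nw) // ler_pdivrMl ?mulr_gt0 //; nra.
have : 0 < nr w * t by rewrite mulr_gt0.
nra.
Qed.

End Geometry.

(** * The effect of one bump on [h] and on [Phi] *)

Section Steps.
Variables (R : realType) (m : nat).
Local Notation C := R[i].
Local Notation V := 'rV[C]_m.
Implicit Types (x y z u v : V) (Phi h f : V -> V).
Variables (r : R) (zeta : V) (Q : seq V) (lam : nat -> V -> C) (rho tau : nat -> R).
Hypothesis hb : bump_seq r zeta Q lam rho tau.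
Hypothesis zr : nr zeta = r.

Lemma bump_rho_le (r' : R) : r < r' -> \forall k \near \oo, rho k <= r'.
Proof.
move=> rr'; have e0 : 0 < r' - r by rewrite subr_gt0.
by apply: filterS (bump_radius_cvg hb e0) => k; rewrite addrC subrK.
Qed.

(** The zero [- al^-1] of [1 + t * al] lies in the open left half-plane, hence at positive distance
    from every admissible [t]; for large [t] the quotient is close to [al^-1]. *)
Lemma right_half_plane (al t : C) : 0 < complex.Re al -> 0 <= complex.Re t ->
  cm t <= (1 + cm al / complex.Re al) / cm al * cm (1 + t * al).
Proof.
move=> al0 t0; have a0 : al != 0 by apply/eqP => h; rewrite h ltxx in al0.
have c0 := cm_gt0 a0; pose s := t + al^-1.
have -> : 1 + t * al = al * s by rewrite /s mulrDr divff // addrC mulrC.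
rewrite cmM mulrA divfK ?gt_eqF //.
have Res : complex.Re al / cm al ^+ 2 <= cm s.
  apply: le_trans (Re_le_cm _); rewrite /s cReD.
  have -> : al^-1 = (cm al ^+ 2)^-1%:C%C * al^*%C.
    by apply: (mulfI a0); rewrite divff // mulrCA mulcJ -rmorphM mulVf // gt_eqF ?exprn_gt0.
  by rewrite cReM /= mul0r subr0 cReC mulrC; lra.
have h1 : cm t <= cm s + (cm al)^-1.
  by have := cmD s (- al^-1); rewrite /s addrK cmN cmV.
rewrite mulrDl mul1r; apply: le_trans h1 _; rewrite lerD2l.
rewrite ler_pdivrMr ?exprn_gt0 // in Res.
rewrite -(ler_pM2r al0) -(ler_pM2r c0).
rewrite mulrAC mulVf ?gt_eqF // mul1r.
have -> : cm al / complex.Re al * cm s * complex.Re al * cm al = cm s * cm al ^+ 2.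
  by field; rewrite gt_eqF.
by [].
Qed.

Lemma absorb_half (a b c d : R) : a <= b + c -> c <= a / 2 -> b <= d -> a <= 2 * d.
Proof. by move=> h1 h2 h3; lra. Qed.

(** Away from [zeta] the bump has a small Lipschitz constant. Near [zeta] the difference of values
    is close to [(u + (t * dot u zeta) *: a) *m A] with Re t >= 0. Removing [A] and multiplying by
    [zeta] leaves [dot u zeta * (1 + t * al)], and [right_half_plane] bounds [t * dot u zeta], hence
    [u], uniformly in [t]. *)
Lemma jump_locinj h v rho0 A : r < rho0 -> locinj h rho0 -> sder h zeta A ->
  0 < complex.Re (dot (v *m invmx A) zeta) ->
  \forall k \near \oo, locinj (fun x => h x + lam k x *: v) (rho k).
Proof.
move=> rr0 hl hA; have Au := locinj_unitmx hl (eq_ind_r (fun s => s < rho0) rr0 zr) hA.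
set a := v *m _; set al := dot a zeta => al0.
have [be [d0 [be0 d00 hbe]]] := hl.
have [K K0 hK] := nr_mulmx (invmx A).
have v0 := nr_ge0 v; have v1 : 0 < nr v + 1 by lra.
have r0 : 0 <= r by rewrite -zr nr_ge0.
pose C1 := (1 + cm al / complex.Re al) / cm al.
have C10 : 0 <= C1.
  by rewrite divr_ge0 ?cm_ge0 // addr_ge0 // divr_ge0 ?cm_ge0 // ltW.
pose C2 := 1 + nr a * C1 * r.
have C20 : 0 < C2 by rewrite ltr_wpDr // mulr_ge0 // mulr_ge0 ?nr_ge0.
pose w := (4 * C2 * K)^-1.
have w0 : 0 < w by rewrite invr_gt0 mulr_gt0 // mulr_gt0.
pose de := w / (nr v + 1).
have de0 : 0 < de by rewrite divr_gt0.
have dev : de * nr v <= w.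
  by rewrite /de mulrAC ler_pdivrMr // ler_wpM2l ?(ltW w0) //; lra.
have [d d1 hd] := hA w w0.
pose ga := Num.min (d / 2) (be / (2 * (nr v + 1))).
have ga0 : 0 < ga by rewrite lt_min !divr_gt0 // mulr_gt0.
have gav : ga * nr v <= be / 2.
  apply: (@le_trans _ _ (be / (2 * (nr v + 1)) * (nr v + 1))).
    by apply: ler_pM; rewrite ?(ltW ga0) //; [rewrite ge_min lexx orbT|lra].
  by rewrite le_eqVlt; apply/orP; left; apply/eqP; field; rewrite gt_eqF.
apply: filterS3 (bump_rho_le rr0) (bump_off_lip hb ga0) (bump_monotone hb de0) => k rk hoff hmono.
exists (Num.min (2 * w) (be / 2)), (Num.min d0 (d / 2)).
split; rewrite ?lt_min ?d00 ?divr_gt0 ?mulr_gt0 // => x y xr yr.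
rewrite le_min => /andP[xy0 xyd]; set u := x - y in xy0 xyd *.
have u0 := nr_ge0 u.
have -> : h x + lam k x *: v - (h y + lam k y *: v) = h x - h y + (lam k x - lam k y) *: v.
  by rewrite opprD addrACA -scalerBl.
have far : d / 2 <= nr (x - zeta) -> d / 2 <= nr (y - zeta) ->
    be / 2 * nr u <= nr (h x - h y + (lam k x - lam k y) *: v).
  move=> xz yz; have gad : ga <= d / 2 by rewrite ge_min lexx.
  have H1 := hoff x y xr yr (le_trans gad xz) (le_trans gad yz).
  have H2 := hbe x y (le_trans xr rk) (le_trans yr rk) xy0.
  have := nrD (h x - h y + (lam k x - lam k y) *: v) (- ((lam k x - lam k y) *: v)).
  rewrite addrK nrN nrZ -/u in H1 H2 *.
  have := ler_wpM2r v0 H1; rewrite mulrAC; have := ler_wpM2r u0 gav; lra.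
have minl (q : R) : be / 2 * nr u <= q -> Num.min (2 * w) (be / 2) * nr u <= q.
  by apply: le_trans; rewrite ler_wpM2r // ge_min lexx orbT.
have [xz|xz] := ltP (nr (x - zeta)) d; last first.
  apply/minl/far; first by lra.
  by have := nr_tri x y zeta; rewrite -/u; lra.
have [yz|yz] := ltP (nr (y - zeta)) d; last first.
  apply/minl/far; last by lra.
  by have := nr_tri y x zeta; rewrite (nrB y x) -/u; lra.
have [t t0 ht] := hmono x y xr yr; rewrite -/u in ht.
set u1 := dot u zeta in ht.
have := hd x y xz yz; rewrite -/u; set e1 := h x - h y - _ => he1.
set e2 := lam k x - lam k y - _ in ht.
set D := h x - h y + _.
have DE : D = u *m A + (t * u1) *: v + (e1 + e2 *: v).
  have E1 : h x - h y = u *m A + e1 by rewrite /e1 [RHS]addrC subrK.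
  have E2 : lam k x - lam k y = t * u1 + e2 by rewrite /e2 [RHS]addrC subrK.
  by rewrite /D E1 E2 scalerDl addrACA.
pose e' := (e1 + e2 *: v) *m invmx A.
pose y' := D *m invmx A.
have y'E : y' = u + (t * u1) *: a + e'.
  by rewrite /y' DE mulmxDl mulmxDl mulmxK // -scalemxAl.
have he' : nr e' <= nr u / (2 * C2).
  apply: le_trans (hK _) _; have := nrD e1 (e2 *: v); rewrite nrZ.
  have : cm e2 * nr v <= w * nr u.
    apply: le_trans (ler_wpM2r v0 ht) _; rewrite mulrAC.
    exact: ler_wpM2r.
  move=> h1 h2.
  have h3 : nr (e1 + e2 *: v) <= 2 * w * nr u by lra.
  apply: le_trans (ler_wpM2l (ltW K0) h3) _.
  by rewrite le_eqVlt; apply/orP; left; apply/eqP; rewrite /w; field; rewrite !gt_eqF.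
have hu1 : u1 * (1 + t * al) = dot (y' - e') zeta.
  by rewrite y'E addrK dotDl dotZl -/u1 -/al; ring.
have hye : nr (y' - e') <= nr y' + nr e' by rewrite -(nrN e'); exact: nrD.
have htu : cm (t * u1) <= C1 * r * (nr y' + nr e').
  have q : cm t <= C1 * cm (1 + t * al) := right_half_plane al0 t0.
  have q' : cm (u1 * (1 + t * al)) <= r * (nr y' + nr e').
    rewrite hu1; apply: le_trans (cm_dot _ _) _; rewrite zr mulrC; exact: ler_wpM2l.
  rewrite cmM in q'; rewrite cmM.
  apply: le_trans (ler_wpM2r (cm_ge0 u1) q) _.
  rewrite -[leLHS]mulrA [X in C1 * X <= _]mulrC -[leRHS]mulrA; exact: ler_wpM2l.
have hu : nr u <= C2 * (nr y' + nr e').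
  have -> : u = y' - e' + - ((t * u1) *: a).
    by rewrite y'E addrK addrK.
  apply: le_trans (nrD _ _) _; rewrite nrN nrZ /C2 mulrDl mul1r; apply: lerD => //.
  apply: le_trans (ler_wpM2r (nr_ge0 a) htu) _.
  have E (p1 p2 p3 p4 : R) : p1 * p2 * p3 * p4 = p2 * p3 * p4 * p1 by ring.
  by rewrite E.
have hy' : nr y' <= K * nr D := hK D.
apply: (@le_trans _ _ (2 * w * nr u)); first by rewrite ler_wpM2r // ge_min lexx.
have h5 : C2 * nr e' <= nr u / 2.
  rewrite -(ler_pdivlMl _ _ C20); apply: le_trans he' _.
  by rewrite le_eqVlt; apply/orP; left; apply/eqP; field; rewrite gt_eqF.
have h6 : C2 * nr y' <= C2 * (K * nr D) by rewrite ler_pM2l.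
have -> : 2 * w * nr u = nr u / (2 * C2 * K) by rewrite /w; field; rewrite !gt_eqF.
have E (p1 p2 p3 : R) : p1 * (2 * p2 * p3) = 2 * (p2 * (p3 * p1)) by ring.
rewrite ler_pdivrMr ?mulr_gt0 // E; rewrite mulrDr in hu.
exact: absorb_half hu h5 h6.
Qed.

Section Stretch.
Variables (Phi h : V -> V) (s : R).
Hypotheses (Phic : econt Phi) (hc : econt h) (hN : nochain Phi h r) (s0 : 0 < s).

Let Phik k x := Phi x + lam k x *: (s%:C%C *: zeta).

(** The displacement and the gradient of the bump are both along [zeta], so the stretch contributes
    s Re(t) |<x - y, zeta>|^2 >= 0; only the error in [bump_monotone] costs [ka]. *)
Lemma stretch_monot rho0 (mu ka : R) : r < rho0 -> 0 < ka -> monot Phi rho0 mu ->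
  \forall k \near \oo, monot (Phik k) (rho k) (mu - ka).
Proof.
move=> rr0 ka0 hP; have r0 : 0 <= r by rewrite -zr nr_ge0.
have K0 : 0 < s * r + 1 by rewrite ltr_wpDl // mulr_ge0 // ltW.
have de0 : 0 < ka / (s * r + 1) by rewrite divr_gt0.
apply: filterS2 (bump_rho_le rr0) (bump_monotone hb de0) => k rk hmono x y xr yr.
have [t t0 ht] := hmono x y xr yr.
have H := hP x y (le_trans xr rk) (le_trans yr rk).
rewrite /Phik opprD addrACA -scalerBl; set u := x - y in ht H *.
set u1 := dot u zeta in ht; set e := _ - _ - _ in ht.
have -> : lam k x - lam k y = t * u1 + e by rewrite /e [RHS]addrC subrK.
rewrite dotDl !dotZl (dotC u zeta) -/u1 cReD.
have -> : complex.Re ((t * u1 + e) * (s%:C%C * u1^*%C)) =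
   s * (complex.Re t * cm u1 ^+ 2) + s * complex.Re (e * u1^*%C).
  have -> : (t * u1 + e) * (s%:C%C * u1^*%C) = s%:C%C * (t * (u1 * u1^*%C) + e * u1^*%C) by ring.
  by rewrite mulcJ cReM /= mul0r subr0 cReD cReM /= mulr0 subr0; ring.
have h1 : 0 <= s * (complex.Re t * cm u1 ^+ 2).
  by rewrite !mulr_ge0 ?exprn_ge0 ?cm_ge0 // ltW.
have h2 : - (ka * nr u ^+ 2) <= s * complex.Re (e * u1^*%C).
  have h3 := Re_ge_cm (e * u1^*%C); rewrite cmM cm_conj in h3.
  have h4 : cm e * cm u1 <= ka / (s * r + 1) * nr u * (nr u * r).
    by apply: ler_pM; rewrite ?cm_ge0 //; rewrite -zr; exact: cm_dot.
  have h5 : s * (ka / (s * r + 1) * nr u * (nr u * r)) <= ka * nr u ^+ 2.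
    have -> : s * (ka / (s * r + 1) * nr u * (nr u * r)) = (ka * nr u ^+ 2) * (s * r / (s * r + 1)).
      by ring.
    rewrite ler_piMr ?mulr_ge0 ?exprn_ge0 ?nr_ge0 ?(ltW ka0) //.
    by rewrite ler_pdivrMr // mul1r; lra.
  have := ler_wpM2l (ltW s0) h4; have := ler_wpM2l (ltW s0) h3; lra.
rewrite mulrBl; lra.
Qed.

Variables (b : nat -> V) (n : nat).
Hypotheses (hb0 : h zeta = Phi (b 0%N))
  (hbr : forall j, (j <= n)%N -> nr (b j) < r)
  (hbS : forall j, (j < n)%N -> h (b j) = Phi (b j.+1))
  (hexit : forall x, nr x <= r -> h (b n) <> Phi x)
  (hexit_seg : forall th : R, 0 <= th <= 1 -> h (b n) <> Phi zeta + th%:C%C *: (s%:C%C *: zeta))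
  (hinj : forall x y, nr x <= r -> nr y <= r -> Phi x = Phi y -> x = y)
  (hseg : forall (th : R) x, 0 <= th <= 1 -> nr x < r -> Phi x <> Phi zeta + th%:C%C *: (s%:C%C *: zeta)).

(** A limit chain that meets [zeta] is forced: [h zeta = Phi (b 0)] and injectivity drive it along
    [b], and [h (b n)] lies neither in the image of the closed ball nor on the attached segment. A
    limit chain off [zeta] is an old infinite chain. *)
Lemma stretch_nochain : \forall k \near \oo, nochain (Phik k) h (rho k).
Proof.
apply: near_by_contradiction => phi hphi /(_ _)/contrapT hX.
have /choice[X hX'] := hX.
have Xr K i : nr (X K i) <= rho (phi K) by have [] := hX' K.
have /choice[x hx] : forall i, exists l, ulim (X^~ i) l /\ nr l <= r.
  by move=> i; have [l l1 l2] := bump_ulim_ex hb hphi (Xr^~ i); exists l.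
have xl i : ulim (X^~ i) (x i) := (hx i).1; have xr i : nr (x i) <= r := (hx i).2.
clear hx.
have hx i : exists th : R, [/\ 0 <= th <= 1, x i.+1 <> zeta -> th = 0 &
    h (x i) = Phi (x i.+1) + th%:C%C *: (s%:C%C *: zeta)].
  have [th [th01 thz hth]] := bump_ulim hb hphi (s%:C%C *: zeta) Phic (Xr^~ i.+1) (xl i.+1).
  exists th; split=> //; apply: ulim_unique hth.
  apply: ulim_eq (ulim_cont (hc _) (xl i)).
  by apply: fu_all => K /=; have [_] := hX' K; apply.
have [[i xi]|nz] := pselect (exists i, x i = zeta); last first.
  apply: hN; exists x; split=> // i; have [th [_ thz ->]] := hx i.
  by rewrite thz ?scale0r ?addr0 // => xi; apply: nz; exists i.+1.
have next j y : nr y < r -> h (x j) = Phi y -> x j.+1 = y.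
  move=> yr hy; have [th [th01 thz hth]] := hx j.
  have [xz|xz] := eqVneq (x j.+1) zeta.
    by case: (hseg th01 yr); rewrite -hy hth xz.
  move: hth; rewrite thz ?scale0r ?addr0 => [hth|]; last exact/eqP.
  by apply: hinj => //; [exact: ltW|rewrite -hth].
have along j : (j <= n)%N -> x (i.+1 + j)%N = b j.
  elim: j => [_|j IH jn].
    by rewrite addn0; apply: next; [exact: hbr|rewrite xi].
  rewrite addnS; apply: next; first exact: hbr.
  by rewrite IH 1?ltnW // hbS.
have [th [th01 thz]] := hx (i.+1 + n)%N; rewrite along // => hth.
have [xz|xz] := eqVneq (x (i.+1 + n).+1) zeta.
  by apply: (hexit_seg th01); rewrite hth xz.
move: hth; rewrite thz ?scale0r ?addr0 => [hth|]; last exact/eqP.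
exact: (hexit (xr _) hth).
Qed.

Lemma stretch_exit : \forall k \near \oo, forall x, nr x <= rho k -> h (b n) <> Phik k x.
Proof.
apply: near_by_contradiction => phi hphi hX.
have /choice[X /all_and2[Xr hX']] : forall K, exists x, nr x <= rho (phi K) /\ h (b n) = Phik (phi K) x.
  move=> K; apply: contrapT => nK; apply: (hX K) => x xr hx.
  by apply: nK; exists x.
have [l Xl lr] := bump_ulim_ex hb hphi Xr.
have [th [th01 thz hth]] := bump_ulim hb hphi (s%:C%C *: zeta) Phic Xr Xl.
have E : h (b n) = Phi l + th%:C%C *: (s%:C%C *: zeta).
  apply: ulim_unique hth; apply: ulim_eq (ulim_cst _).
  by apply: fu_all => K; exact: hX'.
have [lz|lz] := eqVneq l zeta; first by apply: (hexit_seg th01); rewrite E lz.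
by apply: (hexit lr); rewrite E thz ?scale0r ?addr0 //; apply/eqP.
Qed.

End Stretch.
End Steps.

(** * Projection onto the ball and a variational inequality *)

Section Variational.
Variables (R : realType) (m : nat).
Local Notation C := R[i].
Local Notation V := 'rV[C]_m.
Implicit Types (r : R) (x y z u v w : V) (Phi h f : V -> V).

Definition bproj r x : V := if nr x <= r then x else (r / nr x)%:C%C *: x.

Lemma bproj_le r x : 0 <= r -> nr (bproj r x) <= r.
Proof.
move=> r0; rewrite /bproj; case: ifPn => //; rewrite -ltNge => h.
have n0 : 0 < nr x by apply: le_lt_trans h.
by rewrite nrZ cm_real ger0_norm ?divr_ge0 ?(ltW n0) // divfK ?gt_eqF.
Qed.

Lemma bproj_obtuse r x q : 0 <= r -> nr q <= r ->
  complex.Re (dot (x - bproj r x) (q - bproj r x)) <= 0.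
Proof.
move=> r0 qr; rewrite /bproj; case: ifPn => [_|].
  by rewrite subrr dot0l.
rewrite -ltNge => h; have n0 : 0 < nr x by apply: le_lt_trans h.
set t := r / nr x; have t1 : t < 1 by rewrite /t ltr_pdivrMr // mul1r.
have -> : x - t%:C%C *: x = (1 - t)%:C%C *: x.
  by rewrite rmorphB rmorph1 scalerBl scale1r.
rewrite dotZl cReM /= mul0r subr0 dotBr dotZr conjc_real cReD cReN cReM /= mul0r subr0.
rewrite Redotxx mulr_ge0_le0 ?subr_ge0 ?(ltW t1) // subr_le0.
rewrite /t expr2 mulrA divfK ?gt_eqF // dotC cReC.
by apply: le_trans (Redot_le _ _) _; rewrite ler_wpM2r // ltW.
Qed.

Lemma bproj_lip r x y : 0 <= r -> nr (bproj r x - bproj r y) <= nr (x - y).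
Proof.
move=> r0; set p := bproj r x; set q := bproj r y.
have h1 := bproj_obtuse x r0 (bproj_le y r0); rewrite -/p -/q in h1.
have h2 := bproj_obtuse y r0 (bproj_le x r0); rewrite -/p -/q in h2.
have [->|pq] := eqVneq p q; first by rewrite subrr nr0 nr_ge0.
have n0 : 0 < nr (p - q) by rewrite nr_gt0 // subr_eq0.
rewrite -(ler_pM2r n0) -expr2; apply: le_trans (Redot_le _ _).
rewrite -Redotxx; move: h1 h2.
rewrite -[q - p]opprB dotNr cReN !dotBl !cReD !cReN; lra.
Qed.

(* A fixed point of the contraction [z |-> bproj r (z - t (Phi z - w))] solves
   the variational inequality, whose solution lies on the sphere because [w] is
   not a value of [Phi]; it is found as a minimum of [|T z - z|]. *)
Lemma boundary_ray r Phi mu (K : R) w : 0 < r -> 0 < mu -> 0 <= K -> monot Phi r mu ->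
  (forall x y, nr x <= r -> nr y <= r -> nr (Phi x - Phi y) <= K * nr (x - y)) ->
  (forall x, nr x <= r -> Phi x <> w) ->
  exists (zeta : V) (s : R), [/\ nr zeta = r, 0 < s & w = Phi zeta + s%:C%C *: zeta].
Proof.
move=> r0 mu0 K0 hP hK hw.
(* Since [t * K ^+ 2 <= mu], the map [z |-> z - t (Phi z - w)] multiplies squared distances by at
   most 1 - t mu. *)
pose t := mu / (K ^+ 2 + 1).
have K1 : 0 < K ^+ 2 + 1 by rewrite ltr_wpDl ?exprn_ge0.
have t0 : 0 < t by rewrite divr_gt0.
have tK : t * K ^+ 2 <= mu.
  by rewrite /t mulrAC ler_pdivrMr // ler_pM2l //; lra.
pose T z := bproj r (z - t%:C%C *: (Phi z - w)).
have TE z : T z = bproj r (z - t%:C%C *: (Phi z - w)) by [].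
clearbody T.
have contr x y : nr x <= r -> nr y <= r -> x != y -> nr (T x - T y) < nr (x - y).
  move=> xr yr xy; rewrite !TE; apply: le_lt_trans (bproj_lip _ _ (ltW r0)) _.
  have n0 : 0 < nr (x - y) by rewrite nr_gt0 // subr_eq0.
  rewrite -(@ltr_pXn2r _ 2) ?nnegrE ?nr_ge0 //.
  have -> : x - t%:C%C *: (Phi x - w) - (y - t%:C%C *: (Phi y - w)) = 
      (x - y) - t%:C%C *: (Phi x - Phi y).
    rewrite opprD addrACA -opprD -scalerBr [in LHS]opprB addrA subrK; reflexivity.
  rewrite nrD_sqr nrN nrZ cm_real gtr0_norm // dotNr dotZr conjc_real cReN cReM /= mul0r subr0.
  rewrite dotC cReC.
  have h1 := hP x y xr yr; have h2 := hK x y xr yr.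
  have h3 : nr (Phi x - Phi y) ^+ 2 <= K ^+ 2 * nr (x - y) ^+ 2.
    by rewrite -exprMn ler_pXn2r ?nnegrE ?nr_ge0 // mulr_ge0 ?nr_ge0.
  set n2 := nr (x - y) ^+ 2 in h1 h3 *.
  have n20 : 0 < n2 by rewrite exprn_gt0.
  have h4 := ler_wpM2l (ltW t0) h1.
  have h5 : t ^+ 2 * nr (Phi x - Phi y) ^+ 2 <= t * (mu * n2).
    apply: le_trans (ler_wpM2l (exprn_ge0 2 (ltW t0)) h3) _.
    by rewrite expr2 -mulrA ler_pM2l // mulrA ler_pM2r.
  have h6 : 0 < t * (mu * n2) by rewrite mulr_gt0 // mulr_gt0.
  rewrite exprMn; move: h4 h5 h6; set q1 := t * (mu * n2); set q2 := t ^+ 2 * _.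
  set q3 := complex.Re _; move=> h4 h5 h6; lra.
have gc z : nr (z - 0) <= r -> forall e : R, 0 < e -> exists2 d : R, 0 < d &
     forall y, nr (y - 0) <= r -> nr (y - z) < d -> `|nr (T y - y) - nr (T z - z)| < e.
  rewrite subr0 => zr e e0; exists (e / 2); first by rewrite divr_gt0.
  move=> y; rewrite subr0 => yr yz.
  have h : nr (T y - T z) <= nr (y - z).
    by have [->|/(contr _ _ yr zr)/ltW//] := eqVneq y z; rewrite !subrr.
  have := nrD (T y - y - (T z - z)) (T z - z); rewrite subrK.
  have := nrD (T z - z - (T y - y)) (T y - y); rewrite subrK (nrB (T z - z)).
  have : nr (T y - y - (T z - z)) <= 2 * nr (y - z).
    have -> : T y - y - (T z - z) = (T y - T z) - (y - z).
      by rewrite opprD addrACA -opprD.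
    apply: le_trans (nrD _ _) _; rewrite nrN; lra.
  by move=> h1 h2 h3; rewrite ltr_norml; apply/andP; split; lra.
have [z] := ball_min (ltW r0) gc (fun z _ => nr_ge0 (T z - z)).
rewrite subr0 => zr zmin.
have Tz : T z = z.
  apply/eqP; apply: contraT => Tz.
  have Tr : nr (T z) <= r by rewrite TE; exact: bproj_le _ (ltW r0).
  have := zmin (T z); rewrite (subr0 (T z)) => /(_ Tr).
  by rewrite leNgt (contr _ _ Tr zr Tz).
move: Tz; rewrite TE /bproj; case: ifPn => [_ /eqP|].
  rewrite -subr_eq0 addrAC subrr add0r oppr_eq0 scaler_eq0 subr_eq0 => /orP[|/eqP /hw //].
  by rewrite -(rmorph0 (real_complex R)) (inj_eq (@complexI _)) gt_eqF.
set p := z - _; rewrite -ltNge => h hz.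
have p0 : 0 < nr p by apply: lt_trans h.
have zr' : nr z = r.
  by rewrite -hz nrZ cm_real ger0_norm ?divr_ge0 ?(ltW p0) ?(ltW r0) // divfK ?gt_eqF.
exists z, ((nr p / r - 1) / t); split=> //.
  by rewrite divr_gt0 // subr_gt0 ltr_pdivlMr // mul1r.
have pz : p = (nr p / r)%:C%C *: z.
  rewrite -{1}hz scalerA -rmorphM (_ : nr p / r * (r / nr p) = 1) ?scale1r //.
  by field; rewrite !gt_eqF.
have tC : t%:C%C != 0 :> C.
  by rewrite -(rmorph0 (real_complex R)) (inj_eq (@complexI _)) gt_eqF.
apply: (scalerI tC); rewrite scalerDr scalerA -rmorphM mulrC divfK ?gt_eqF //.
rewrite rmorphB rmorph1 scalerBl scale1r -pz /p.
by rewrite [z - _ - z]addrAC subrr add0r -scalerN opprB scalerBr addrC subrK.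
Qed.

End Variational.

(** * Countability of the backward chains, and chains that exit *)

Section ExitChain.
Variables (R : realType) (m : nat).
Local Notation C := R[i].
Local Notation V := 'rV[C]_m.
Implicit Types (r : R) (x y z u v w : V) (Phi h f : V -> V).

(** The fibre is even finite: infinitely many points would accumulate in the closed ball, against
    expansion at small scale. *)
Lemma fiber_countable h r p : locinj h r -> countable [set x | nr x <= r /\ h x = p].
Proof.
move=> [be [d [be0 d0 hbe]]]; apply: finite_set_countable; apply: contrapT => /infiniteP.
move=> /pcard_leP[f].
have fr K : nr (f K) <= r by have [] := @funS _ _ _ _ f K I.
have [l fl] : exists l, ulim f l by apply: (@ulim_ex _ _ _ r); exact: fu_all.
have d2 : 0 < d / 2 by rewrite divr_gt0.
have [K /= hK] := filter_ex (fl _ d2).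
have [K' [/= hK' KK']] := filter_ex (filterI (fl _ d2) (fu_ge K.+1)).
have fp i : h (f i) = p by have [] := @funS _ _ _ _ f i I.
have : be * nr (f K - f K') <= nr (h (f K) - h (f K')).
  apply: hbe => //; have := nr_tri (f K) l (f K'); rewrite (nrB l); lra.
rewrite !fp subrr nr0 pmulr_rle0 // => h0.
have E : f K = f K'.
  by apply/eqP; rewrite -subr_eq0; apply/eqP/nr_eq0/eqP; rewrite eq_le h0 nr_ge0.
have EK : K = K' by apply: (@inj _ _ _ f); rewrite ?inE.
by move: KK'; rewrite EK ltnn.
Qed.

(** [L n] collects the starting points of chains of [n] links ending at [zeta]; [L n.+1] lies in the
    fibres of [h] over the values [Phi y] with [y] in [L n]. *)
Lemma reach_countable Phi h r zeta : locinj h r -> countable [set p | reach Phi h r zeta p].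
Proof.
move=> hl.
pose L n := [set y | exists x : nat -> V, [/\ forall i, nr (x i) <= r, x n = zeta,
  x 0%N = y & forall i, (i < n)%N -> h (x i) = Phi (x i.+1)]].
have Lc n : countable (L n).
  elim: n => [|n IH].
    apply: sub_countable (countable1 zeta); apply: subset_card_le.
    by move=> y [x [_ <- <-]].
  have := @bigcup_countable _ _ (L n) (fun y => [set x | nr x <= r /\ h x = Phi y]) IH
    (fun y _ => fiber_countable (Phi y) hl).
  apply: sub_countable; apply: subset_card_le => y [x [xr xn x0 hx]].
  exists (x 1%N); last by rewrite /= -x0; split=> //; exact: hx.
  by exists (x \o S); split=> // i => [|ni]; [exact: xr|exact: hx].
have := @bigcup_countable _ _ [set: nat] (fun n => Phi @` L n) (countableP _)
  (fun n _ => card_le_trans (card_image_le _ _) (Lc n)).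
apply: sub_countable; apply: subset_card_le => p [n [x [xr xn x0 hx]]].
by exists n => //; exists (x 0%N) => //; exists x.
Qed.

(** A chain from [h zeta] back to [zeta] repeats with period [n.+1]. *)
Lemma nochain_aperiodic Phi h r zeta : nochain Phi h r -> ~ reach Phi h r zeta (h zeta).
Proof.
move=> hN [n [x [xr xn x0 hx]]]; apply: hN.
exists (fun i => x (i %% n.+1)%N); split=> // i.
have := ltn_pmod i (ltn0Sn n); rewrite ltnS leq_eqVlt => /predU1P[E|lt].
  have -> : (i.+1 %% n.+1 = 0)%N.
    by rewrite -addn1 -modnDml E addn1 modnn.
  by rewrite E xn x0.
have -> : (i.+1 %% n.+1 = (i %% n.+1).+1)%N by rewrite -[i.+1]addn1 -modnDml addn1 modn_small.
exact: hx.
Qed.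

(** Injectivity of [Phi] forces a chain from [Phi (b 0)] to follow [b], which stays in the open
    ball, hence off [zeta], and then exits. *)
Lemma exit_noreach Phi h r zeta (b : nat -> V) n : nr zeta = r ->
  (forall x y, nr x <= r -> nr y <= r -> Phi x = Phi y -> x = y) ->
  (forall j, (j <= n)%N -> nr (b j) < r) ->
  (forall j, (j < n)%N -> h (b j) = Phi (b j.+1)) ->
  (forall x, nr x <= r -> h (b n) <> Phi x) ->
  ~ reach Phi h r zeta (Phi (b 0%N)).
Proof.
move=> zr inj br hbS hexit [k [x [xr xk x0 hx]]].
have xb j : (j <= n)%N -> (j <= k)%N -> x j = b j.
  elim: j => [_ _|j IH jn jk].
    by apply: inj => //; exact/ltW/br.
  apply: inj => //; first exact/ltW/br.
  by rewrite -hx // IH ?hbS // ltnW.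
have [kn|nk] := leqP k n.
  by have := br k kn; rewrite -xb // xk zr ltxx.
by apply: (hexit (x n.+1)) => //; rewrite -hx // xb // ltnW.
Qed.

Lemma locally_onto f r rho0 c : polymap f -> locinj f rho0 -> r <= rho0 -> nr c < r ->
  forall e : R, 0 < e -> exists2 t : R, 0 < t & forall p, nr (p - f c) < t ->
    exists x, [/\ nr (x - c) < e, nr x < r & f x = p].
Proof.
move=> pf hl rr cr e e0; have [be [d [be0 d0 hbe]]] := hl.
pose q := Num.min (Num.min e d) (r - nr c) / 2.
have q0 : 0 < q by rewrite divr_gt0 // !lt_min e0 d0 subr_gt0.
have q2 : 2 * q <= Num.min (Num.min e d) (r - nr c) by rewrite /q mulrC divfK // pnatr_eq0.
move: q2; rewrite !le_min => /andP[/andP[qe qd] qr].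
have ball x : nr (x - c) <= q -> nr x < r.
  by move=> xc; have := nrD (x - c) c; rewrite subrK; lra.
have surj := @local_surjection R m f c q be q0 be0.
exists (be * q / 2) => [|p hp]; first by rewrite divr_gt0 // mulr_gt0.
have [||x xq fx] := surj _ _ p hp.
- move=> x xq; apply: hbe; last by lra.
  + by apply: le_trans rr; exact/ltW/ball.
  + by apply: le_trans rr; exact: ltW.
- move=> x xq; have [A hA] := polymap_sder pf x; exists A; last exact: sder_fder.
  by apply: (locinj_unitmx hl _ hA); apply: lt_le_trans rr; exact: ball.
exists x; split=> //; last exact/ball/ltW.
lra.
Qed.

Lemma monot_locinj Phi rho mu : 0 < mu -> monot Phi rho mu -> locinj Phi rho.
Proof.
by move=> mu0 hP; exists mu, 1; split=> // x y xr yr _; exact: monot_expand hP xr yr.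
Qed.

Lemma image_ball_closed f r e : econt f -> (forall x, nr x <= r -> f x <> e) ->
  exists2 t : R, 0 < t & forall e', nr (e' - e) < t -> forall x, nr x <= r -> f x <> e'.
Proof.
move=> fc he; apply: contrapT => H.
have /choice[X /all_and2[Xr Xe]] : forall K : nat, exists x, nr x <= r /\ nr (f x - e) < K.+1%:R^-1.
  move=> K; apply: contrapT => nK; apply: H; exists (K.+1%:R^-1); first by rewrite invr_gt0.
  by move=> e' he' x xr fx; apply: nK; exists x; rewrite fx.
have [l Xl] : exists l, ulim X l by apply: (@ulim_ex _ _ _ r); exact: fu_all.
have lr : nr l <= r.
  by apply: (ulim_le Xl) => t t0; apply: fu_all => K; have := Xr K; lra.
apply: (he l lr); apply: ulim_unique (ulim_cont (fc _) Xl) _ => t t0.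
have ev : \forall K \near \oo, K.+1%:R^-1 < t.
  have : \forall k \near \oo, t^-1 < k%:R :> R by exact: nbhs_infty_gtr.
  apply: filterS => K hK; rewrite -[ltRHS]invrK ltf_pV2 ?posrE ?invr_gt0 //.
  by apply: lt_le_trans hK _; rewrite ler_nat.
apply: filterS (near_fu (fun K => leqnn K) ev) => K /=; exact: lt_trans (Xe K).
Qed.

(** A small imaginary multiple of [d] leaves the real line through [p] with direction [d]. *)
Lemma avoid_segment (p d e : V) : d != 0 -> forall t : R, 0 < t -> exists2 e',
  nr (e' - e) < t & forall th : R, e' <> p + th%:C%C *: d.
Proof.
move=> d0 t t0; have [[th Eth]|hn] := pselect (exists th : R, e = p + th%:C%C *: d); last first.
  by exists e; [rewrite subrr nr0|move=> th h; apply: hn; exists th].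
have n0 := nr_gt0 d0; pose c : R := t / (2 * nr d).
have c0 : 0 < c by rewrite divr_gt0 // mulr_gt0.
exists (e + (0 +i* c)%C *: d).
  rewrite addrC addKr nrZ; have := cm_ReIm (0 +i* c)%C; rewrite /= normr0 add0r gtr0_norm // => h.
  apply: le_lt_trans (ler_wpM2r (nr_ge0 d) h) _.
  rewrite /c (_ : t / (2 * nr d) * nr d = t / 2); last by field; rewrite gt_eqF.
  by rewrite ltr_pdivrMr //; lra.
move=> th'; rewrite Eth -addrA => /addrI; rewrite -scalerDl => /eqP.
rewrite -subr_eq0 -scalerBl scaler_eq0 (negPf d0) orbF => /eqP/(congr1 (@complex.Im R)).
by rewrite cImD cImD cImN /= add0r subr0 => h; rewrite h ltxx in c0.
Qed.

(** The value [e] may still be [Phi z] with [z] on the sphere. Then [e + c z] leaves the image: Re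
    <z, x - z> <= 0 on the closed ball, so monotonicity would force [x = z]. The image is closed,
    which leaves room for a second shift off the line. *)
Lemma exit_point Phi r rho mu (p d : V) e : econt Phi -> 0 < r -> r <= rho -> 0 < mu -> monot Phi rho mu ->
  d != 0 -> (forall x, nr x < r -> Phi x <> e) -> forall t : R, 0 < t -> exists e',
  [/\ nr (e' - e) < t, forall x, nr x <= r -> Phi x <> e' & forall th : R, e' <> p + th%:C%C *: d].
Proof.
move=> Pc r0 rr mu0 hP d0 he t t0; have t2 : 0 < t / 2 by rewrite divr_gt0.
have [e1 [he1 hx1]] : exists e1, nr (e1 - e) < t / 2 /\ forall x, nr x <= r -> Phi x <> e1.
  have [[z [zr Pz]]|hn] := pselect (exists z, nr z <= r /\ Phi z = e); last first.
    exists e; split; first by rewrite subrr nr0.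
    by move=> x xr hx; apply: hn; exists x.
  have zr' : nr z = r.
    by apply/eqP; rewrite eq_le zr leNgt; apply/negP => /he.
  pose c : R := t / (4 * r); have c0 : 0 < c by rewrite divr_gt0 // mulr_gt0.
  exists (e + c%:C%C *: z); split.
    rewrite addrC addKr nrZ cm_real gtr0_norm // zr' /c.
    rewrite (_ : t / (4 * r) * r = t / 4); last by field; rewrite gt_eqF.
    lra.
  move=> x xr Px; have := hP x z (le_trans xr rr) (le_trans zr rr).
  have E : e + c%:C%C *: z - e = c%:C%C *: z by rewrite addrC addKr.
  rewrite Px Pz E dotZl cReM /= mul0r subr0 dotBr cReD cReN Redotxx zr'.
  have h1 : complex.Re (dot z x) <= r ^+ 2.
    by apply: le_trans (Redot_le _ _) _; rewrite zr' expr2 ler_pM2l.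
  move=> h2; have h3 : mu * nr (x - z) ^+ 2 <= 0.
    by apply: le_trans h2 _; rewrite mulr_ge0_le0 ?(ltW c0) // subr_le0.
  move: h3; rewrite pmulr_rle0 // => h3.
  have xz : x = z.
    apply/eqP; rewrite -subr_eq0; apply/eqP/nr_eq0/eqP.
    by rewrite -sqrf_eq0 eq_le h3 exprn_ge0 ?nr_ge0.
  move: Px; rewrite xz Pz -[X in X = _]addr0 => /addrI /esym/eqP.
  rewrite scaler_eq0 -(rmorph0 (real_complex R)) (inj_eq (@complexI _)) gt_eqF //= => /eqP z0.
  by move: zr'; rewrite z0 nr0 => h; rewrite -h ltxx in r0.
have [t' t'0 ht'] := image_ball_closed Pc hx1.
have m0 : 0 < Num.min t' (t / 2) by rewrite lt_min t'0.
have [e' + hS] := avoid_segment p e1 d0 m0; rewrite lt_min => /andP[h1 h2].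
exists e'; split=> //; last exact: ht'.
by have := nr_tri e' e1 e; lra.
Qed.

(** [h] is locally onto, so a small change of the last value is carried back link by link to a small
    change of the starting point. *)
Lemma pull_back Phi h r rho0 n : polymap h -> econt Phi -> locinj h rho0 -> r <= rho0 ->
  forall c : nat -> V, (forall j, (j <= n)%N -> nr (c j) < r) ->
  (forall j, (j < n)%N -> h (c j) = Phi (c j.+1)) ->
  forall e : R, 0 < e -> exists2 t : R, 0 < t & forall p, nr (p - h (c n)) < t ->
  exists b : nat -> V, [/\ nr (b 0%N - c 0%N) < e, forall j, (j <= n)%N -> nr (b j) < r,
    forall j, (j < n)%N -> h (b j) = Phi (b j.+1) & h (b n) = p].
Proof.
move=> ph Pc hl rr; elim: n => [|n IH] c cr hc e e0.
  have [t t0 ht] := locally_onto ph hl rr (cr 0%N (leqnn 0)) e0.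
  exists t => // p /ht[x [x1 x2 x3]]; exists (fun=> x); split=> //.
have [t t0 ht] := locally_onto ph hl rr (cr 0%N (leq0n _)) e0.
have [d d0 hd] := Pc (c 1%N) t t0.
have [t' t'0 ht'] := IH (c \o S) (fun j => cr j.+1) (fun j => hc j.+1) d d0.
exists t' => // p /ht'[b [b1 b2 b3 b4]].
have [|x [x1 x2 x3]] := ht (Phi (b 0%N)).
  by rewrite hc //; exact: hd.
exists (fun j => if j is i.+1 then b i else x); split=> // [[|j] jn|[|j] jn].
- exact: x2.
- exact: b2.
- exact: x3.
- exact: b3.
Qed.

(** Successors in the open ball are chosen as long as there are any; this stops, since otherwise the
    chain would be infinite. *)
Lemma escape Phi h r a : nochain Phi h r -> nr a < r ->
  exists (n : nat) (c : nat -> V), [/\ c 0%N = a, forall j, (j <= n)%N -> nr (c j) < r,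
    forall j, (j < n)%N -> h (c j) = Phi (c j.+1) & forall x, nr x < r -> Phi x <> h (c n)].
Proof.
move=> hN ar.
have /choice[g hg] : forall y, exists x, (exists z, nr z < r /\ h y = Phi z) -> nr x < r /\ h y = Phi x.
  move=> y; have [[z hz]|hn] := pselect (exists z, nr z < r /\ h y = Phi z); first by exists z.
  by exists y.
pose c j := iter j g a.
pose stop j := `[< ~ exists z, nr z < r /\ h (c j) = Phi z >].
have [[j0 hj0]|hn] := pselect (exists j, stop j); last first.
  have go j : exists z, nr z < r /\ h (c j) = Phi z.
    by apply: contrapT => hj; apply: hn; exists j; apply/asboolP.
  exfalso; apply: hN; exists c; split=> [[|i]|i]; first exact: ltW.
    by have [/ltW] := hg (c i) (go i).
  by have [_] := hg (c i) (go i).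
case: (ex_minnP (ex_intro stop j0 hj0)) => n /asboolP hstop hmin.
have go j : (j < n)%N -> exists z, nr z < r /\ h (c j) = Phi z.
  move=> jn; apply: contrapT => hj; have := hmin j; rewrite leqNgt jn => H.
  by have := H (asboolT hj).
exists n, c; split=> //.
- case=> [//|j jn]; by have [] := hg (c j) (go j jn).
- by move=> j jn; have [] := hg (c j) (go j jn).
- by move=> x xr hx; apply: hstop; exists x.
Qed.

Lemma exit_chain Phi h r rho0 mu (p d a : V) : polymap h -> econt Phi -> locinj h rho0 ->
  0 < r -> r <= rho0 -> 0 < mu -> monot Phi rho0 mu -> nochain Phi h r -> nr a < r -> d != 0 ->
  forall e : R, 0 < e -> exists (n : nat) (b : nat -> V),
  [/\ nr (b 0%N - a) < e, forall j, (j <= n)%N -> nr (b j) < r,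
    forall j, (j < n)%N -> h (b j) = Phi (b j.+1),
    forall x, nr x <= r -> h (b n) <> Phi x &
    forall th : R, h (b n) <> p + th%:C%C *: d].
Proof.
move=> ph Pc hl r0 rr mu0 hP hN ar d0 e e0.
have [n [c [ca cr hc hstop]]] := escape hN ar.
have [t t0 ht] := pull_back ph Pc hl rr cr hc e0.
have [e' [h1 h2 h3]] := exit_point p Pc r0 rr mu0 hP d0 hstop t0.
have [b [b1 b2 b3 b4]] := ht e' h1.
exists n, b; rewrite -ca; split=> //.
- by move=> x xr; rewrite b4 => E; apply: (h2 x xr).
- by move=> th; rewrite b4.
Qed.

End ExitChain.

(** * A path of two segments off a countable set *)

Section Path.
Variables (R : realType) (m : nat).
Local Notation C := R[i].
Local Notation V := 'rV[C]_m.
Implicit Types (r : R) (x y z u v w : V) (Phi h f : V -> V).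

Lemma unit_interval_uncountable : ~ countable [set t : R | 0 <= t <= 1].
Proof.
move=> /countable_lebesgue_measure0.
have -> : [set t : R | 0 <= t <= 1] = `[0, 1]%classic by rewrite set_itvcc.
rewrite lebesgue_measure_itv /= lte_fin ltr01 oppr0 adde0 => /eqP.
by rewrite eqe oner_eq0.
Qed.

(** Each point of [Z] excludes at most one parameter per index, so countably many parameters in all;
    the index distinguishes the two segments of the path. *)
Lemma choice_in_interval (Z : set V) (A : bool -> R -> V -> Prop) : countable Z ->
  (forall i t t' z, 0 <= t <= 1 -> 0 <= t' <= 1 -> A i t z -> A i t' z -> Z z -> t = t') ->
  exists2 t : R, 0 <= t <= 1 & forall i z, A i t z -> ~ Z z.
Proof.
move=> /countable_injP[f finj] hA; apply: contrapT => hn; apply: unit_interval_uncountable.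
pose B i := [set t : R | 0 <= t <= 1 /\ exists z, A i t z /\ Z z].
have Bc i : countable (B i).
  have /choice[g hg] : forall t, exists z, B i t -> A i t z /\ Z z.
    move=> t; have [[_ [z hz]]|nB] := pselect (B i t); first by exists z.
    by exists 0.
  apply/countable_injP; exists (f \o g) => t t' /[!inE] Bt Bt' /= fE.
  have [a1 z1] := hg t Bt; have [a2 z2] := hg t' Bt'.
  have E : g t = g t' by apply: finj; rewrite ?inE.
  by rewrite -E in a2; exact: (hA i _ _ (g t) Bt.1 Bt'.1).
have := @bigcup_countable _ _ [set: bool] B (countableP _) (fun i _ => Bc i).
apply: sub_countable; apply: subset_card_le => t t01; apply: contrapT => nB.
by apply: hn; exists t => // i z hz Zz; apply: nB; exists i => //; split=> //; exists z.
Qed.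

(** Reads the second segment from [p1], the end shared by all the paths. *)
Lemma segment_reverse (p0 p1 v : V) (q : R) :
  p0 + v + q%:C%C *: (p1 - p0 - v) = p1 - (1 - q)%:C%C *: (p1 - p0 - v).
Proof.
set w := p1 - p0 - v.
have -> : p0 + v = p1 - w by rewrite /w -addrA -opprD subKr.
rewrite rmorphB rmorph1 scalerBl scale1r; clearbody w.
by rewrite opprB addrA addrAC.
Qed.

(** The corner [p0 + v] runs through a one-parameter family. Seen through the form [al], the first
    segments of two paths meet only at [p0] and the second ones only at [p1], both off [Z], so some
    parameter is free. The positivity conditions are those of [jump_locinj] for the first leg and,
    through [second_direction], for the second. *)
Lemma path_choice (Z : set V) (p0 p1 e zeta : V) (B : 'M[C]_m) (ka : R) :
  countable Z -> ~ Z p0 -> ~ Z p1 -> dot (e *m B) zeta = 1 ->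
  complex.Im (dot ((p1 - p0) *m B) zeta) != 0 -> 0 < ka ->
  exists v, [/\ nr v <= ka, 0 < complex.Re (dot (v *m B) zeta),
    0 < complex.Re (dot ((p1 - p0 - v) *m B) zeta * (dot (v *m B) zeta)^*%C),
    forall th : R, 0 <= th <= 1 -> ~ Z (p0 + th%:C%C *: v) &
    forall th : R, 0 <= th <= 1 -> ~ Z (p0 + v + th%:C%C *: (p1 - p0 - v))].
Proof.
move=> Zc Z0 Z1 al1; set a := dot _ zeta => y0 ka0.
have [al alE] : exists al : V -> C, forall u, al u = dot (u *m B) zeta by eexists.
have alZ (c : C) u : al (c *: u) = c * al u by rewrite !alE -scalemxAl dotZl.
have alB u v : al (u - v) = al u - al v by rewrite !alE mulmxBl dotBl.
have aE : a = al (p1 - p0) by rewrite alE.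
pose x := complex.Re a; pose y := complex.Im a.
have y2 : 0 < y ^+ 2 by rewrite exprn_even_gt0.
(* Makes x + y (k y + th) >= 1 for all [th] in the unit interval; the real part in the third
   condition is [ep] times this number minus |al v|^2. *)
pose k := (`|x| + `|y| + 1) / y ^+ 2.
have k0 : 0 <= k by rewrite divr_ge0 ?(ltW y2) // addr_ge0 // addr_ge0.
have ky : k * y ^+ 2 = `|x| + `|y| + 1 by rewrite /k divfK // gt_eqF.
pose G := 1 + (k * `|y| + 1) ^+ 2.
have G1 : 1 <= G by rewrite /G lerDl exprn_ge0 // addr_ge0 // mulr_ge0.
have GE : G = 1 + (k * `|y| + 1) ^+ 2 by [].
have n0 : 0 < nr e + 1 by have := nr_ge0 e; lra.
pose d := Num.min (1 / (2 * G)) (ka / (G * (nr e + 1))).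
have d0 : 0 < d by rewrite lt_min !divr_gt0 // mulr_gt0 //; lra.
(* [x - ep] is the real part of [a - al v]; being nonzero and independent of [th], it determines the
   position on the second segment. *)
have [ep [ep0 epd epx]] : exists ep : R, [/\ 0 < ep, ep <= d & x - ep != 0].
  have [dx|dx] := eqVneq (x - d) 0; last by exists d.
  exists (d / 2); split; rewrite ?divr_gt0 //; first by lra.
  by apply/eqP; lra.
have epG : ep * G <= 1 / 2.
  have : ep <= 1 / (2 * G) by apply: le_trans epd _; rewrite ge_min lexx.
  rewrite ler_pdivlMr; [lra|by rewrite mulr_gt0 //; lra].
have epk : ep * (G * (nr e + 1)) <= ka.
  rewrite -ler_pdivlMr; last by rewrite mulr_gt0 //; lra.
  by apply: le_trans epd _; rewrite ge_min lexx orbT.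
pose g th : C := (1 +i* (k * y + th))%C.
pose v th : V := (ep%:C%C * g th) *: e.
have alv th : al (v th) = ep%:C%C * g th by rewrite alZ alE al1 mulr1.
have Re_alv th : complex.Re (al (v th)) = ep.
  by rewrite alv /g cReM /= mul0r subr0 mulr1.
have Im_alv th : complex.Im (al (v th)) = ep * (k * y + th).
  by rewrite alv /g cImM /= mul0r addr0.
have nrv th : nr (v th) = ep * cm (g th) * nr e.
  by rewrite nrZ cmM cm_real gtr0_norm.
have gE th : cm (g th) ^+ 2 = 1 + (k * y + th) ^+ 2 by rewrite cm_sqr /= expr1n.
clearbody v g d G k.
have v_inj t t' : al (v t) = al (v t') -> t = t'.
  move/(congr1 (@complex.Im R)); rewrite !Im_alv => /(mulfI _) E.
  by apply: (addrI (k * y)); apply: E; rewrite gt_eqF.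
pose A (i : bool) (th : R) z := exists2 s : R, 0 <= s <= 1 &
  z = if i then p0 + s%:C%C *: v th else p0 + v th + s%:C%C *: (p1 - p0 - v th).
have hA i t t' z : 0 <= t <= 1 -> 0 <= t' <= 1 -> A i t z -> A i t' z -> Z z -> t = t'.
  move=> _ _ [s _ zs] [s' _ zs'] Zz; case: i zs zs' => zs zs'.
    have E : s%:C%C * al (v t) = s'%:C%C * al (v t').
      by rewrite -!alZ; congr al; apply: (addrI p0); rewrite -zs -zs'.
    have ss : s = s'.
      move/(congr1 (@complex.Re R)): (E); rewrite !cReM /= !mul0r !subr0 !Re_alv.
      by apply: mulIf; rewrite gt_eqF.
    have s0 : s != 0.
      by apply/eqP => s0; apply: Z0; move: Zz; rewrite zs s0 scale0r addr0.
    apply: v_inj; move: E; rewrite -ss; apply: mulfI.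
    by rewrite -(rmorph0 (real_complex R)) (inj_eq (@complexI _)).
  have zE (q : R) th := segment_reverse p0 p1 (v th) q.
  have E : (1 - s)%:C%C * (a - al (v t)) = (1 - s')%:C%C * (a - al (v t')).
    rewrite aE -!alB -!alZ; congr al; apply: oppr_inj; apply: (addrI p1).
    exact: etrans (esym (zE s t)) (etrans (esym zs) (etrans zs' (zE s' t'))).
  have ss : 1 - s = 1 - s'.
    move/(congr1 (@complex.Re R)): (E); rewrite !cReM /= !mul0r !subr0 !cReD !cReN !Re_alv.
    exact: mulIf.
  have s0 : 1 - s != 0.
    by apply/eqP => s0; apply: Z1; move: Zz; rewrite zs zE s0 scale0r subr0.
  apply: v_inj; apply: oppr_inj; apply: (addrI a); move: E; rewrite -ss; apply: mulfI.
  by rewrite -(rmorph0 (real_complex R)) (inj_eq (@complexI _)).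
have [t t01 ht] := choice_in_interval Zc hA.
have gG : cm (g t) ^+ 2 <= G.
  rewrite gE GE lerD2l.
  have h1 : `|k * y + t| <= k * `|y| + 1.
    apply: le_trans (ler_normD _ _) _; rewrite normrM (ger0_norm k0).
    by case/andP: t01 => t0 t1; rewrite (ger0_norm t0); lra.
  by rewrite -real_normK ?num_real // ler_pXn2r // nnegrE addr_ge0 // mulr_ge0.
have gG' : cm (g t) <= G.
  have := cm_ge0 (g t); have [] := leP (cm (g t)) 1; nra.
exists (v t); split.
- rewrite nrv; apply: le_trans epk.
  rewrite -mulrA ler_pM2l //; apply: ler_pM; rewrite ?cm_ge0 ?nr_ge0 //; lra.
- by rewrite -alE Re_alv.
- rewrite -!alE alB -aE.
  have -> : complex.Re ((a - al (v t)) * (al (v t))^*%C) =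
     ep * (x + y * (k * y + t)) - cm (al (v t)) ^+ 2.
    rewrite cm_sqr cReM cReC cImC cReD cReN cImD cImN Re_alv Im_alv -/x -/y.
    by clearbody x y; clear - x y ep k t; ring.
  rewrite alv cmM cm_real gtr0_norm // exprMn expr2 -mulrA -mulrBr pmulr_rgt0 //.
  have h1 : ep * cm (g t) ^+ 2 <= 1 / 2.
    by apply: le_trans epG; rewrite ler_pM2l.
  have h2 : 1 <= x + y * (k * y + t).
    have -> : x + y * (k * y + t) = x + k * y ^+ 2 + y * t by by rewrite expr2; clearbody x y; clear - x y k t; ring.
    rewrite ky; case/andP: t01 => t0 t1.
    have : - `|x| <= x by rewrite lerNl -normrN ler_norm.
    have : - `|y| <= y * t.
      rewrite lerNl -mulNr; apply: le_trans (ler_wpM2r t0 (ler_norm (- y))) _.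
      by rewrite normrN ler_piMr.
    lra.
  lra.
- by move=> th th01; apply: (ht true); exists th.
- by move=> th th01; apply: (ht false); exists th.
Qed.

End Path.

(** * One stage of the construction *)

Section Stage.
Variables (R : realType) (m : nat).
Local Notation C := R[i].
Local Notation V := 'rV[C]_m.
Implicit Types (r : R) (x y z u v w : V) (Phi h f : V -> V).

(** The maps are polynomial on the whole space, but all estimates concern the closed ball of radius
    [rho], which shrinks from stage to stage; the chain lies in the open ball and leaves room for
    this. The chain being nonempty, the default values of [nth] and [last] do not interfere. *)
Record stage Phi h (rho mu M : R) (qs : seq V) : Prop := Stage {
  stage_Phi : polymap Phi;
  stage_h : polymap h;
  stage_rho : 0 < rho;
  stage_monot : monot Phi rho mu;
  stage_locinj : locinj h rho;
  stage_nochain : nochain Phi h rho;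
  stage_Phi_le : forall x, nr x <= rho -> nr (Phi x) <= M;
  stage_h_le : forall x, nr x <= rho -> nr (h x) <= M;
  stage_size : (0 < size qs)%N;
  stage_in : forall q, q \in qs -> nr q < rho;
  stage_chain : forall i, (i.+1 < size qs)%N -> h (nth 0 qs i) = Phi (nth 0 qs i.+1);
  stage_exit : forall x, nr x <= rho -> Phi x <> h (last 0 qs) }.

Lemma monotW Phi r r' mu : r' <= r -> monot Phi r mu -> monot Phi r' mu.
Proof. by move=> rr h x y xr yr; apply: h; exact: le_trans rr. Qed.

Lemma locinjW h r r' : r' <= r -> locinj h r -> locinj h r'.
Proof.
move=> rr [be [d [be0 d0 hb]]]; exists be, d; split=> // x y xr yr.
by apply: hb; exact: le_trans rr.
Qed.

Lemma nochainW Phi h r r' : r' <= r -> nochain Phi h r -> nochain Phi h r'.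
Proof.
by move=> rr hN [x [xr hx]]; apply: hN; exists x; split=> // i; exact: le_trans rr.
Qed.

Lemma segment_le (p v : V) (M th : R) : nr p <= M -> nr (p + v) <= M -> 0 <= th <= 1 ->
  nr (p + th%:C%C *: v) <= M.
Proof.
move=> h1 h2 /andP[t0 t1].
have -> : p + th%:C%C *: v = (1 - th)%:C%C *: p + th%:C%C *: (p + v).
  by rewrite scalerDr addrA -scalerDl -rmorphD subrK scale1r.
apply: le_trans (nrD _ _) _; rewrite !nrZ !cm_real !ger0_norm ?subr_ge0 //.
have t1' : 0 <= 1 - th by lra.
have := ler_wpM2l t0 h2; have := ler_wpM2l t1' h1; lra.
Qed.

(* Monotonicity makes the ray from [Phi zeta] in the direction [zeta] leave the
   image of the open ball. *)
Lemma monot_ray Phi r mu s zeta (th : R) x : 0 < mu -> 0 < s -> monot Phi r mu -> nr zeta = r ->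
  0 <= th <= 1 -> nr x < r -> Phi x <> Phi zeta + th%:C%C *: (s%:C%C *: zeta).
Proof.
move=> mu0 s0 hP zr /andP[th0 _] xr Px; have := hP x zeta (ltW xr); rewrite zr lexx => /(_ isT).
rewrite Px [_ + _ - _]addrAC subrr add0r !dotZl !cReM /= !mul0r !subr0 dotBr cReD cReN Redotxx zr.
have r0 : 0 <= r by rewrite -zr nr_ge0.
have h3 : complex.Re (dot zeta x) <= r ^+ 2.
  by apply: le_trans (Redot_le _ _) _; rewrite zr expr2 ler_wpM2l // ltW.
have h4 : th * (s * (complex.Re (dot zeta x) - r ^+ 2)) <= 0.
  by rewrite mulr_ge0_le0 // mulr_ge0_le0 ?(ltW s0) // subr_le0.
have xz : 0 < nr (x - zeta).
  by rewrite nr_gt0 // subr_eq0; apply/eqP => xz; rewrite xz zr ltxx in xr.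
have : 0 < mu * nr (x - zeta) ^+ 2 by rewrite mulr_gt0 // exprn_gt0.
move=> h5 h6; have := lt_le_trans h5 h6.
by rewrite ltNge => /negP; apply; exact: h4.
Qed.

(** The ball of radius [r - ka] stays at distance [ka] from [zeta], where late bumps and their
    Lipschitz constants are small; this gives the convergence of the stages. *)
Lemma bump_small r zeta (Q : seq V) lam rho tau v (ka : R) : nr zeta = r ->
  bump_seq r zeta Q lam rho tau -> 0 < ka -> \forall k \near \oo,
  forall x y, nr x <= r - ka -> nr y <= r - ka ->
    nr (lam k x *: v) <= ka /\ nr (lam k x *: v - lam k y *: v) <= ka * nr (x - y).
Proof.
move=> zr hb ka0; have v0 := nr_ge0 v; have v1 : 0 < nr v + 1 by lra.
pose d := Num.min ka (ka / (nr v + 1)).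
have d0 : 0 < d by rewrite lt_min ka0 divr_gt0.
have dka : d <= ka by rewrite ge_min lexx.
have dv : d * nr v <= ka.
  have : d * (nr v + 1) <= ka by rewrite -ler_pdivlMr // ge_min lexx orbT.
  lra.
apply: filterS2 (bump_off hb d0) (bump_off_lip hb d0) => k h1 h2 x y xr yr.
have rk : r < rho k by have /andP[] := bump_radius hb k.
have far z : nr z <= r - ka -> nr z <= rho k /\ d <= nr (z - zeta).
  move=> zk; split; first lra.
  by have := nrD (zeta - z) z; rewrite subrK zr (nrB zeta); lra.
have [x1 x2] := far x xr; have [y1 y2] := far y yr.
rewrite -scalerBl !nrZ; split.
  by apply: le_trans dv; rewrite ler_wpM2r // h1.
apply: le_trans (ler_wpM2r v0 (h2 x y x1 y1 x2 y2)) _.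
by rewrite mulrAC ler_wpM2r // nr_ge0.
Qed.

(** [E] carries what a leg owes to the next one: for the first leg a large slope and the avoidance
    of the second segment, for the second leg nothing. *)
Lemma jump_step r zeta (Q : seq V) lam rho tau Phi h v A rho0 M ka (E : nat -> Prop) :
  nr zeta = r -> bump_seq r zeta Q lam rho tau -> econt Phi -> polymap h ->
  r < rho0 -> locinj h rho0 -> nochain Phi h r -> sder h zeta A ->
  (forall th : R, 0 <= th <= 1 -> ~ reach Phi h r zeta (h zeta + th%:C%C *: v)) ->
  0 < complex.Re (dot (v *m invmx A) zeta) ->
  (forall x, nr x <= r -> nr (h x) <= M) -> nr (h zeta + v) <= M -> 0 < ka ->
  (\forall k \near \oo, E k) ->
  let hk k x := h x + lam k x *: v in
  exists k, [/\ E k, rho k < rho0, nochain Phi (hk k) (rho k), locinj (hk k) (rho k) &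
    (forall x, nr x <= rho k -> nr (hk k x) <= M + ka) /\
    (forall x y, nr x <= r - ka -> nr y <= r - ka ->
      nr (lam k x *: v) <= ka /\ nr (lam k x *: v - lam k y *: v) <= ka * nr (x - y))].
Proof.
move=> zr hb Pc ph rr hl hN hA avoid al0 hM hv ka0 hE hk.
have hc := polymap_cont ph.
have [r' [rr' r'0]] : exists r', r < r' /\ r' < rho0.
  by exists ((r + rho0) / 2); split; lra.
have seg (th : R) : 0 <= th <= 1 -> nr (h zeta + th%:C%C *: v) <= M.
  by apply: segment_le hv; apply: hM; rewrite zr.
have N1 := jump_nochain hb Pc hc hN avoid.
have N2 := jump_locinj hb zr rr hl hA al0.
have N3 := jump_bound hb hc hM seg ka0.
have N4 := bump_small v zr hb ka0.
have N5 := bump_rho_le hb rr'.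
have [k [[[[[h1 h2] h3] h4] h5] h6]] := filter_ex (filterI (filterI (filterI (filterI (filterI hE N1) N2) N3) N4) N5).
by exists k; split=> //; exact: le_lt_trans h6 r'0.
Qed.

(** As in the inversion of a rank one update, the product [x1] in the conclusion satisfies x1 (1 + t
    a1) = a2; hence Re x1 has the sign of Re a2 + t Re (a2 conj a1), which a large [t] makes
    positive if Re (a2 conj a1) > 0. *)
Lemma second_direction (A : 'M[C]_m) zeta (t : R) v1 v2 :
  A \in unitmx -> A + adj (t%:C%C *: zeta) *m v1 \in unitmx ->
  0 < complex.Re (dot (v2 *m invmx A) zeta) +
      t * complex.Re (dot (v2 *m invmx A) zeta * (dot (v1 *m invmx A) zeta)^*%C) ->
  0 < complex.Re (dot (v2 *m invmx (A + adj (t%:C%C *: zeta) *m v1)) zeta).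
Proof.
move=> Au; set A1 := A + _ => A1u; set a1 := dot (v1 *m _) _; set a2 := dot (v2 *m _) _ => H.
set x := v2 *m invmx A1; set x1 := dot x zeta.
have E : x1 * (1 + t%:C%C * a1) = a2.
  have : x *m A1 = v2 by rewrite /x mulmxKV.
  rewrite mulmxDr mulmx_adj dotZr conjc_real => /(congr1 (fun q => dot (q *m invmx A) zeta)).
  by rewrite mulmxDl mulmxK // -scalemxAl dotDl dotZl -/x1 -/a1 -/a2 => <-; ring.
have K : x1 * (cm (1 + t%:C%C * a1) ^+ 2)%:C%C = a2 * (1 + t%:C%C * a1)^*%C.
  by rewrite -mulcJ mulrA E.
have := congr1 (@complex.Re R) K; rewrite cReM /= mulr0 subr0 => K'.
have c0 : 0 <= cm (1 + t%:C%C * a1) ^+ 2 by rewrite exprn_ge0 // cm_ge0.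
have P : 0 < complex.Re x1 * cm (1 + t%:C%C * a1) ^+ 2.
  rewrite K' (_ : complex.Re _ = complex.Re a2 + t * complex.Re (a2 * a1^*%C)) //.
  rewrite !cReM !cReC !cImC cReD cImD cReM cImM /=; ring.
by rewrite ltNge; apply/negP => x0; move: P; rewrite ltNge mulr_le0_ge0.
Qed.

(** Supplies the nonzero imaginary part that [path_choice] asks for, on a whole neighbourhood
    because [exit_chain] moves the starting point once more. If it vanishes at [a], then [Phi a] is
    shifted by an imaginary multiple of [e]. *)
Lemma good_start r rho0 mu Phi (B : 'M[C]_m) zeta e p0 a (ka : R) : polymap Phi -> 0 < mu ->
  monot Phi rho0 mu -> r <= rho0 -> nr a < r -> dot (e *m B) zeta = 1 -> 0 < ka ->
  exists a' (t : R), [/\ nr a' < r, 0 < t, nr (a' - a) + t <= ka &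
    forall b, nr (b - a') < t -> complex.Im (dot ((Phi b - p0) *m B) zeta) != 0].
Proof.
move=> pP mu0 hP rr ar e1 ka0; have Pc := polymap_cont pP.
pose al u := dot (u *m B) zeta.
have alD u v : al (u + v) = al u + al v by rewrite /al mulmxDl dotDl.
have ka2 : 0 < ka / 2 by rewrite divr_gt0.
have [a' [ar' aa' Ia']] : exists a', [/\ nr a' < r, nr (a' - a) < ka / 2 &
    complex.Im (al (Phi a' - p0)) != 0].
  have [Ia|Ia] := eqVneq (complex.Im (al (Phi a - p0))) 0; last first.
    by exists a; split=> //; rewrite subrr nr0.
  have [t t0 ht] := locally_onto pP (monot_locinj mu0 hP) rr ar ka2.
  have n0 : 0 < nr e + 1 by have := nr_ge0 e; lra.
  pose d := t / (2 * (nr e + 1)); have d0 : 0 < d by rewrite divr_gt0 // mulr_gt0.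
  have [|x [x1 x2 x3]] := ht (Phi a + (0 +i* d)%C *: e).
    rewrite addrC addKr nrZ; have := cm_ReIm (0 +i* d)%C; rewrite /= normr0 add0r gtr0_norm // => h.
    apply: le_lt_trans (ler_wpM2r (nr_ge0 e) h) _.
    have : d * (nr e + 1) = t / 2 by rewrite /d; field; rewrite gt_eqF.
    lra.
  exists x; split=> //; rewrite x3 addrAC alD cImD Ia add0r.
  by rewrite /al -scalemxAl dotZl e1 mulr1 /= gt_eqF.
have I0 : 0 < `|complex.Im (al (Phi a' - p0))| by rewrite normr_gt0.
have [K K0 hK] := nr_mulmx B.
have z1 : 0 < K * (nr zeta + 1) by rewrite mulr_gt0 //; have := nr_ge0 zeta; lra.
have [d d0 hd] := Pc a' _ (divr_gt0 I0 z1).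
exists a', (Num.min d (ka / 2)); split; [exact: ar'|by rewrite lt_min d0| |].
  have : Num.min d (ka / 2) <= ka / 2 by rewrite ge_min lexx orbT.
  lra.
move=> b; rewrite lt_min => /andP[/hd h1 _]; apply/eqP => Ib.
have E : al (Phi a' - p0) = al (Phi b - p0) + al (Phi a' - Phi b).
  by rewrite -alD addrAC; congr (al (_ - _)); rewrite [RHS]addrC subrK.
have : `|complex.Im (al (Phi a' - p0))| <= cm (al (Phi a' - Phi b)).
  by rewrite E cImD [complex.Im (al (Phi b - p0))]Ib add0r; exact: normIm_cm.
move: h1; rewrite nrB ltr_pdivlMr // => h1; rewrite leNgt => /negP; apply.
apply: le_lt_trans h1; apply: le_trans (cm_dot _ _) _.
rewrite mulrA; apply: ler_pM; rewrite ?nr_ge0 //; last by lra.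
by rewrite mulrC.
Qed.

Lemma seq_bound (qs : seq V) (rho : R) : 0 < rho -> (forall q, q \in qs -> nr q < rho) ->
  exists2 r, 0 <= r < rho & forall q, q \in qs -> nr q <= r.
Proof.
move=> rho0; elim: qs => [_|q qs IH h]; first by exists 0; rewrite ?lexx.
have [q' hq'|r /andP[r0 rr] hr] := IH; first by apply: h; rewrite inE hq' orbT.
have qr := h q (mem_head _ _).
exists (Num.max r (nr q)); first by rewrite le_max r0 gt_max rr.
move=> q'; rewrite inE => /predU1P[->|/hr h']; first by rewrite le_max lexx orbT.
by rewrite le_max h'.
Qed.

(** [h] is moved before [Phi] is stretched, because [stretch_nochain] relies on
    [h zeta = Phi (b 0)]. The three bumps come from one family whose nodes are the old chain and
    [b], so the existing links and values there are kept. *)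
Lemma stage_step Phi h rho mu M qs (ka : R) d : stage Phi h rho mu M qs ->
  0 < ka -> ka < mu -> nr d < 1 ->
  exists (Phi' h' : V -> V) (rho' r : R) (ext : seq V),
  [/\ stage Phi' h' rho' (mu - ka) (M + ka) (qs ++ ext),
    [/\ rho - ka < r, r < rho', rho' < rho, forall q, q \in qs -> nr q < r &
        exists2 q, q \in ext & nr q = r],
    exists2 q, q \in ext & nr (q - r%:C%C *: d) <= ka,
    forall x y, nr x <= r - ka -> nr y <= r - ka ->
      nr (Phi' x - Phi x) <= ka /\
      nr ((Phi' x - Phi x) - (Phi' y - Phi y)) <= ka * nr (x - y) &
    forall x y, nr x <= r - ka -> nr y <= r - ka ->
      nr (h' x - h x) <= ka /\
      nr ((h' x - h x) - (h' y - h y)) <= ka * nr (x - y)].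
Proof.
move=> [pP ph rho0 hP hl hN PM hM qsz qin qch qex] ka0 kamu d1.
have mu0 : 0 < mu by apply: lt_trans kamu.
have Pc := polymap_cont pP; have hc := polymap_cont ph.
have [r1 /andP[r10 r1rho] hr1] := seq_bound rho0 qin.
pose r := (Num.max r1 (rho - ka) + rho) / 2.
have r1r : r1 < r by have : r1 <= Num.max r1 (rho - ka); [rewrite le_max lexx|rewrite /r; lra].
have kr : rho - ka < r.
  by have : rho - ka <= Num.max r1 (rho - ka); [rewrite le_max lexx orbT|rewrite /r; lra].
have rr : r < rho.
  have : Num.max r1 (rho - ka) < rho by rewrite gt_max r1rho /=; lra.
  rewrite /r; lra.
have r0 : 0 < r by apply: le_lt_trans r1r.
clearbody r.
have hPr := monotW (ltW rr) hP; have hNr := nochainW (ltW rr) hN.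
have qr q : q \in qs -> nr q < r by move=> /hr1 hq; apply: le_lt_trans r1r.
set w := h (last 0 qs) in qex.
have [K K0 hK] := polymap_lip r pP.
have [zeta [s [zr s0 wE]]] := boundary_ray r0 mu0 K0 hPr hK
  (fun x xr => qex x (le_trans xr (ltW rr))).
have z0 : zeta != 0 by apply/eqP => z0; rewrite -zr z0 nr0 ltxx in r0.
have [A hA] := polymap_sder ph zeta.
have zrho : nr zeta < rho by rewrite zr.
have Au := locinj_unitmx hl zrho hA.
(* Normalised so that the form [u |-> dot (u *m invmx A) zeta] takes the value 1 at [e]. *)
pose e := (r ^+ 2)^-1%:C%C *: (zeta *m A).
have e1 : dot (e *m invmx A) zeta = 1.
  by rewrite /e -scalemxAl mulmxK // dotZl dotxx zr -rmorphM mulVf // gt_eqF ?exprn_gt0.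
clearbody e.
have ar : nr (r%:C%C *: d) < r by rewrite nrZ cm_real gtr0_norm // -[ltRHS]mulr1 ltr_pM2l.
have [a [t [ar' t0 hat hIm]]] := good_start (h zeta) pP mu0 hP (ltW rr) ar e1 ka0.
have sz0 : s%:C%C *: zeta != 0.
  by rewrite scaler_eq0 negb_or z0 andbT -(rmorph0 (real_complex R)) (inj_eq (@complexI _)) gt_eqF.
have [n [b [ba br bch bex bexS]]] :=
  exit_chain (Phi zeta) ph Pc hl r0 (ltW rr) mu0 hP hNr ar' sz0 t0.
have Phi_inj x y : nr x <= r -> nr y <= r -> Phi x = Phi y -> x = y.
  by move=> xr yr; exact: monot_inj mu0 hPr xr yr.
pose Z := [set p | reach Phi h r zeta p].
(* The bound on [h] grows by three quarters of [ka]: the length of [v1] and the two jumps. *)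
pose ka4 := ka / 4; have ka40 : 0 < ka4 by rewrite divr_gt0.
have k4E : 4 * ka4 = ka by rewrite mulrC divfK ?pnatr_eq0.
clearbody ka4.
have [v1 [v1k v1al v12 av1 av2]] := path_choice (reach_countable Phi zeta (locinjW (ltW rr) hl))
  (nochain_aperiodic hNr) (exit_noreach zr Phi_inj br bch bex) e1 (hIm _ ba) ka40.
set v2 := Phi (b 0%N) - h zeta - v1 in v12 av2.
pose Q := qs ++ mkseq b n.+1.
have hQ q : q \in Q -> nr q <= r /\ q != zeta.
  move=> qQ; suff qr' : nr q < r.
    by split; [exact: ltW|apply/eqP => qz; rewrite qz zr ltxx in qr'].
  move: qQ; rewrite mem_cat => /orP[/qr//|/mapP[j]].
  by rewrite mem_iota add0n ltnS => /andP[_ jn] ->; exact: br.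
have [lam [rhok [tau hb]]] := bump_exists r0 zr hQ.
have hMr x : nr x <= r -> nr (h x) <= M by move=> xr; exact: hM (le_trans xr (ltW rr)).
have hz : nr (h zeta) <= M by apply: hMr; rewrite zr.
have hM1 x : nr x <= r -> nr (h x) <= M + ka4 by move=> /hMr hx; apply: le_trans hx _; rewrite lerDl ltW.
have hv1 : nr (h zeta + v1) <= M + ka4 by apply: le_trans (nrD _ _) _; exact: lerD.
pose al2 := dot (v2 *m invmx A) zeta.
(* From this slope on, the quantity required by [second_direction] is at least 1. *)
pose X := (1 - complex.Re al2) / complex.Re (al2 * (dot (v1 *m invmx A) zeta)^*%C).
have hX : \forall k \near \oo, X <= tau k /\ (forall th : R, 0 <= th <= 1 ->
    ~ reach Phi (fun x => h x + lam k x *: v1) (rhok k) zeta (h zeta + v1 + th%:C%C *: v2)).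
  exact: filterI (bump_slope hb X) (jump_noreach hb Pc hc hNr v1 av2).
have [k1 [[E1 E2] rk1 hN1 hl1 [hM1' sm1]]] :=
  jump_step zr hb Pc ph rr hl hNr hA av1 v1al hM1 hv1 ka40 hX.
set h1 := (fun x => h x + lam k1 x *: v1) in E2 hN1 hl1 hM1'.
have ph1 : polymap h1 by apply: pm_add => //; exact: bump_poly hb k1.
have hA1 := sderD v1 hA (bump_grad hb k1); rewrite -/h1 in hA1.
have rk1' : r < rhok k1 by have /andP[] := bump_radius hb k1.
have zk1 : nr zeta < rhok k1 by rewrite zr.
have A1u := locinj_unitmx hl1 zk1 hA1.
have v2al : 0 < complex.Re (dot (v2 *m invmx (A + adj ((tau k1)%:C%C *: zeta) *m v1)) zeta).
  apply: second_direction => //; rewrite -/al2; apply: (lt_le_trans ltr01).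
  by rewrite -lerBlDl -ler_pdivrMr.
have h1z : h1 zeta = h zeta + v1 by rewrite /h1 (bump_tip hb) scale1r.
have hN1r := nochainW (ltW rk1') hN1.
have av2' th : 0 <= th <= 1 -> ~ reach Phi h1 r zeta (h1 zeta + th%:C%C *: v2).
  move=> th01; rewrite h1z => -[i [x [xr xi x0 hx]]]; apply: (E2 th th01).
  by exists i, x; split=> // j; apply: le_trans (xr j) (ltW rk1').
have hM2 x : nr x <= r -> nr (h1 x) <= M + ka4 + ka4.
  by move=> xr; apply: hM1'; apply: le_trans xr (ltW rk1').
have v12E : h zeta + v1 + v2 = Phi (b 0%N).
  by rewrite /v2 -[_ - h zeta - v1]addrA -opprD [LHS]addrC subrK.
have Pb0 : nr (Phi (b 0%N)) <= M.
  by apply: PM; apply/ltW; apply: lt_trans rr; exact: br.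
have hv2 : nr (h1 zeta + v2) <= M + ka4 + ka4 
  by rewrite h1z v12E; apply: le_trans Pb0 _; rewrite -addrA lerDl addr_ge0 // ltW.
have [k2 [_ rk2 hN2 hl2 [hM2' sm2]]] :=
  jump_step zr hb Pc ph1 rk1' hl1 hN1r hA1 av2' v2al hM2 hv2 ka40 filterT.
set h2 := (fun x => h1 x + lam k2 x *: v2) in hN2 hl2 hM2'.
have ph2 : polymap h2 by apply: pm_add => //; exact: bump_poly hb k2.
have hc2 := polymap_cont ph2.
have rk2' : r < rhok k2 by have /andP[] := bump_radius hb k2.
have hN2r := nochainW (ltW rk2') hN2.
have h2z : h2 zeta = Phi (b 0%N) by rewrite /h2 (bump_tip hb) scale1r h1z.
have h2Q q : q \in Q -> h2 q = h q.
  by move=> qQ; rewrite /h2 /h1 !(bump_node hb) // !scale0r !addr0.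
have bQ j : (j <= n)%N -> b j \in Q.
  by move=> jn; rewrite mem_cat; apply/orP; right; apply: map_f; rewrite mem_iota add0n ltnS.
have qQ q : q \in qs -> q \in Q by rewrite mem_cat => ->.
have bch2 j : (j < n)%N -> h2 (b j) = Phi (b j.+1).
  by move=> jn; rewrite h2Q ?bch // bQ // ltnW.
have bex2 x : nr x <= r -> h2 (b n) <> Phi x by rewrite h2Q ?bQ //; exact: bex.
have bexS2 (th : R) : 0 <= th <= 1 -> h2 (b n) <> Phi zeta + th%:C%C *: (s%:C%C *: zeta).
  by move=> _; rewrite h2Q ?bQ.
have seg_free (th : R) x : 0 <= th <= 1 -> nr x < r -> Phi x <> Phi zeta + th%:C%C *: (s%:C%C *: zeta).
  exact: (monot_ray mu0 s0 hPr zr).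
have segM (th : R) : 0 <= th <= 1 -> nr (Phi zeta + th%:C%C *: (s%:C%C *: zeta)) <= M.
  apply: segment_le; first by apply: PM; exact: ltW.
  rewrite -wE; apply: hM; apply/ltW/qin; case: (qs) qsz => // q qs' _ /=; exact: mem_last.
have PMr x : nr x <= r -> nr (Phi x) <= M by move=> xr; exact: PM (le_trans xr (ltW rr)).
have T1 := stretch_monot hb zr s0 rr ka0 hP.
have T2 := stretch_nochain hb Pc hc2 hN2r h2z br bch2 bex2 bexS2 Phi_inj seg_free.
have T3 := stretch_exit hb Pc bex2 bexS2.
have T4 := jump_bound hb Pc PMr segM ka0.
have T5 := bump_small (s%:C%C *: zeta) zr hb ka0.
have [k3 [[[[U1 U2] U3] U4] U5]] := filter_ex (filterI (filterI (filterI (filterI T1 T2) T3) T4) T5).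
set P3 := (fun x => Phi x + lam k3 x *: (s%:C%C *: zeta)) in U1 U2 U3 U4.
have pP3 : polymap P3 by apply: pm_add => //; exact: bump_poly hb k3.
have rk3' : r < rhok k3 by have /andP[] := bump_radius hb k3.
pose rho' := Num.min (rhok k2) (rhok k3).
have rr' : r < rho' by rewrite lt_min rk2'.
have r'2 : rho' <= rhok k2 by rewrite ge_min lexx.
have r'3 : rho' <= rhok k3 by rewrite ge_min lexx orbT.
have r'rho : rho' < rho by apply: le_lt_trans r'2 (lt_trans rk2 rk1).
clearbody rho'.
have P3Q q : q \in Q -> P3 q = Phi q.
  by move=> qQ'; rewrite /P3 (bump_node hb) // scale0r addr0.
have P3z : P3 zeta = w by rewrite /P3 (bump_tip hb) scale1r wE.
have P3b j : (j <= n)%N -> P3 (b j) = Phi (b j) by move=> jn; rewrite P3Q ?bQ.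
have [ext [esz en eb]] : exists ext : seq V, [/\ size ext = n.+1,
    forall j, (j <= n)%N -> nth 0 ext j = b j &
    forall q, q \in ext -> exists2 j, (j <= n)%N & q = b j].
  exists (mkseq b n.+1); split; first by rewrite size_mkseq.
    by move=> j jn; rewrite nth_mkseq.
  by move=> q /mapP[j]; rewrite mem_iota add0n ltnS => /andP[_ jn] ->; exists j.
exists P3, h2, rho', r, (zeta :: ext); split.
- split; [exact: pP3|exact: ph2|exact: lt_trans rr'|exact: monotW U1|exact: locinjW hl2
    |exact: nochainW U2| | | | | |].
  + by move=> x xr; apply: U4; apply: le_trans r'3.
  + move=> x xr; apply: le_trans (hM2' x (le_trans xr r'2)) _.
    by rewrite -!addrA lerD2l -k4E; clear - ka40; lra.
  + by rewrite size_cat /= addnS.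
  + move=> q; rewrite mem_cat inE => /or3P[/qr hq|/eqP->|/eb[j jn ->]].
    * exact: lt_trans rr'.
    * by rewrite zr.
    * by apply: lt_trans rr'; exact: br.
  + move=> i; rewrite size_cat /= esz => hi.
    rewrite !nth_cat; have [iq|iq] := ltnP i.+1 (size qs).
      by rewrite (ltnW iq) h2Q ?qQ ?mem_nth ?(ltnW iq) // P3Q ?qQ ?mem_nth // qch.
    have [iq'|iq'] := ltnP i (size qs).
      have E : i.+1 = size qs by apply/eqP; rewrite eqn_leq iq'.
      by rewrite E subnn /= P3z h2Q ?qQ ?mem_nth // /w -nth_last -E.
    rewrite (subSn iq') /=.
    have lt : (i - size qs < n.+1)%N by rewrite ltn_subLR // -ltnS -addnS.
    case E : (i - size qs)%N lt => [|j] lt /=.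
      by rewrite h2z en // P3b.
    have jn : (j < n)%N := lt.
    by rewrite (en _ (ltnW jn)) (en _ jn) (h2Q _ (bQ _ (ltnW jn))) (bch _ jn) (P3b _ jn).
  + move=> x xr; rewrite last_cat /= (_ : last zeta ext = b n) => [hx|].
      by apply: (U3 x (le_trans xr r'3)); exact: esym hx.
    by rewrite -nth_last esz /= (set_nth_default 0) ?esz // en.
- by split=> //; exists zeta; rewrite ?mem_head.
- exists (b 0%N).
    by rewrite inE; apply/orP; right; rewrite -(en 0%N) // mem_nth // esz.
  apply: le_trans (nr_tri _ a _) _; apply: le_trans hat.
  by rewrite addrC lerD2l; exact: ltW.
- move=> x y xr yr; have P3E z : P3 z - Phi z = lam k3 z *: (s%:C%C *: zeta).
    by rewrite /P3 addrC addKr.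
  by rewrite !P3E; exact: U5.
- move=> x y xr yr.
  have h2E z : h2 z - h z = lam k1 z *: v1 + lam k2 z *: v2.
    by rewrite /h2 /h1 [_ - h z]addrAC [_ + _ - h z]addrAC subrr add0r.
  have k1' : r - ka <= r - ka4 by rewrite lerD2l lerN2 -k4E; clear - ka40; lra.
  have xr4 := le_trans xr k1'; have yr4 := le_trans yr k1'.
  have [s1 s2] := sm1 x y xr4 yr4; have [s3 s4] := sm2 x y xr4 yr4.
  have k24 : ka4 + ka4 <= ka by rewrite -k4E; clear - ka40; lra.
  rewrite !h2E; split; first by apply: le_trans (nrD _ _) _; apply: le_trans (lerD s1 s3) _.
  rewrite opprD addrACA; apply: le_trans (nrD _ _) _.
  apply: le_trans (lerD s2 s4) _.
  by rewrite -mulrDl ler_wpM2r // nr_ge0.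
Qed.

End Stage.

(** * From Euclidean estimates to the topology and differentials of C^m *)

Section Topology.
Variables (R : realType) (m : nat).
Local Notation C := R[i].
Local Notation V := 'rV[C]_m.
Implicit Types (r : R) (x y z u v w : V) (f g : V -> V).

Lemma gt0_real (e : C) : 0 < e -> exists2 t : R, 0 < t & e = t%:C%C.
Proof.
case: e => a b; rewrite ltcE /= => /andP[/eqP -> a0]; exists a => //.
Qed.

Lemma norm_le_nr u : `|u| <= (nr u)%:C%C.
Proof.
have [->|u0] := eqVneq u 0; first by rewrite normr0 nr0.
have : mx_norm u != 0 by rewrite -[mx_norm u]/(`|u|) normr_eq0.
move=> /mx_norm_neq0[[i j] /= E]; rewrite -[`|u|]/(mx_norm u) E cmE lecR ord1.
exact: cm_le_nr.
Qed.

Lemma norm_entry_le u ij : `|u ij.1 ij.2| <= `|u|.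
Proof.
by rewrite -[`|u|]/(mx_norm u) mx_normE -[leLHS]nngE num_le; exact: le_bigmax.
Qed.

Lemma nr_le_norm u : (nr u)%:C%C <= m%:R * `|u|.
Proof.
have [t t0 E] : exists2 t : R, 0 <= t & `|u| = t%:C%C.
  have : 0 <= `|u| by []. case: `|u| => a b; rewrite lecE /= => /andP[/eqP -> a0]; by exists a.
have h : nr u <= m%:R * t.
  apply: nr_le_bound => j; rewrite -lecR -cmE -E.
  exact: (norm_entry_le u (0, j)).
by rewrite E -(rmorph_nat (real_complex R)) -rmorphM lecR.
Qed.

(** The bridge between neighbourhoods for the sup norm, whose radii are in [R[i]], and the real
    Euclidean estimates of the construction. *)
Lemma nbhs_nr (p : V) (B : set V) : nbhs p B <-> exists2 t : R, 0 < t & forall y, nr (y - p) < t -> B y.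
Proof.
split=> [/nbhs_ballP[e /gt0_real[t t0 ->] hB]|[t t0 hB]].
  exists t => // y yt; apply: hB; rewrite mx_norm_ball /ball_ /= distrC.
  by apply: le_lt_trans (norm_le_nr _) _; rewrite ltcR.
apply/nbhs_ballP; exists (t / m.+1%:R)%:C%C; first by rewrite /= ltcR divr_gt0.
move=> y; rewrite mx_norm_ball /ball_ /= distrC => yt; apply: hB.
rewrite -ltcR; apply: le_lt_trans (nr_le_norm _) _.
have m1 : 0 < m.+1%:R :> C by [].
apply: (@le_lt_trans _ _ (m.+1%:R * `|y - p|)); first by rewrite ler_wpM2r // ler_nat.
by rewrite -ltr_pdivlMl // mulrC; move: yt; rewrite rmorphM fmorphV rmorph_nat.
Qed.

Lemma fder_differentiable f z (A : 'M[C]_m) : fder f z A -> differentiable f z.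
Proof.
move=> hf; pose df : {linear V -> V} := mulmxr A.
have dfc : continuous df.
  move=> x B /= /nbhs_nr[t t0 hB]; apply/nbhs_nr.
  have [K K0 hK] := nr_mulmx A.
  exists (t / K); first by rewrite divr_gt0.
  move=> y; rewrite ltr_pdivlMr // => yt; apply: hB; rewrite /= -mulmxBl.
  by apply: le_lt_trans (hK _) _; rewrite mulrC.
pose W : normedModType C := 'rV[C]_m.
have E : (f : W -> W) \o shift (z : W) = cst (f z) + (df : W -> W) +o_ (0 : W) id.
  apply/eqaddoP => _ /gt0_real[e e0 ->].
  have m1 : 0 < m.+1%:R :> R by [].
  have [d d0 hd] := hf (e / m.+1%:R) (divr_gt0 e0 m1).
  apply/nbhs_nr; exists d => // y; rewrite subr0 => yd.
  have := hd (y + z); rewrite addrK => /(_ yd) h.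
  rewrite /= -[X in `|X|]/(f (y + z) - (f z + y *m A)) opprD addrA.
  apply: le_trans (norm_le_nr _) _; rewrite -lecR in h; apply: le_trans h _.
  rewrite rmorphM; apply: le_trans (ler_wpM2l _ (nr_le_norm y)) _; first by rewrite lecR divr_ge0 // ltW.
  rewrite mulrA ler_wpM2r // -(rmorph_nat (real_complex R)) -rmorphM lecR.
  by rewrite mulrAC ler_pdivrMr // ler_pM2l // ler_nat.
have D := @diff_unique C W W f df z dfc E.
by apply/diff_locallyP; rewrite D; split.
Qed.

Lemma fder_cont f z A : fder f z A -> forall e : R, 0 < e -> exists2 d : R, 0 < d &
  forall y, nr (y - z) < d -> nr (f y - f z) < e.
Proof.
move=> hf e e0; have [d d0 hd] := hf 1 ltr01; have [K K0 hK] := nr_mulmx A.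
have K1 : 0 < 1 + K by lra.
exists (Num.min d (e / (1 + K))); first by rewrite lt_min d0 divr_gt0.
move=> y; rewrite lt_min => /andP[/hd h1]; rewrite ltr_pdivlMr // => h2.
rewrite -(subrK ((y - z) *m A) (f y - f z)).
by apply: le_lt_trans (nrD _ _) _; have := hK (y - z); lra.
Qed.

Lemma fder_comp f g z A B : fder f z A -> fder g (f z) B -> fder (g \o f) z (A *m B).
Proof.
move=> hf hg w w0; have [K K0 hK] := nr_mulmx A; have [L L0 hL] := nr_mulmx B.
have K1 : 0 < K + 1 by lra. have L2 : 0 < 2 * L by lra.
pose w1 := w / (2 * (K + 1)); pose w2 := Num.min 1 (w / (2 * L)).
have w10 : 0 < w1 by rewrite divr_gt0 // mulr_gt0.
have w20 : 0 < w2 by rewrite lt_min ltr01 divr_gt0.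
have E1 : w1 * (K + 1) = w / 2 by rewrite /w1; field; rewrite gt_eqF.
have E2 : L * w2 <= w / 2.
  have : w2 <= w / (2 * L) by rewrite ge_min lexx orbT.
  rewrite ler_pdivlMr //; lra.
have w21 : w2 <= 1 by rewrite ge_min lexx.
have [d1 d10 h1] := hg w1 w10; have [d2 d20 h2] := hf w2 w20.
clearbody w1 w2.
exists (Num.min d2 (d1 / (K + 1))); first by rewrite lt_min d20 divr_gt0.
move=> y; rewrite lt_min => /andP[/h2 yf]; rewrite ltr_pdivlMr // => yd.
have y0 := nr_ge0 (y - z); have hKy := hK (y - z).
have fy : nr (f y - f z) <= (K + 1) * nr (y - z).
  rewrite -(subrK ((y - z) *m A) (f y - f z)); apply: le_trans (nrD _ _) _; nra.
have /h1 gy : nr (f y - f z) < d1 by apply: le_lt_trans fy _; rewrite mulrC.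
rewrite /= mulmxA -(subrK ((f y - f z) *m B) (g (f y) - g (f z))) -addrA -mulmxBl.
apply: le_trans (nrD _ _) _; apply: le_trans (lerD gy (hL _)) _.
have h3 := ler_wpM2l (ltW w10) fy; have h4 := ler_wpM2l (ltW L0) yf.
have h5 : L * w2 * nr (y - z) <= w / 2 * nr (y - z) by rewrite ler_wpM2r.
have h6 : w1 * (K + 1) * nr (y - z) = w / 2 * nr (y - z) by rewrite E1.
apply: le_trans (lerD h3 h4) _; rewrite !mulrA h6; lra.
Qed.

Lemma fder_scale (c : C) z : fder (fun x => c *: x) z c%:M.
Proof.
move=> w w0; exists 1 => // y _.
by rewrite -scalerBr mul_mx_scalar subrr nr0 mulr_ge0 ?nr_ge0 // ltW.
Qed.

Lemma unit_ballE : @unit_ball R m = [set z | nr z < 1].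
Proof.
apply/seteqP; have E z : euclidean_norm z = (nr z)%:C%C.
  rewrite /euclidean_norm.
  have -> : \sum_(j < m) `|z 0 j| ^+ 2 = ((nr z)%:C%C) ^+ 2.
    by rewrite -rmorphXn nr_sqr rmorph_sum; apply: eq_bigr => j _; rewrite cmE -rmorphXn.
  by rewrite sqrCK // lecR nr_ge0.
by split=> z; rewrite /unit_ball /= E ltcR.
Qed.

(** The ball is a union of segments issuing from 0, so its image is a union of connected curves
    through [f 0]. *)
Lemma image_ball_connected f (r : R) :
  (forall z, nr z < r -> forall e : R, 0 < e -> exists2 d : R, 0 < d &
    forall y, nr (y - z) < d -> nr (f y - f z) < e) ->
  connected (f @` [set x | nr x < r]).
Proof.
move=> fc; have [r0|r0] := leP r 0.
  rewrite (_ : _ @` _ = set0); first exact: connected0.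
  by apply/seteqP; split=> // y [x /= xr _]; have := nr_ge0 x; lra.
have nZ (t : R) x : 0 <= t <= 1 -> nr x < r -> nr (t%:C%C *: x) < r.
  move=> /andP[t0 t1] xr; rewrite nrZ cm_real ger0_norm //; apply: le_lt_trans xr.
  by rewrite ler_piMl // nr_ge0.
pose g x (t : R) : V := f (t%:C%C *: x).
have -> : f @` [set x | nr x < r] = \bigcup_(x in [set x | nr x < r]) (g x @` `[0, 1]%classic).
  apply/seteqP; split=> [y [x xr <-]|y [x xr [t + <-]]].
    by exists x => //; exists 1; rewrite /g ?scale1r //= in_itv /= ler01 lexx.
  by rewrite /= in_itv /= => t01; exists (t%:C%C *: x) => //; exact: nZ.
apply: bigcup_connected.
  exists (f 0) => x xr; exists 0; first by rewrite /= in_itv /= ler01 lexx.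
  by rewrite /g scale0r.
move=> x xr; apply: connected_continuous_connected; first exact: segment_connected.
apply: continuous_in_subspaceT => t; rewrite inE /= in_itv /= => t01.
move=> B /nbhs_nr[e e0 hB]; have [d d0 hd] := fc _ (nZ t x t01 xr) e e0.
have x1 : 0 < nr x + 1 by have := nr_ge0 x; lra.
apply/nbhs_ballP; exists (d / (nr x + 1)); first by rewrite /= divr_gt0.
move=> s; rewrite /ball /= ltr_pdivlMr // distrC => st; apply: hB; apply: hd.
rewrite -scalerBl -rmorphB nrZ cm_real; apply: le_lt_trans st.
by rewrite ler_wpM2l // lerDl.
Qed.

Lemma bounded_nr (U : set V) (M : R) : (forall y, U y -> nr y <= M) -> bounded_set U.
Proof.
move=> hU; exists M%:C%C; split; first by rewrite realE -(rmorph0 (real_complex R)) !lecR le_total.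
move=> x Mx y Uy; apply: ltW; apply: le_lt_trans Mx; apply: le_trans (norm_le_nr _) _.
by rewrite lecR; exact: hU.
Qed.

End Topology.

(** * Limits of maps with geometrically decreasing steps *)

Section Limit.
Variables (R : realType) (m : nat).
Local Notation C := R[i].
Local Notation V := 'rV[C]_m.
Implicit Types (r : R) (x y z u v w : V) (f g : V -> V).

Lemma fder_bound f z (A : 'M[C]_m) (c d : R) : 0 < d -> fder f z A ->
  (forall y, nr (y - z) < d -> nr (f y - f z) <= c * nr (y - z)) ->
  forall u, nr (u *m A) <= c * nr u.
Proof.
move=> d0 hf hc u; have [->|u0] := eqVneq u 0; first by rewrite mul0mx nr0 mulr0.
have nu := nr_gt0 u0; apply/ler_addgt0Pr => e e0.
have [d' d'0 hd] := hf (e / nr u) (divr_gt0 e0 nu).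
pose t := Num.min d d' / 2 / nr u.
have md : 0 < Num.min d d' by rewrite lt_min d0.
have t0 : 0 < t by rewrite !divr_gt0.
have nt : nr (t%:C%C *: u) = Num.min d d' / 2.
  by rewrite nrZ cm_real gtr0_norm // /t divfK // gt_eqF.
have nt' : nr (t%:C%C *: u) = t * nr u by rewrite nrZ cm_real gtr0_norm.
have : nr (t%:C%C *: u) < Num.min d d' by rewrite nt; lra.
rewrite lt_min => /andP[td td'].
have yz : z + t%:C%C *: u - z = t%:C%C *: u by rewrite addrC addKr.
have := hc (z + t%:C%C *: u); have := hd (z + t%:C%C *: u).
rewrite yz => /(_ td') h1 /(_ td); rewrite -scalemxAl nt' in h1 * => h2.
have E : e / nr u * (t * nr u) = t * e by field; rewrite gt_eqF.
rewrite E in h1; clearbody t.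
rewrite -(ler_pM2l t0) -{1}(gtr0_norm t0) -cm_real -nrZ.
apply: le_trans (_ : c * (t * nr u) + t * e <= _); last by rewrite mulrDr mulrCA.
set p := f (z + _) - f z in h1 h2; set q := t%:C%C *: (u *m A) in h1 *.
by have := nrD p (q - p); rewrite (nrB q) addrC subrK; lra.
Qed.

Lemma fderB f g z A B : fder f z A -> fder g z B -> fder (fun x => f x - g x) z (A - B).
Proof.
move=> hf hg w w0; have w2 : 0 < w / 2 by rewrite divr_gt0.
have [d1 d10 h1] := hf _ w2; have [d2 d20 h2] := hg _ w2.
exists (Num.min d1 d2); first by rewrite lt_min d10.
move=> y; rewrite lt_min => /andP[/h1 {}h1 /h2 {}h2].
have -> : f y - g y - (f z - g z) - (y - z) *m (A - B) =
    (f y - f z - (y - z) *m A) - (g y - g z - (y - z) *m B).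
  rewrite mulmxBr; move: (_ *m A) (_ *m B) => a b.
  rewrite !opprD !opprK -!addrA; congr (_ + _).
  rewrite [- g y + _]addrCA; congr (_ + _).
  rewrite [RHS]addrCA; congr (_ + _); rewrite addrCA; congr (_ + _).
apply: le_trans (nrD _ _) _; rewrite nrN; lra.
Qed.

Variables (rho : R) (e : nat -> R).
Hypotheses (e_gt0 : forall N, 0 < e N) (eS : forall N, e N.+1 = e N / 2).

Lemma e_anti N k : (N <= k)%N -> e k <= e N.
Proof.
move=> Nk; rewrite -(subnK Nk); elim: (k - N)%N => [|j IH]; first by rewrite add0n.
by rewrite addSn eS; apply: le_trans IH; have := e_gt0 (j + N)%N; lra.
Qed.

Lemma e_small (c : R) : 0 < c -> exists N, e N < c.
Proof.
move=> c0; have hle N : N.+1%:R * e N <= 2 * e 0%N.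
  elim: N => [|N IH]; first by rewrite mul1r; have := e_gt0 0%N; lra.
  rewrite eS; have h := e_gt0 N; have : N.+2%:R <= 2 * N.+1%:R :> R.
    by rewrite -natrM ler_nat mul2n -addnn addnS ltnS leq_addr.
  by move=> h2; apply: le_trans IH; nra.
have [N hN] : exists N : nat, 2 * e 0%N / c < N%:R.
  by exists (Num.bound (2 * e 0%N / c)); apply: archi_boundP; rewrite divr_ge0 ?mulr_ge0 // ltW.
exists N; rewrite ltNge; apply/negP => ce; have := hle N.
rewrite ltr_pdivrMr // in hN; rewrite -natr1; have : 0 <= N%:R :> R by [].
by move: (N%:R) hN => a hN a0; nra.
Qed.

(** [rho] will be the limit radius; as it is below [r N + e N], the ball of radius [rho - 2 * e N]
    lies in the ball of radius [r N - e N] on which a stage controls the change of its maps. *)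
Definition small_steps (f : nat -> V -> V) := forall N x y,
  nr x <= rho - 2 * e N -> nr y <= rho - 2 * e N ->
  nr (f N.+1 x - f N x) <= e N /\
  nr ((f N.+1 x - f N x) - (f N.+1 y - f N y)) <= e N * nr (x - y).

Definition close_to (f : nat -> V -> V) (F : V -> V) := forall N x y,
  nr x <= rho - 2 * e N -> nr y <= rho - 2 * e N ->
  nr (F x - f N x) <= 2 * e N /\
  nr ((F x - f N x) - (F y - f N y)) <= 2 * e N * nr (x - y).

(** [2 * (e N - e k)] is the geometric sum of the steps from [N] up to but excluding [k]. *)
Lemma small_steps_tail (f : nat -> V -> V) : small_steps f -> forall N k x y, (N <= k)%N ->
  nr x <= rho - 2 * e N -> nr y <= rho - 2 * e N ->
  nr (f k x - f N x) <= 2 * (e N - e k) /\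
  nr ((f k x - f N x) - (f k y - f N y)) <= 2 * (e N - e k) * nr (x - y).
Proof.
move=> hf N k x y Nk xr yr; rewrite -(subnK Nk); elim: (k - N)%N => [|j IH].
  by rewrite add0n !subrr nr0 mulr0 mul0r.
rewrite addSn; set K := (j + N)%N in IH *; have [h1 h2] := IH.
have KN : e K <= e N by apply: e_anti; exact: leq_addl.
have [||h3 h4] := hf K x y; [lra|lra|].
rewrite eS; split.
  by apply: le_trans (nr_tri _ (f K x) _) _; lra.
have -> : f K.+1 x - f N x - (f K.+1 y - f N y) =
    (f K.+1 x - f K x - (f K.+1 y - f K y)) + (f K x - f N x - (f K y - f N y)).
  by rewrite [RHS]addrACA -opprD !addrA !subrK.
by apply: le_trans (nrD _ _) _; lra.
Qed.

Lemma small_steps_limit (f : nat -> V -> V) : small_steps f -> exists F, close_to f F.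
Proof.
move=> hf.
have /choice[F hF] : forall x, exists l, (exists N, nr x <= rho - 2 * e N) -> ulim (f^~ x) l.
  move=> x; have [[N xN]|hn] := pselect (exists N, nr x <= rho - 2 * e N); last by exists 0.
  suff [l xl] : exists l, ulim (f^~ x) l by exists l.
  apply: (@ulim_ex _ _ _ (nr (f N x) + 2 * e N)); apply: filterS (fu_ge N) => k /= Nk.
  have [h _] := small_steps_tail hf Nk xN xN.
  by have := nrD (f k x - f N x) (f N x); rewrite subrK; have := e_gt0 k; lra.
exists F => N x y xN yN.
have Fx := hF x (ex_intro _ N xN); have Fy := hF y (ex_intro _ N yN).
have Dx := ulimD Fx (ulim_cst (- f N x)); have Dy := ulimD Fy (ulim_cst (- f N y)).
split.
  apply: (ulim_le Dx) => t t0; apply: filterS (fu_ge N) => k /= Nk.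
  by have [h _] := small_steps_tail hf Nk xN xN; have := e_gt0 k; lra.
have Dy' := ulim_cont (f := -%R) _ Dy.
have {}Dy' : ulim (fun k => - (f k y - f N y)) (- (F y - f N y)).
  apply: Dy' => t t0; exists t => // z zt.
  by rewrite -opprD nrN.
apply: (ulim_le (ulimD Dx Dy')) => t t0; apply: filterS (fu_ge N) => k /= Nk.
have [_ h] := small_steps_tail hf Nk xN yN; apply: le_trans h _.
rewrite -[leLHS]addr0 lerD ?(ltW t0) // ler_wpM2r ?nr_ge0 //.
by have := e_gt0 k; lra.
Qed.

(* The differential of the limit is the limit of the differentials, taken here
   along the ultrafilter. *)
Lemma close_to_fder (f : nat -> V -> V) F z : (forall N, polymap (f N)) -> small_steps f -> close_to f F ->
  nr z < rho -> exists A, fder F z A.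
Proof.
move=> pf hs hF zr.
have /choice[A hA] : forall N, exists A, fder (f N) z A.
  by move=> N; have [A /sder_fder] := polymap_sder (pf N) z; exists A.
have [N0 hN0] : exists N, e N < (rho - nr z) / 4 by apply: e_small; rewrite divr_gt0 // subr_gt0.
pose d0 := rho - 2 * e N0 - nr z; have d00 : 0 < d0 by rewrite /d0; have := e_gt0 N0; lra.
have near N y : (N0 <= N)%N -> nr (y - z) < d0 -> nr y <= rho - 2 * e N.
  move=> /e_anti eN; rewrite /d0 => yz; have := nrD (y - z) z; rewrite subrK; lra.
have AN N k u : (N0 <= N)%N -> (N <= k)%N -> nr (u *m A k - u *m A N) <= 2 * e N * nr u.
  move=> N0N Nk; rewrite -mulmxBr; apply: (fder_bound d00 (fderB (hA k) (hA N))) => y yz.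
  have zz : nr (z - z) < d0 by rewrite subrr nr0.
  have [_ h] := small_steps_tail hs Nk (near N y N0N yz) (near N z N0N zz).
  apply: le_trans h _; rewrite ler_wpM2r ?nr_ge0 //; have := e_gt0 k; lra.
have /choice[L hL] : forall u, exists l, ulim (fun N => u *m A N) l.
  move=> u; apply: (@ulim_ex _ _ _ (nr (u *m A N0) + 2 * e N0 * nr u)).
  apply: filterS (fu_ge N0) => k /= Nk; have := AN N0 k u (leqnn _) Nk.
  rewrite -[u *m A k](subrK (u *m A N0)) => h; apply: le_trans (nrD _ _) _.
  by rewrite subrK in h; rewrite addrC lerD2l.
have LD u v : L (u + v) = L u + L v.
  apply: ulim_unique (hL _) _; apply: ulim_eq (ulimD (hL u) (hL v)).
  by apply: fu_all => k; rewrite mulmxDl.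
have L0 : L 0 = 0.
  by apply: ulim_unique (hL _) _; apply: ulim_eq (ulim_cst 0); apply: fu_all => k; rewrite mul0mx.
have LZ (c : C) u : L (c *: u) = c *: L u.
  apply: ulim_unique (hL _) _; apply: ulim_eq (ulim_cont (f := fun x => c *: x) _ (hL u)).
    by apply: fu_all => k /=; rewrite scalemxAl.
  exact: fder_cont (fder_scale c _).
pose B := \matrix_i L (delta_mx 0 i).
have BL u : u *m B = L u.
  rewrite [in RHS](row_sum_delta u) (big_morph L LD L0) mulmx_sum_row.
  by apply: eq_bigr => i _; rewrite rowK LZ.
exists B => w w0; have [N1 hN1] : exists N, e N < w / 8 by apply: e_small; rewrite divr_gt0.
pose N := maxn N0 N1; have N0N : (N0 <= N)%N by rewrite leq_maxl.
have eN : e N < w / 8 by apply: le_lt_trans hN1; apply: e_anti; rewrite leq_maxr.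
have w4 : 0 < w / 4 by rewrite divr_gt0.
have [d d1 hd] := hA N _ w4.
exists (Num.min d d0); first by rewrite lt_min d1.
move=> y; rewrite lt_min => /andP[/hd yd yd0].
have zz : nr (z - z) < d0 by rewrite subrr nr0.
have [_ h1] := hF N y z (near N y N0N yd0) (near N z N0N zz).
have h2 : nr (L (y - z) - (y - z) *m A N) <= 2 * e N * nr (y - z).
  apply: (ulim_le (ulimD (hL (y - z)) (ulim_cst (- ((y - z) *m A N))))) => t t0.
  by apply: filterS (fu_ge N) => k /= Nk; have := AN N k (y - z) N0N Nk; lra.
rewrite BL; set u := y - z in yd h1 h2 *.
have -> : F y - F z - L u = (F y - f N y - (F z - f N z)) + (f N y - f N z - u *m A N)
    + (u *m A N - L u).
  have -> : F y - f N y - (F z - f N z) = (F y - F z) - (f N y - f N z) by rewrite !opprD addrACA.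
  by move: (F y - F z) (f N y - f N z) => p q; rewrite ![_ + (_ - _)]addrA !subrK.
rewrite nrB in h2.
apply: le_trans (nrD _ _) _; apply: le_trans (lerD (nrD _ _) h2) _.
apply: le_trans (lerD (lerD h1 yd) (lexx _)) _.
by rewrite -!mulrDl ler_wpM2r ?nr_ge0 //; clear - eN w0; lra.
Qed.

End Limit.

(** * The targets to approximate and the initial stage *)

Section Sequences.
Variables (R : realType) (m : nat).
Local Notation C := R[i].
Local Notation V := 'rV[C]_m.
Implicit Types (x y z u v w : V).

Lemma rational_approx x (t : R) : 0 < t -> exists q : 'rV[rat * rat]_m,
  nr (\row_j (ratr (q 0 j).1 +i* ratr (q 0 j).2)%C - x) < t.
Proof.
move=> t0; have m1 : 0 < m.+1%:R :> R by [].
pose s := t / (2 * m.+1%:R); have s0 : 0 < s by rewrite divr_gt0 // mulr_gt0.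
have sE : m.+1%:R * (2 * s) = t by rewrite /s; move: m1; clear; move: (m.+1%:R) => a a0; field; rewrite gt_eqF.
have /choice[q hq] : forall j, exists q : rat * rat,
    cm ((ratr q.1 +i* ratr q.2)%C - x 0 j) <= 2 * s.
  have ap (a : R) : exists q : rat, `|ratr q - a| < s.
    have [|q /[!in_itv]/= /andP[h1 h2]] := @rat_in_itvoo R (a - s) (a + s); first lra.
    by exists q; rewrite ltr_norml; apply/andP; split; lra.
  move=> j; have [q1 h1] := ap (complex.Re (x 0 j)); have [q2 h2] := ap (complex.Im (x 0 j)).
  exists (q1, q2); apply: le_trans (cm_ReIm _) _.
  by rewrite cReD cReN cImD cImN /=; lra.
exists (\row_j q j).
apply: le_lt_trans (nr_le_bound (b := 2 * s) _) _.
  by move=> j; rewrite !mxE; exact: hq.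
by rewrite -sE ltr_pM2r ?mulr_gt0 // ltr_nat.
Qed.

(** Each rational point must recur at late indices, because the error of stage [N] tends to 0 only
    with [N]. The exponent of 2 in [N.+1] codes the point, and a factor [3 ^ N0] makes the index
    late. *)
Lemma dense_sequence : exists d : nat -> V, (forall N, nr (d N) < 1) /\
  forall x (t : R) N0, nr x < 1 -> 0 < t -> exists2 N, (N0 <= N)%N & nr (d N - x) < t.
Proof.
pose c (q : 'rV[rat * rat]_m) : V := \row_j (ratr (q 0 j).1 +i* ratr (q 0 j).2)%C.
exists (fun N => if unpickle (logn 2 N.+1) is Some q then if nr (c q) < 1 then c q else 0 else 0).
split=> [N|x t N0 x1 t0].
  case: unpickle => [q|]; last by rewrite nr0.
  by case: ifP => // _; rewrite nr0.
have t'0 : 0 < Num.min t (1 - nr x) by rewrite lt_min t0 subr_gt0.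
have [q] := rational_approx x t'0; rewrite -/(c q) lt_min => /andP[q1 q2].
have N1 : (0 < 2 ^ pickle q * 3 ^ N0)%N by rewrite muln_gt0 !expn_gt0.
exists (2 ^ pickle q * 3 ^ N0).-1.
  rewrite -ltnS prednK //; apply: leq_trans (ltn_expl N0 (isT : 1 < 3)%N) _.
  by rewrite leq_pmull // expn_gt0.
rewrite prednK // lognM ?expn_gt0 // !lognX !logn_prime //= muln0 muln1 addn0 pickleK.
rewrite (_ : nr (c q) < 1) //.
by have := nrD (c q - x) x; rewrite subrK; lra.
Qed.

(** The identity and a translation of length 3: the closed unit ball is disjoint from its translate,
    so not even one link exists. The bound 4 is 1 + 3. *)
Lemma initial_stage : (1 <= m)%N ->
  exists (Phi h : V -> V), stage Phi h 1 1 4 [:: 0].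
Proof.
move=> hm; pose c : V := 3%:C%C *: delta_mx 0 (Ordinal hm).
have c3 : 3 <= nr c.
  apply: le_trans (cm_le_nr c (Ordinal hm)).
  by rewrite !mxE !eqxx mulr1 cm_real ger0_norm.
have c3' : nr c <= 3.
  rewrite nrZ cm_real ger0_norm // ler_piMr //.
  rewrite -(@ler_pXn2r _ 2) ?nnegrE ?nr_ge0 // nr_sqr expr1n (bigD1 (Ordinal hm)) //= !mxE !eqxx cm1.
  rewrite expr1n big1 ?addr0 // => j jm; rewrite mxE (negPf jm) andbF cm0 expr0n //.
clearbody c.
exists (fun x => x + 0), (fun x => x + c); split=> //.
- exact: pm_tr.
- exact: pm_tr.
- by move=> x y _ _; rewrite !addr0 mul1r Redotxx.
- exists 1, 1; split=> // x y _ _ _.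
  by rewrite mul1r opprD addrACA subrr addr0.
- move=> [x [xr hx]]; have := hx 0%N; rewrite addr0 => E.
  have := nrD (x 1%N) (- x 0%N); rewrite -E addrC addKr nrN E.
  by have := xr 0%N; have := xr 1%N; lra.
- by move=> x xr; rewrite addr0; lra.
- by move=> x xr; apply: le_trans (nrD _ _) _; lra.
- by move=> q /[!inE] /eqP ->; rewrite nr0.
- by move=> x xr; rewrite /= addr0 add0r => E; move: xr; rewrite E; lra.
Qed.

End Sequences.

(** * The sequence of stages and the limit maps *)

Section Sequence.
Variables (R : realType) (m : nat).
Local Notation C := R[i].
Local Notation V := 'rV[C]_m.
Implicit Types (x y z u v w : V).

Variables (e : nat -> R) (d : nat -> V).
Hypotheses (e0 : e 0%N = 1 / 4) (e_gt0 : forall N, 0 < e N)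
  (eS : forall N, e N.+1 = e N / 2) (d1 : forall N, nr (d N) < 1).

(** Stage [N] spends [ka = e N], in total 2 e_0 = 1/2: the monotonicity constant goes from 1 down
    towards 1/2 and the bound from 4 up towards 9/2. *)
Lemma stage_sequence : (1 <= m)%N ->
  exists (Phi h : nat -> V -> V) (rho r : nat -> R) (qs : nat -> seq V) (M : R),
  [/\ forall N, stage (Phi N) (h N) (rho N) (1 / 2 + 2 * e N) (M - 2 * e N) (qs N),
    forall N, [/\ rho N - e N < r N, r N < rho N.+1, rho N.+1 < rho N &
      forall q, q \in qs N -> nr q < r N],
    forall N, exists ext, [/\ qs N.+1 = qs N ++ ext, exists2 q, q \in ext & nr q = r N &
      exists2 q, q \in ext & nr (q - (r N)%:C%C *: d N) <= e N],
    forall N x y, nr x <= r N - e N -> nr y <= r N - e N ->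
      nr (Phi N.+1 x - Phi N x) <= e N /\
      nr ((Phi N.+1 x - Phi N x) - (Phi N.+1 y - Phi N y)) <= e N * nr (x - y) &
    forall N x y, nr x <= r N - e N -> nr y <= r N - e N ->
      nr (h N.+1 x - h N x) <= e N /\
      nr ((h N.+1 x - h N x) - (h N.+1 y - h N y)) <= e N * nr (x - y)].
Proof.
move=> hm; have [Phi0 [h0 st0]] := initial_stage R hm.
pose T := ((V -> V) * (V -> V) * R * seq V)%type.
pose P N (s : T) := stage s.1.1.1 s.1.1.2 s.1.2 (1 / 2 + 2 * e N) (9 / 2 - 2 * e N) s.2.
have P0 : P 0%N (Phi0, h0, 1, [:: 0]).
  rewrite /P /= e0 (_ : 1 / 2 + 2 * (1 / 4) = 1); last by field.
  by rewrite (_ : 9 / 2 - 2 * (1 / 4) = 4); last by field.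
pose Q N (s s' : T) (r : R) := [/\ P N.+1 s',
  [/\ s.1.2 - e N < r, r < s'.1.2, s'.1.2 < s.1.2 & forall q, q \in s.2 -> nr q < r],
  exists ext, [/\ s'.2 = s.2 ++ ext, exists2 q, q \in ext & nr q = r &
      exists2 q, q \in ext & nr (q - r%:C%C *: d N) <= e N],
  forall x y, nr x <= r - e N -> nr y <= r - e N ->
      nr (s'.1.1.1 x - s.1.1.1 x) <= e N /\
      nr ((s'.1.1.1 x - s.1.1.1 x) - (s'.1.1.1 y - s.1.1.1 y)) <= e N * nr (x - y) &
  forall x y, nr x <= r - e N -> nr y <= r - e N ->
      nr (s'.1.1.2 x - s.1.1.2 x) <= e N /\
      nr ((s'.1.1.2 x - s.1.1.2 x) - (s'.1.1.2 y - s.1.1.2 y)) <= e N * nr (x - y)].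
have /choice[g hg] : forall p : nat * T, exists s'r : T * R, P p.1 p.2 -> Q p.1 p.2 s'r.1 s'r.2.
  move=> [N s] /=; have [Ps|nP] := pselect (P N s); last by exists (s, 0).
  have eN := e_gt0 N; have eN' : e N < 1 / 2 + 2 * e N by lra.
  have [Phi' [h' [rho' [r [ext [st [h1 h2 h3 h4 h5] h6 h7 h8]]]]]] := stage_step Ps eN eN' (d1 N).
  exists (Phi', h', rho', s.2 ++ ext, r) => _; split=> //=; last by exists ext.
  rewrite /P /= eS (_ : 1 / 2 + 2 * (e N / 2) = 1 / 2 + 2 * e N - e N); last by field.
  by rewrite (_ : 9 / 2 - 2 * (e N / 2) = 9 / 2 - 2 * e N + e N); last by field.
pose S : nat -> T := nat_rect (fun=> T) (Phi0, h0, 1, [:: 0]) (fun N s => (g (N, s)).1).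
have PS N : P N (S N).
  by elim: N => [|N IH] //; have [] := hg (N, S N) IH.
have QS N : Q N (S N) (S N.+1) (g (N, S N)).2 := hg (N, S N) (PS N).
clearbody S.
exists (fun N => (S N).1.1.1), (fun N => (S N).1.1.2), (fun N => (S N).1.2),
  (fun N => (g (N, S N)).2), (fun N => (S N).2), (9 / 2).
split=> N; first exact: PS.
all: by have [] := QS N.
Qed.

(** The radii [r N] increase, the radii [rho N] decrease and [rho N - e N < r N], so they have a
    common limit [ri]. A chain point has norm below some [r N < ri] and stays in the open limit
    ball. *)
Lemma limit_maps : (1 <= m)%N -> exists (Phi h : V -> V) (rho M : R) (q : nat -> V),
  [/\ 0 < rho, [/\ forall x y, nr x < rho -> nr y < rho ->
      1 / 2 * nr (x - y) ^+ 2 <= complex.Re (dot (Phi x - Phi y) (x - y)),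
    forall z, nr z < rho -> exists A, fder Phi z A,
    forall z, nr z < rho -> exists A, fder h z A & forall x, nr x < rho -> nr (Phi x) <= M],
  forall n, nr (q n) < rho, forall n, h (q n) = Phi (q n.+1) &
  (forall x (t : R) N0, nr x < 1 -> 0 < t -> exists2 N, (N0 <= N)%N & nr (d N - x) < t) ->
  forall x (t : R), nr x < rho -> 0 < t -> exists n, nr (q n - x) < t].
Proof.
move=> hm; have [Phi [h [rho [r [qs [M [st hr hext incP inch]]]]]]] := stage_sequence hm.
have esmall := e_small e_gt0 eS.
have rS N : r N < r N.+1.
  have [ext [E [q qe qr] _]] := hext N; have [_ _ _ hq] := hr N.+1.
  by rewrite -qr; apply: hq; rewrite E mem_cat qe orbT.
have r_mono N k : (N <= k)%N -> r N <= r k.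
  move=> Nk; rewrite -(subnK Nk); elim: (k - N)%N => // j IH.
  by rewrite addSn; apply: le_trans IH (ltW (rS _)).
have rho_anti N k : (N <= k)%N -> rho k <= rho N.
  move=> Nk; rewrite -(subnK Nk); elim: (k - N)%N => // j IH.
  by rewrite addSn; apply: le_trans IH; have [_ _ /ltW] := hr (j + N)%N.
have r_rho N k : r N <= rho k.
  have [Nk|/ltnW kN] := leqP N k; last first.
    apply: le_trans (rho_anti _ _ kN); have [_ /ltW h1 /ltW h2 _] := hr N; exact: le_trans h2.
  by apply: le_trans (r_mono _ _ Nk) _; have [_ /ltW h1 /ltW h2 _] := hr k; exact: le_trans h2.
pose ri := sup (range r).
have hs : has_sup (range r).
  by split; [exists (r 0%N); exists 0%N|exists (rho 0%N) => _ [N _ <-]].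
have r_ri N : r N < ri.
  by apply: lt_le_trans (rS N) _; apply: ub_le_sup; [case: hs|exists N.+1].
have ri_rho N : ri <= rho N by apply: ge_sup; [case: hs|move=> _ [k _ <-]].
have ri_r N : ri < r N + e N by have := ri_rho N; have [+ _ _ _] := hr N; lra.
have r0 : 0 <= r 0%N.
  by have [ext [_ [q0 _ q0r] _]] := hext 0%N; rewrite -q0r nr_ge0.
have ri0 : 0 < ri by apply: le_lt_trans (r_ri 0%N).
clearbody ri.
have sP : small_steps ri e Phi.
  by move=> N x y xr yr; apply: incP; have := ri_r N; lra.
have sh : small_steps ri e h.
  by move=> N x y xr yr; apply: inch; have := ri_r N; lra.
have [Pi cP] := small_steps_limit e_gt0 eS sP.
have [hi ch] := small_steps_limit e_gt0 eS sh.
have level x : nr x < ri -> exists N0, forall N, (N0 <= N)%N -> nr x <= ri - 2 * e N.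
  move=> xr; have [|N0 hN0] := esmall ((ri - nr x) / 2); first by rewrite divr_gt0 // subr_gt0.
  by exists N0 => N /(e_anti e_gt0 eS); lra.
have qs_size N : (N < size (qs N))%N.
  elim: N => [|N IH]; first exact: stage_size (st 0%N).
  have [ext [-> [q qe _] _]] := hext N; rewrite size_cat.
  by case: ext qe => // a ext _; rewrite addnS ltnS; apply: leq_trans IH (leq_addr _ _).
have qs_nth N k i : (N <= k)%N -> (i < size (qs N))%N ->
    (i < size (qs k))%N /\ nth 0 (qs k) i = nth 0 (qs N) i.
  move=> Nk iN; rewrite -(subnK Nk); elim: (k - N)%N => // j [IH1 IH2].
  have [ext [E _ _]] := hext (j + N)%N; rewrite addSn E size_cat nth_cat IH1.
  by split=> //; apply: leq_trans IH1 (leq_addr _ _).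
(* The chains extend each other and [qs n] has more than [n] entries, so the diagonal enumerates all
   of them. *)
pose q n := nth 0 (qs n) n.
have qE N i : (i < size (qs N))%N -> nth 0 (qs N) i = q i.
  rewrite /q => iN; have [_ <-] := qs_nth N (maxn N i) i (leq_maxl _ _) iN.
  by have [_ <-] := qs_nth i (maxn N i) i (leq_maxr _ _) (qs_size i).
have qr n : nr (q n) < ri.
  have [_ _ _ hq] := hr n; apply: lt_trans (r_ri n); apply: hq.
  by apply: mem_nth; exact: qs_size.
exists Pi, hi, ri, (M + 2 * e 0%N), q; split=> //; first split.
- move=> x y xr yr; have [N1 h1] := level x xr; have [N2 h2] := level y yr.
  pose N := maxn N1 N2; have xN := h1 N (leq_maxl _ _); have yN := h2 N (leq_maxr _ _).
  have [_ hl] := cP N x y xN yN.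
  have xr' : nr x <= rho N by apply/ltW; apply: lt_le_trans xr (ri_rho N).
  have yr' : nr y <= rho N by apply/ltW; apply: lt_le_trans yr (ri_rho N).
  have h3 := stage_monot (st N) xr' yr'; rewrite mulrDl in h3.
  have -> : Pi x - Pi y = (Phi N x - Phi N y) + ((Pi x - Phi N x) - (Pi y - Phi N y)).
    by rewrite addrACA -opprD !(addrC (Phi N _)) !subrK.
  rewrite dotDl cReD.
  have h4 := Redot_le (- ((Pi x - Phi N x) - (Pi y - Phi N y))) (x - y).
  rewrite dotNl cReN nrN in h4.
  have h5 : nr ((Pi x - Phi N x) - (Pi y - Phi N y)) * nr (x - y) <= 2 * e N * nr (x - y) ^+ 2.
    by rewrite expr2 mulrA ler_wpM2r ?nr_ge0.
  move: h3 h4 h5; clear; move: (nr (x - y) ^+ 2) => a h3 h4 h5; lra.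
- by move=> z; apply: (close_to_fder e_gt0 eS _ sP cP) => N; exact: stage_Phi (st N).
- by move=> z; apply: (close_to_fder e_gt0 eS _ sh ch) => N; exact: stage_h (st N).
- move=> x xr; have [N hN] := level x xr; have xN := hN N (leqnn _).
  have [h1 _] := cP N x x xN xN.
  have xr' : nr x <= rho N by apply/ltW; apply: lt_le_trans xr (ri_rho N).
  have h2 := stage_Phi_le (st N) xr'.
  have := nrD (Pi x - Phi N x) (Phi N x); rewrite subrK; have := e_gt0 0%N.
  move: h1 h2; clear; lra.
- move=> n; have [N1 h1] := level _ (qr n); have [N2 h2] := level _ (qr n.+1).
  apply/eqP; rewrite -subr_eq0; apply/eqP; apply: nr_eq0; apply/eqP; rewrite eq_le nr_ge0 andbT.
  apply/ler_addgt0Pr => c c0; rewrite add0r.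
  have [|N3 h3] := esmall (c / 4); first by rewrite divr_gt0.
  pose N := maxn (maxn N1 N2) (maxn N3 n.+1).
  have qN := h1 N (leq_trans (leq_maxl _ _) (leq_maxl _ _)).
  have qN' := h2 N (leq_trans (leq_maxr _ _) (leq_maxl _ _)).
  have eN : e N <= e N3.
    by apply: (e_anti e_gt0 eS); apply: leq_trans (leq_maxl _ _) (leq_maxr _ _).
  have nN : (n.+1 < size (qs N))%N.
    by apply: leq_ltn_trans (qs_size N); apply: leq_trans (leq_maxr _ _) (leq_maxr _ _).
  have := stage_chain (st N) nN; rewrite !qE ?(ltnW nN) // => E.
  have [h4 _] := ch N _ _ qN qN; have [h5 _] := cP N _ _ qN' qN'.
  have := nr_tri (hi (q n)) (h N (q n)) (Pi (q n.+1)); rewrite E (nrB (Phi N _)).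
  rewrite E in h4; move: h3 h4 h5 eN; clear; lra.
(* Stage [N] places a chain point near [r N] times [d N]; at a late [N] with [d N] near x / ri this
   is close to [x], as [r N] is within [e N] of [ri]. *)
- move=> hd x t xr t0.
  have x1 : nr (ri^-1%:C%C *: x) < 1.
    by rewrite nrZ cm_real gtr0_norm ?invr_gt0 // mulrC ltr_pdivrMr // mul1r.
  have [|N0 hN0] := esmall (t / 4); first by rewrite divr_gt0.
  have [|N N0N hN] := hd _ (t / (4 * ri)) N0 x1; first by rewrite divr_gt0 // mulr_gt0.
  have eN := e_anti e_gt0 eS N0N.
  have [ext [E _ [p pe hp]]] := hext N.
  have pq : p \in qs N.+1 by rewrite E mem_cat pe orbT.
  exists (index p (qs N.+1)); rewrite -(qE N.+1) ?index_mem // nth_index //.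
  have h1 : nr ((r N)%:C%C *: d N - ri%:C%C *: d N) <= e N.
    rewrite -scalerBl -rmorphB nrZ cm_real -[leRHS]mulr1.
    apply: ler_pM; rewrite ?nr_ge0 ?(ltW (d1 N)) // ler_norml.
    by have := r_ri N; have := ri_r N; move=> *; apply/andP; split; lra.
  have h2 : nr (ri%:C%C *: d N - x) < t / 4.
    have {1}-> : x = ri%:C%C *: (ri^-1%:C%C *: x).
      by rewrite scalerA -rmorphM divff ?gt_eqF // scale1r.
    rewrite -scalerBr nrZ cm_real gtr0_norm // mulrC -ltr_pdivlMr //.
    by apply: lt_le_trans hN _; rewrite invfM mulrA.
  apply: le_lt_trans (nr_tri _ ((r N)%:C%C *: d N) _) _.
  apply: le_lt_trans (lerD hp (nr_tri _ (ri%:C%C *: d N) _)) _.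
  apply: (@lt_le_trans _ _ (e N + (e N + t / 4))); first by rewrite ltrD2l ler_ltD.
  by clear - hN0 eN t0; lra.
Qed.

End Sequence.

(** * The inverse of the limit map, the domain and the orbit *)

Lemma fder_inverse (R : realType) (m : nat) (f g : 'rV[R[i]]_m -> 'rV[R[i]]_m) z A (be t : R) :
  fder f z A -> A \in unitmx -> 0 < be -> 0 < t -> g (f z) = z ->
  (forall y, nr (y - f z) < t -> f (g y) = y /\ be * nr (g y - z) <= nr (y - f z)) ->
  fder g (f z) (invmx A).
Proof.
move=> hf Au be0 t0 gz hg w w0; have [K K0 hK] := nr_mulmx (invmx A).
have w'0 : 0 < w * be / K by rewrite divr_gt0 // mulr_gt0.
have [d d0 hd] := hf _ w'0.
exists (Num.min t (be * d)); first by rewrite lt_min t0 mulr_gt0.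
move=> y; rewrite lt_min => /andP[/hg[fy gy] yd].
have /hd : nr (g y - z) < d by rewrite -(ltr_pM2l be0); apply: le_lt_trans yd.
rewrite fy => h.
(* The remainder of [g] is minus the remainder of [f] at [g y], carried by [invmx A]; the expansion
   of [f] then turns [nr (g y - z)] into [nr (y - f z)]. *)
have -> : g y - g (f z) - (y - f z) *m invmx A = - ((y - f z - (g y - z) *m A) *m invmx A).
  by rewrite [in RHS]mulmxBl mulmxK // gz opprB.
rewrite nrN; apply: le_trans (hK _) _.
apply: le_trans (ler_wpM2l (ltW K0) h) _; apply: le_trans (ler_wpM2l (ltW w0) gy).
have -> : K * (w * be / K * nr (g y - z)) = w * (be * nr (g y - z)) by field; rewrite gt_eqF.
exact: lexx.
Qed.

Theorem theorem1p2 (R : realType) (m : nat) (hm : (1 <= m)%N) :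
  exists U : set 'rV[R[i]]_m,
    [/\ domain U, bounded_set U, biholomorphic U (@unit_ball R m) &
      exists F : 'rV[R[i]]_m -> 'rV[R[i]]_m,
        holomorphic_on U F /\
        exists p : nat -> 'rV[R[i]]_m,
          [/\ forall n, U (p n),
              U `<=` closure (range p) &
              forall n, F (p n) = p n.+1]].
Proof.
have [d [d1 dd]] := dense_sequence R m.
pose e (N : nat) : R := 2^-1 ^+ N / 4.
have e0 : e 0%N = 1 / 4 by rewrite /e expr0.
have e_gt0 N : 0 < e N by rewrite divr_gt0 // exprn_gt0.
have eS N : e N.+1 = e N / 2 by rewrite /e exprSr mulrAC.
have [Phi [h [rho [M [q [rho0 [mon dP dh PM] qr hq /(_ dd) qd]]]]]] := limit_maps e0 e_gt0 eS d1 hm.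
clear e e0 e_gt0 eS d d1 dd.
(* Monotonicity holds on the open ball; the closed ball whose radius is the larger of the two norms
   lies inside it. *)
have expand x y : nr x < rho -> nr y < rho -> 1 / 2 * nr (x - y) <= nr (Phi x - Phi y).
  move=> xr yr; apply: (@monot_expand _ _ _ (Num.max (nr x) (nr y))); last 2 first.
  - by rewrite le_max lexx.
  - by rewrite le_max lexx orbT.
  by move=> u v ur vr; apply: mon; [apply: le_lt_trans ur _|apply: le_lt_trans vr _];
    rewrite gt_max xr.
have Pinj x y : nr x < rho -> nr y < rho -> Phi x = Phi y -> x = y.
  move=> xr yr E; have := expand x y xr yr; rewrite E subrr nr0 pmulr_rle0 // => h0.
  by apply/eqP; rewrite -subr_eq0; apply/eqP/nr_eq0/eqP; rewrite eq_le h0 nr_ge0.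
(* The inverse of [Phi] as a total function, with the value 0 available off the image. *)
have /choice[g hg] : forall y, exists x, (exists2 x', nr x' < rho & Phi x' = y) ->
    nr x < rho /\ Phi x = y.
  move=> y; have [[x xr xy]|hn] := pselect (exists2 x', nr x' < rho & Phi x' = y).
    by exists x.
  by exists 0.
have gK x : nr x < rho -> g (Phi x) = x.
  by move=> xr; have [|g1 g2] := hg (Phi x); [exists x|exact: Pinj].
have inball (z r : 'rV[R[i]]_m) : nr (z - r) <= (rho - nr r) / 2 -> nr r < rho -> nr z < rho.
  by move=> zr rr; have := nrD (z - r) r; rewrite subrK; lra.
have Punit z A : nr z < rho -> fder Phi z A -> A \in unitmx.
  move=> zr hA; apply: (@unitmx_expand _ _ _ (1 / 2)) => // u.
  apply: (@fder_expand _ _ Phi z A (1 / 2) ((rho - nr z) / 2)) => // [|y yz].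
    by rewrite divr_gt0 // subr_gt0.
  by apply: expand => //; exact: inball yz zr.
have Popen x : nr x < rho -> exists2 t : R, 0 < t &
    forall y, nr (y - Phi x) < t -> exists2 x', nr x' < rho & Phi x' = y.
  move=> xr; have r0 : 0 < (rho - nr x) / 2 by rewrite divr_gt0 // subr_gt0.
  have be0 : 0 < 1 / 2 :> R by [].
  exists (1 / 2 * ((rho - nr x) / 2) / 2) => [|y yt]; first by rewrite divr_gt0 // mulr_gt0.
  have [||x' x'r <-] := @local_surjection R m Phi x _ _ r0 be0 _ _ y yt.
  - by move=> z zx; apply: expand => //; exact: inball zx xr.
  - move=> z zx; have zr := inball z x zx xr; have [A hA] := dP z zr.
    by exists A => //; exact: Punit hA.
  by exists x' => //; apply: inball (ltW x'r) xr.
have gder x : nr x < rho -> exists A, fder g (Phi x) A.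
  move=> xr; have [A hA] := dP x xr; have [t t0 ht] := Popen x xr; exists (invmx A).
  apply: (fder_inverse hA (Punit x A xr hA) (_ : 0 < 1 / 2) t0 (gK x xr)) => // y /ht hy.
  by have [g1 g2] := hg y hy; split=> //; have := expand (g y) x g1 xr; rewrite g2.
have Pcont z : nr z < rho -> forall e : R, 0 < e -> exists2 d : R, 0 < d &
    forall y, nr (y - z) < d -> nr (Phi y - Phi z) < e.
  by move=> /dP[A hA]; exact: fder_cont hA.
have rhoV (c : R) : c != 0 -> forall x : 'rV[R[i]]_m, c%:C%C *: (c^-1%:C%C *: x) = x.
  by move=> c0 x; rewrite scalerA -rmorphM divff // scale1r.
have rhon0 : rho != 0 by rewrite gt_eqF.
have rhoM (z : 'rV[R[i]]_m) : nr z < 1 -> nr (rho%:C%C *: z) < rho.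
  by move=> z1; rewrite nrZ cm_real gtr0_norm // -[ltRHS]mulr1 ltr_pM2l.
exists (Phi @` [set x | nr x < rho]); split.
- split; last exact: image_ball_connected.
  by rewrite openE => _ [x xr <-]; apply/nbhs_nr; exact: Popen.
- by apply: (bounded_nr (M := M)) => _ [x xr <-]; exact: PM.
- rewrite unit_ballE.
  exists (fun p => rho^-1%:C%C *: g p), (fun z => Phi (rho%:C%C *: z)); split.
  + move=> _ [x xr <-]; have [A hA] := gder x xr.
    exact: fder_differentiable (fder_comp hA (fder_scale rho^-1%:C%C (g (Phi x)))).
  + split=> [_ [x xr <-]|y y' /[!inE] -[x xr <-] [x' xr' <-]|z /= z1].
    * by rewrite /= gK // nrZ cm_real gtr0_norm ?invr_gt0 // mulrC ltr_pdivrMr // mul1r.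
    * by rewrite !gK // => /(congr1 (fun u => rho%:C%C *: u)); rewrite !rhoV // => ->.
    * exists (Phi (rho%:C%C *: z)); first by exists (rho%:C%C *: z) => //=; exact: rhoM.
      by rewrite gK ?rhoM // scalerA -rmorphM mulVf // scale1r.
  + move=> z /= z1; have [A hA] := dP _ (rhoM z z1).
    exact: fder_differentiable (fder_comp (fder_scale rho%:C%C z) hA).
  + by move=> y /[!inE] -[x xr <-]; rewrite rhoV // gK.
exists (h \o g); split.
  move=> _ [x xr <-]; have [A hA] := gder x xr; have [B hB] := dh x xr.
  by apply: fder_differentiable (fder_comp hA _); rewrite gK //; exact: hB.
exists (fun n => Phi (q n)); split=> [n||n]; last by rewrite /= gK ?hq.
  by exists (q n) => //; exact: qr.
move=> _ [x xr <-] B /nbhs_nr[t t0 hB]; have [d d0 hd] := Pcont x xr t t0.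
have [n qn] := qd x d xr d0.
by exists (Phi (q n)); split; [exists n|exact/hB/hd].
Qed.
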